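(* Let $k\in\{1,2\}$ and let $\Delta_k(n)$ be defined by \[\sum_{n=0}^{\infty}\Delta_k(n)q^n=\prod_{n=1}^{\infty}\frac{(1-q^{2n})(1-q^{(2k+1)n})}{(1-q^n)^3(1-q^{(4k+2)n})}.\] Put $x_k(n)=\frac{\pi\sqrt{24n-(2k+2)}}{6}$, $\alpha_k(1)=\frac{5k+2}{2k+1}$, and \[M_k(n)=\frac{\alpha_k(1)\pi^3}{18x_k^2(n)}\,I_2\!\left(\sqrt{\alpha_k(1)}\,x_k(n)\right).\] Then for every positive integer $n$ with $x_k(n)\ge152$, \[M_k(n)\left(1-\frac{1}{x_k^6(n)}\right)\le\Delta_k(n)\le M_k(n)\left(1+\frac{1}{x_k^6(n)}\right).\]
   Context: $\Delta_k(n)$ is the number of broken $k$-diamond partitions of $n$ (in the sense of Andrews and Paule), whose generating function is the product displayed. $I_2$ is the modified Bessel function of the first kind of order 2, $I_\nu(s)=\sum_{r\ge0}\frac{1}{r!\,\Gamma(r+\nu+1)}(s/2)^{2r+\nu}$. *)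

(* Defs.v *)
From Stdlib Require Import Reals Factorial Lra Lia.
From Coquelicot Require Import Coquelicot.
Open Scope R_scope.

Definition diamond_factor (k : nat) (q : R) (m : nat) : R :=
  ((1 - q ^ (2 * m)) * (1 - q ^ ((2 * k + 1) * m))) /
  ((1 - q ^ m) ^ 3 * (1 - q ^ ((4 * k + 2) * m))).

(* Sum_n Delta(n) q^n = prod_(m >= 1) diamond_factor k q m for |q| < 1, with
   convergence of both sides; this determines [Delta] uniquely.
   [prod_f_R0 f N] is [f 0 * ... * f N], hence the index shift. *)
Definition is_broken_diamond (k : nat) (Delta : nat -> R) : Prop :=
  forall q : R, Rabs q < 1 ->
    exists l : R,
      is_lim_seq (fun N => prod_f_R0 (fun i => diamond_factor k q (S i)) N) l /\
      is_series (fun n => Delta n * q ^ n) l.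

(* Only meaningful for s > 0, where the integral converges. *)
Definition Gamma (s : R) : R :=
  RInt_gen (fun t => Rpower t (s - 1) * exp (- t))
    (at_right 0) (Rbar_locally p_infty).

Definition besselI (nu : nat) (s : R) : R :=
  Series (fun r =>
    1 / (INR (fact r) * Gamma (INR r + INR nu + 1)) * (s / 2) ^ (2 * r + nu)).

Definition xk (k n : nat) : R :=
  PI * sqrt (24 * INR n - (2 * INR k + 2)) / 6.

(* The value alpha_k(1). *)
Definition alpha1 (k : nat) : R := (5 * INR k + 2) / (2 * INR k + 1).

Definition Mk (k n : nat) : R :=
  alpha1 k * PI ^ 3 / (18 * xk k n ^ 2) * besselI 2 (sqrt (alpha1 k) * xk k n).

(* Main.v *)
Require Import Defs.
From Stdlib Require Import Reals.
From Coquelicot Require Import Coquelicot.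
From Stdlib Require Import Lra Lia Psatz Factorial.
Open Scope R_scope.

(** With [q = exp (- z)] the generating function is an eta quotient of weight [-1]. Its logarithm is
    a combination of the series [Lam z = sum_j 1 / (j (exp (j z) - 1))], whose derivative is the
    weight two Eisenstein series. Eisenstein's method of subtracting a telescoping double series gives
    the transformation of the latter under [z -> 4 PI^2 / z], anomalous term [- 1 / (2 z)] included;
    integrating back, the generating function equals [z / (2 PI) exp (A / z - B z) (1 + small)] with
    [A = PI^2 alpha / 6] and [B = (2 k + 2) / 24].

    The coefficient is then a contour integral. Near the real axis the contour is an arc of the circle
    [|z| = sqrt (A / N)], [N = n - B], through the saddle point, on which [A / z + N z] is real: there
    the main factor is the integrand of [I_2 = 1 / PI int_0^PI cos (2 t) exp (y cos t) dt], and for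
    [k <= 2] the first correction of the dual product does not grow at all. On the vertical rest of
    the contour the transformation formula handles [Im z <= 10 Re z]; farther out, the term [j = 1] of
    [Lam] alone, compared with its value on the real axis, loses enough. All errors are
    [O (exp (1.527 Y))] against a main term of size [exp (2 Y)], where [2 Y = sqrt alpha * x_k (n)]. *)

(** * Complex sequences and absolutely convergent series *)

(** With [s = 2 k + 1] the four factors of the product have scales [1, 2 s, 2, s] and enter the
    logarithm with multiplicities [3, 1, -1, -1]. Weighting by inverse scales gives [5/2 - 1/(2 s)],
    which is [alpha]; weighting by scales gives [1 + s = 24 B].

    Neither a complex logarithm nor Cauchy's theorem occurs. Identities on the half-plane are proved
    by showing that a quotient has derivative 0 and evaluating it at one point; for the
    transformation this is [2 PI], the fixed point of the duality. The contour integral is evaluated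
    term by term, since each [exp ((n - l) z)] has an explicit primitive.

    The threshold 152 gives [Y >= 116]. A relative error [x ^ (-6)] then requires [exp (0.473 Y)],
    where [0.473 = 2 - 1.527], to exceed a constant times [Y ^ 9]: six powers stand for [x ^ 6],
    three for the algebraic factors in the lower bound of the main term. At [Y = 116] this holds
    with room to spare. *)

Definition clim (u : nat -> C) (l : C) : Prop :=
  forall eps, 0 < eps -> exists N, forall n, (N <= n)%nat -> Cmod (u n - l)%C < eps.

(** Half-open convention: [csum a n] has [n] terms while [sum_f_R0 a n] has [n + 1], whence the
    [S n] in the conversions between them. *)
Fixpoint csum (a : nat -> C) (n : nat) : C :=
  match n with O => RtoC 0 | S p => (csum a p + a p)%C end.

Definition summ (a : nat -> C) : Prop := ex_series (fun n => Cmod (a n)).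

Definition CSer (a : nat -> C) : C :=
  (Series (fun n => Re (a n)), Series (fun n => Im (a n))).

Lemma C_eq (z w : C) : Re z = Re w -> Im z = Im w -> z = w.
Proof. destruct z, w; simpl; intros; subst; reflexivity. Qed.

Lemma Re_Cplus (z w : C) : Re (z + w)%C = Re z + Re w.
Proof. reflexivity. Qed.

Lemma Im_Cplus (z w : C) : Im (z + w)%C = Im z + Im w.
Proof. reflexivity. Qed.

Lemma Re_Cminus (z w : C) : Re (z - w)%C = Re z - Re w.
Proof. reflexivity. Qed.

Lemma Im_Cminus (z w : C) : Im (z - w)%C = Im z - Im w.
Proof. reflexivity. Qed.

Lemma Re_Cmult (z w : C) : Re (z * w)%C = Re z * Re w - Im z * Im w.
Proof. reflexivity. Qed.

Lemma Im_Cmult (z w : C) : Im (z * w)%C = Re z * Im w + Im z * Re w.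
Proof. reflexivity. Qed.

Lemma Re_RtoC_mult (c : R) (z : C) : Re (c * z)%C = c * Re z.
Proof. rewrite Re_Cmult. simpl. ring. Qed.

Lemma Im_RtoC_mult (c : R) (z : C) : Im (c * z)%C = c * Im z.
Proof. rewrite Im_Cmult. simpl. ring. Qed.

Lemma im_le_Cmod (c : C) : Rabs (Im c) <= Cmod c.
Proof.
  eapply Rle_trans; [| apply Rmax_Cmod]. apply Rmax_r.
Qed.

Lemma Cmod_le_ReIm (c : C) : Cmod c <= Rabs (Re c) + Rabs (Im c).
Proof.
  unfold Cmod, Re, Im.
  pose proof (Rabs_pos (fst c)) as H1. pose proof (Rabs_pos (snd c)) as H2.
  rewrite <- (sqrt_Rsqr (Rabs (fst c) + Rabs (snd c))) by lra.
  apply sqrt_le_1_alt.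
  rewrite <- (pow2_abs (fst c)), <- (pow2_abs (snd c)). unfold Rsqr. nra.
Qed.

Lemma Cmod_minus_sym (a b : C) : Cmod (a - b)%C = Cmod (b - a)%C.
Proof. rewrite <- Cmod_opp. f_equal. ring. Qed.

Lemma Cmod_triangle_minus (a b : C) : Cmod (a - b)%C <= Cmod a + Cmod b.
Proof. unfold Cminus. eapply Rle_trans; [apply Cmod_triangle|]. rewrite Cmod_opp. lra. Qed.

Lemma Cmod_triangle_inv (a b : C) : Cmod a - Cmod b <= Cmod (a + b)%C.
Proof.
  replace a with ((a + b) - b)%C at 1 by ring.
  pose proof (Cmod_triangle_minus (a + b) b). lra.
Qed.

Lemma Cmod_triangle3 (a b c : C) : Cmod (a - c)%C <= Cmod (a - b)%C + Cmod (b - c)%C.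
Proof.
  replace (a - c)%C with ((a - b) + (b - c))%C by ring. apply Cmod_triangle.
Qed.

(** * Limits of complex sequences *)

Lemma clim_unique u l1 l2 : clim u l1 -> clim u l2 -> l1 = l2.
Proof.
  intros H1 H2.
  assert (Hz : Cmod (l1 - l2)%C = 0).
  { destruct (Rle_lt_or_eq_dec _ _ (Cmod_ge_0 (l1 - l2)%C)) as [Hp|]; [|symmetry; assumption].
    destruct (H1 (Cmod (l1 - l2)%C / 2)) as [N1 HN1]; [lra|].
    destruct (H2 (Cmod (l1 - l2)%C / 2)) as [N2 HN2]; [lra|].
    specialize (HN1 (N1 + N2)%nat ltac:(lia)). specialize (HN2 (N1 + N2)%nat ltac:(lia)).
    pose proof (Cmod_triangle3 l1 (u (N1 + N2)%nat) l2) as H.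
    rewrite (Cmod_minus_sym l1 (u _)) in H. lra. }
  apply Cmod_eq_0 in Hz.
  transitivity ((l1 - l2) + l2)%C; [ring|]. rewrite Hz. ring.
Qed.

Lemma clim_ext_ev u v l N0 :
  (forall n, (N0 <= n)%nat -> u n = v n) -> clim u l -> clim v l.
Proof.
  intros He H eps Heps. destruct (H eps Heps) as [N HN].
  exists (N + N0)%nat. intros n Hn. rewrite <- He by lia. apply HN. lia.
Qed.

Lemma clim_ext u v l : (forall n, u n = v n) -> clim u l -> clim v l.
Proof. intros He. apply (clim_ext_ev u v l 0). auto. Qed.

Lemma clim_const l : clim (fun _ => l) l.
Proof.
  intros eps Heps. exists 0%nat. intros n _.
  replace (l - l)%C with (RtoC 0) by ring. rewrite Cmod_0. lra.
Qed.

Lemma clim_plus u v a b : clim u a -> clim v b -> clim (fun n => u n + v n)%C (a + b)%C.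
Proof.
  intros H1 H2 eps He.
  destruct (H1 (eps / 2)) as [N1 HN1]; [lra|].
  destruct (H2 (eps / 2)) as [N2 HN2]; [lra|].
  exists (N1 + N2)%nat. intros n Hn.
  specialize (HN1 n ltac:(lia)). specialize (HN2 n ltac:(lia)).
  replace (u n + v n - (a + b))%C with ((u n - a) + (v n - b))%C by ring.
  pose proof (Cmod_triangle (u n - a) (v n - b)). lra.
Qed.

Lemma clim_scal c u a : clim u a -> clim (fun n => c * u n)%C (c * a)%C.
Proof.
  intros H1 eps He. pose proof (Cmod_ge_0 c) as Hc.
  destruct (H1 (eps / (Cmod c + 1))) as [N1 HN1].
  { apply Rdiv_lt_0_compat; lra. }
  exists N1. intros n Hn. specialize (HN1 n Hn).
  replace (c * u n - c * a)%C with (c * (u n - a))%C by ring.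
  rewrite Cmod_mult.
  apply Rle_lt_trans with ((Cmod c) * (eps / (Cmod c + 1))).
  { apply Rmult_le_compat_l; lra. }
  unfold Rdiv. rewrite <- Rmult_assoc.
  apply Rmult_lt_reg_r with (Cmod c + 1); [lra|].
  rewrite Rmult_assoc, Rinv_l by lra. nra.
Qed.

Lemma clim_minus u v a b : clim u a -> clim v b -> clim (fun n => u n - v n)%C (a - b)%C.
Proof.
  intros H1 H2. apply clim_ext with (fun n => u n + (-(1)) * v n)%C.
  { intros; ring. }
  replace (a - b)%C with (a + (-(1)) * b)%C by ring.
  apply clim_plus; auto. apply clim_scal; auto.
Qed.

Lemma clim_bounded u l : clim u l -> exists K, 0 < K /\ exists N, forall n, (N <= n)%nat -> Cmod (u n) <= K.
Proof.
  intros H. destruct (H 1 Rlt_0_1) as [N HN].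
  exists (Cmod l + 1). split; [pose proof (Cmod_ge_0 l); lra|].
  exists N. intros n Hn. specialize (HN n Hn).
  replace (u n) with ((u n - l) + l)%C by ring.
  pose proof (Cmod_triangle (u n - l) l). lra.
Qed.

Lemma clim_squeeze0 (u : nat -> C) l (e : nat -> R) :
  (exists N, forall n, (N <= n)%nat -> Cmod (u n - l)%C <= e n) -> is_lim_seq e 0 -> clim u l.
Proof.
  intros [N HN] He eps Heps. apply is_lim_seq_spec in He.
  destruct (He (mkposreal eps Heps)) as [N2 HN2]. simpl in HN2.
  exists (N + N2)%nat. intros n Hn. eapply Rle_lt_trans; [apply HN; lia|].
  specialize (HN2 n ltac:(lia)). rewrite Rminus_0_r in HN2.
  apply Rabs_lt_between in HN2. lra.
Qed.

Lemma clim_Re u l : clim u l -> is_lim_seq (fun n => Re (u n)) (Re l).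
Proof.
  intros H. apply is_lim_seq_spec. intros eps.
  destruct (H eps (cond_pos eps)) as [N HN]. exists N. intros n Hn.
  eapply Rle_lt_trans; [| apply (HN n Hn)].
  rewrite <- Re_Cminus. apply re_le_Cmod.
Qed.

Lemma clim_ReIm u l :
  is_lim_seq (fun n => Re (u n)) (Re l) -> is_lim_seq (fun n => Im (u n)) (Im l) -> clim u l.
Proof.
  intros H1 H2. apply clim_squeeze0 with (fun n => Rabs (Re (u n) - Re l) + Rabs (Im (u n) - Im l)).
  { exists 0%nat. intros n _. eapply Rle_trans; [apply Cmod_le_ReIm|]. rewrite Re_Cminus, Im_Cminus. lra. }
  replace (Finite 0) with (Finite (0 + 0)) by (f_equal; ring).
  apply is_lim_seq_plus'.
  - replace (Finite 0) with (Rbar_abs (Finite (Re l - Re l))) by (simpl; f_equal; rewrite Rminus_diag; apply Rabs_R0).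
    apply is_lim_seq_abs. apply is_lim_seq_minus'; [auto|apply is_lim_seq_const].
  - replace (Finite 0) with (Rbar_abs (Finite (Im l - Im l))) by (simpl; f_equal; rewrite Rminus_diag; apply Rabs_R0).
    apply is_lim_seq_abs. apply is_lim_seq_minus'; [auto|apply is_lim_seq_const].
Qed.

Lemma clim_incr u l (k : nat) : clim u l -> clim (fun n => u (n + k)%nat) l.
Proof.
  intros H eps He. destruct (H eps He) as [N HN]. exists N. intros n Hn. apply HN. lia.
Qed.

Lemma clim_decr u l (k : nat) : clim (fun n => u (n + k)%nat) l -> clim u l.
Proof.
  intros H eps He. destruct (H eps He) as [N HN]. exists (N + k)%nat. intros n Hn.
  replace n with ((n - k) + k)%nat by lia. apply HN. lia.
Qed.

(** * Finite sums and series *)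

Lemma csum_ext a b n : (forall k, (k < n)%nat -> a k = b k) -> csum a n = csum b n.
Proof. induction n; intros H; simpl; [auto|]. rewrite IHn, H by auto with arith. auto. Qed.

Lemma csum_plus a b n : csum (fun k => a k + b k)%C n = (csum a n + csum b n)%C.
Proof. induction n; simpl; [ring|]. rewrite IHn. ring. Qed.

Lemma csum_scal c a n : csum (fun k => c * a k)%C n = (c * csum a n)%C.
Proof. induction n; simpl; [ring|]. rewrite IHn. ring. Qed.

Lemma csum_add a n m : csum a (n + m) = (csum a n + csum (fun k => a (n + k)%nat) m)%C.
Proof.
  induction m; simpl. { rewrite Nat.add_0_r. ring. }
  rewrite Nat.add_succ_r. simpl. rewrite IHm. ring.
Qed.

Lemma csum_S_l a n : csum a (S n) = (a 0%nat + csum (fun k => a (S k)) n)%C.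
Proof. change (S n) with (1 + n)%nat. rewrite csum_add. simpl. ring. Qed.

Lemma csum_rev a n : csum a n = csum (fun k => a (n - 1 - k)%nat) n.
Proof.
  revert a; induction n; intros a; [reflexivity|].
  rewrite csum_S_l. simpl. rewrite (IHn (fun k => a (S k))).
  rewrite Cplus_comm. f_equal.
  - apply csum_ext. intros k Hk. f_equal. lia.
  - f_equal. lia.
Qed.

Lemma csum_Re a n : Re (csum a (S n)) = sum_f_R0 (fun k => Re (a k)) n.
Proof.
  induction n; [apply Rplus_0_l|].
  rewrite tech5, <- IHn. reflexivity.
Qed.

Lemma csum_Im a n : Im (csum a (S n)) = sum_f_R0 (fun k => Im (a k)) n.
Proof.
  induction n; [apply Rplus_0_l|].
  rewrite tech5, <- IHn. reflexivity.
Qed.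

Lemma csum_Cmod_le a n : Cmod (csum a (S n)) <= sum_f_R0 (fun k => Cmod (a k)) n.
Proof.
  induction n.
  - simpl. rewrite Cplus_0_l. lra.
  - rewrite tech5. change (csum a (S (S n))) with (csum a (S n) + a (S n))%C.
    eapply Rle_trans; [apply Cmod_triangle|]. lra.
Qed.

Lemma is_series_sum_f_R0 (a : nat -> R) (l : R) :
  is_series a l <-> is_lim_seq (fun n => sum_f_R0 a n) l.
Proof.
  split; intros H.
  - apply is_lim_seq_ext with (sum_n a); [intros; apply sum_n_Reals|]. exact H.
  - apply (is_lim_seq_ext _ (sum_n a)) in H; [exact H|]. intros; symmetry; apply sum_n_Reals.
Qed.

Lemma ex_series_le_R (a b : nat -> R) :
  (forall n, 0 <= a n <= b n) -> ex_series b -> ex_series a.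
Proof.
  intros H. apply (ex_series_le (V := R_CompleteNormedModule)). intros n.
  change (Rabs (a n) <= b n). rewrite Rabs_pos_eq; apply H.
Qed.

Lemma ex_series_Rmult_l (c : R) (a : nat -> R) : ex_series a -> ex_series (fun n => c * a n).
Proof. apply (ex_series_scal_l (V := R_NormedModule)). Qed.

Lemma Series_nonneg (a : nat -> R) : (forall n, 0 <= a n) -> ex_series a -> 0 <= Series a.
Proof.
  intros H Ha. rewrite <- (Rmult_0_l (Series a)), <- Series_scal_l.
  apply Series_le; auto. intros n; specialize (H n); lra.
Qed.

Lemma sum_f_R0_le_Series (a : nat -> R) n :
  (forall n, 0 <= a n) -> ex_series a -> sum_f_R0 a n <= Series a.
Proof.
  intros H Ha. rewrite (Series_incr_n a (S n)) by (auto with arith). simpl pred.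
  assert (0 <= Series (fun k => a (S n + k)%nat)); [|lra].
  apply Series_nonneg; auto. apply (ex_series_incr_n a), Ha.
Qed.

Lemma summ_le a (b : nat -> R) : (forall n, Cmod (a n) <= b n) -> ex_series b -> summ a.
Proof.
  intros H Hb. apply ex_series_le_R with b; auto. intros; split; [apply Cmod_ge_0|auto].
Qed.

Lemma summ_ext a b : (forall n, a n = b n) -> summ a -> summ b.
Proof. intros H. apply ex_series_ext. intros; rewrite H; auto. Qed.

Lemma summ_Re a : summ a -> ex_series (fun n => Re (a n)).
Proof.
  intros H. apply ex_series_Rabs. apply ex_series_le_R with (fun n => Cmod (a n)); auto.
  intros; split; [apply Rabs_pos| apply re_le_Cmod].
Qed.

Lemma summ_Im a : summ a -> ex_series (fun n => Im (a n)).
Proof.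
  intros H. apply ex_series_Rabs. apply ex_series_le_R with (fun n => Cmod (a n)); auto.
  intros; split; [apply Rabs_pos| apply im_le_Cmod].
Qed.

Lemma summ_scal c a : summ a -> summ (fun n => c * a n)%C.
Proof.
  intros H. unfold summ. apply ex_series_ext with (fun n => Cmod (a n) * Cmod c).
  { intros; rewrite Cmod_mult; apply Rmult_comm. }
  apply ex_series_scal_r; auto.
Qed.

Lemma summ_plus a b : summ a -> summ b -> summ (fun n => a n + b n)%C.
Proof.
  intros Ha Hb. apply summ_le with (fun n => Cmod (a n) + Cmod (b n)).
  { intros; apply Cmod_triangle. }
  apply (ex_series_plus (V := R_NormedModule)); auto.
Qed.

Lemma summ_minus a b : summ a -> summ b -> summ (fun n => a n - b n)%C.
Proof.
  intros Ha Hb. apply summ_ext with (fun n => a n + (-(1)) * b n)%C; [intros; ring|].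
  apply summ_plus; auto. apply summ_scal; auto.
Qed.

Lemma summ_incr a k : summ a -> summ (fun n => a (k + n)%nat).
Proof. intros H. apply (ex_series_incr_n (fun n => Cmod (a n)) k). exact H. Qed.

Lemma CSer_correct a : summ a -> clim (csum a) (CSer a).
Proof.
  intros H. apply (clim_decr _ _ 1). apply clim_ReIm.
  - apply is_lim_seq_ext with (fun n => sum_f_R0 (fun k => Re (a k)) n).
    { intros n. rewrite Nat.add_1_r, csum_Re. reflexivity. }
    apply is_series_sum_f_R0. apply Series_correct, summ_Re, H.
  - apply is_lim_seq_ext with (fun n => sum_f_R0 (fun k => Im (a k)) n).
    { intros n. rewrite Nat.add_1_r, csum_Im. reflexivity. }
    apply is_series_sum_f_R0. apply Series_correct, summ_Im, H.
Qed.

Lemma CSer_unique a l : summ a -> clim (csum a) l -> CSer a = l.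
Proof. intros Ha Hl. eapply clim_unique; [apply CSer_correct|]; auto. Qed.

Lemma CSer_ext a b : (forall n, a n = b n) -> CSer a = CSer b.
Proof. intros H. unfold CSer. f_equal; apply Series_ext; intros; rewrite H; auto. Qed.

Lemma CSer_scal c a : summ a -> CSer (fun n => c * a n)%C = (c * CSer a)%C.
Proof.
  intros H. apply CSer_unique; [apply summ_scal; auto|].
  apply clim_ext with (fun n => c * csum a n)%C; [intros; symmetry; apply csum_scal|].
  apply clim_scal, CSer_correct, H.
Qed.

Lemma CSer_plus a b : summ a -> summ b -> CSer (fun n => a n + b n)%C = (CSer a + CSer b)%C.
Proof.
  intros Ha Hb. apply CSer_unique; [apply summ_plus; auto|].
  apply clim_ext with (fun n => csum a n + csum b n)%C; [intros; symmetry; apply csum_plus|].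
  apply clim_plus; apply CSer_correct; auto.
Qed.

Lemma CSer_minus a b : summ a -> summ b -> CSer (fun n => a n - b n)%C = (CSer a - CSer b)%C.
Proof.
  intros Ha Hb.
  rewrite (CSer_ext _ (fun n => a n + (-(1)) * b n)%C) by (intros; ring).
  rewrite CSer_plus, CSer_scal by (auto using summ_scal). ring.
Qed.

Lemma CSer_incr a k : summ a -> CSer a = (csum a k + CSer (fun n => a (k + n)%nat))%C.
Proof.
  intros H. apply CSer_unique; auto.
  apply (clim_decr _ _ k).
  apply clim_ext with (fun n => csum a k + csum (fun i => a (k + i)%nat) n)%C.
  { intros n. rewrite <- csum_add. f_equal. lia. }
  apply clim_plus; [apply clim_const|]. apply CSer_correct, summ_incr, H.
Qed.

Lemma CSer_Cmod_le a : summ a -> Cmod (CSer a) <= Series (fun n => Cmod (a n)).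
Proof.
  intros H. apply Rnot_lt_le. intros Hlt.
  destruct (CSer_correct a H (Cmod (CSer a) - Series (fun n => Cmod (a n)))) as [N HN]; [lra|].
  specialize (HN (S N) ltac:(lia)).
  pose proof (csum_Cmod_le a N) as Hs.
  assert (Hle : sum_f_R0 (fun k => Cmod (a k)) N <= Series (fun n => Cmod (a n))).
  { apply (sum_f_R0_le_Series (fun n => Cmod (a n))); auto. intros; apply Cmod_ge_0. }
  pose proof (Cmod_triangle_inv (CSer a) (csum a (S N) - CSer a)) as Ht.
  replace (CSer a + (csum a (S N) - CSer a))%C with (csum a (S N)) in Ht by ring. lra.
Qed.

Lemma CSer_Cmod_le_b a b : (forall n, Cmod (a n) <= b n) -> ex_series b -> Cmod (CSer a) <= Series b.
Proof.
  intros H Hb. eapply Rle_trans; [apply CSer_Cmod_le, (summ_le a b); auto|].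
  apply Series_le; auto. intros; split; [apply Cmod_ge_0|auto].
Qed.

Lemma Series_zero : Series (fun _ => 0) = 0.
Proof.
  rewrite (Series_ext _ (fun n => 0 * 0)) by (intros; ring). rewrite Series_scal_l. ring.
Qed.

Lemma RtoC_series (a : nat -> R) : CSer (fun n => RtoC (a n)) = RtoC (Series a).
Proof.
  apply C_eq; simpl; auto. apply Series_zero.
Qed.

Lemma series_tail_0 (b : nat -> R) : ex_series b ->
  forall eps, 0 < eps -> exists N, forall n, (N <= n)%nat -> Rabs (Series (fun k => b (n + k)%nat)) < eps.
Proof.
  intros Hb eps Heps.
  pose proof (Series_correct _ Hb) as H. apply is_series_sum_f_R0 in H.
  apply is_lim_seq_spec in H. destruct (H (mkposreal eps Heps)) as [N HN]. simpl in HN.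
  exists (S N). intros n Hn. specialize (HN (pred n) ltac:(lia)).
  rewrite (Series_incr_n b n ltac:(lia) Hb) in HN.
  rewrite <- Rabs_Ropp. 
  replace (- Series (fun k => b (n + k)%nat)) with
    (sum_f_R0 b (pred n) - (sum_f_R0 b (pred n) + Series (fun k => b (n + k)%nat))) by ring.
  exact HN.
Qed.

(** Dominated convergence for series. The limit terms inherit the majorant, so both tails are at
    most a tail of [b], uniformly in [n], and the finitely many remaining terms converge. The bound
    is asked for only from [N0] on, because in the partial fractions it holds only once [2 ^ n]
    exceeds [|Im w|]. *)
Lemma tannery (a : nat -> nat -> C) (l : nat -> C) (b : nat -> R) (N0 : nat) :
  (forall n k, (N0 <= n)%nat -> Cmod (a n k) <= b k) -> ex_series b ->
  (forall k, clim (fun n => a n k) (l k)) ->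
  summ l /\ clim (fun n => CSer (a n)) (CSer l).
Proof.
  intros Hd Hb Hl.
  assert (Hlb : forall k, Cmod (l k) <= b k).
  { intros k. apply Rnot_lt_le. intros Hlt.
    destruct (Hl k (Cmod (l k) - b k)) as [N HN]; [lra|].
    specialize (HN (N + N0)%nat ltac:(lia)). specialize (Hd (N + N0)%nat k ltac:(lia)).
    pose proof (Cmod_triangle_inv (l k) (a (N + N0)%nat k - l k)) as Ht.
    replace (l k + (a (N + N0)%nat k - l k))%C with (a (N + N0)%nat k) in Ht by ring. lra. }
  assert (Hs : summ l) by (apply summ_le with b; auto).
  split; auto. intros eps Heps.
  destruct (series_tail_0 b Hb (eps / 4)) as [K HK]; [lra|].
  specialize (HK (S K) ltac:(lia)).
  assert (Hfin : forall m, clim (fun n => csum (a n) m) (csum l m)).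
  { induction m; simpl; [apply clim_const|]. apply clim_plus; auto. }
  destruct (Hfin (S K) (eps / 4)) as [N HN]; [lra|].
  exists (N + N0)%nat. intros n Hn. specialize (HN n ltac:(lia)).
  assert (Hsn : summ (a n)) by (apply summ_le with b; auto; intros; apply Hd; lia).
  rewrite (CSer_incr (a n) (S K)), (CSer_incr l (S K)) by auto.
  match goal with |- Cmod (?p + ?q - (?s + ?t))%C < _ =>
    replace (p + q - (s + t))%C with ((p - s) + (q - t))%C by ring end.
  assert (Htb : ex_series (fun k => b (S K + k)%nat)) by (apply (ex_series_incr_n b), Hb).
  assert (H1 : Cmod (CSer (fun k => a n (S K + k)%nat)) <= Series (fun k => b (S K + k)%nat)).
  { apply CSer_Cmod_le_b; auto. intros; apply Hd; lia. }
  assert (H2 : Cmod (CSer (fun k => l (S K + k)%nat)) <= Series (fun k => b (S K + k)%nat)).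
  { apply CSer_Cmod_le_b; auto. }
  apply Rabs_lt_between in HK.
  eapply Rle_lt_trans; [apply Cmod_triangle|].
  match goal with |- Cmod ?p + Cmod (?q - ?t)%C < _ => pose proof (Cmod_triangle_minus q t) end.
  lra.
Qed.

Lemma CSer_csum_swap (a : nat -> nat -> C) m :
  (forall k, summ (fun j => a j k)) ->
  summ (fun j => csum (a j) m) /\
  CSer (fun j => csum (a j) m) = csum (fun k => CSer (fun j => a j k)) m.
Proof.
  intros H. induction m as [|m [IH1 IH2]]; simpl.
  - split.
    + unfold summ. apply ex_series_ext with (fun n => 0 ^ S n).
      { intros; rewrite Cmod_0; simpl; ring. }
      apply (ex_series_incr_1 (fun n => 0 ^ n)). apply ex_series_geom. rewrite Rabs_R0; lra.
    + rewrite (RtoC_series (fun _ => 0)). f_equal. apply Series_zero.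
  - split; [apply summ_plus; auto|]. rewrite CSer_plus by auto. rewrite IH2. reflexivity.
Qed.

(** The majorant is a product, so Tannery's theorem applies to the partial row sums with dominating
    sequence [u j * Series v]. Convergence of the partial sums over columns is stated separately:
    Eisenstein's telescoping is visible only in these partial sums. *)
Lemma series_fubini (a : nat -> nat -> C) (u v : nat -> R) :
  (forall j k, Cmod (a j k) <= u j * v k) -> ex_series u -> ex_series v ->
  (forall j, 0 <= u j) -> (forall k, 0 <= v k) ->
  (forall j, summ (a j)) /\ summ (fun j => CSer (a j)) /\
  clim (fun m => csum (fun k => CSer (fun j => a j k)) m) (CSer (fun j => CSer (a j))) /\
  summ (fun k => CSer (fun j => a j k)) /\
  CSer (fun k => CSer (fun j => a j k)) = CSer (fun j => CSer (a j)).
Proof.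
  intros Hd Hu Hv Pu Pv.
  assert (Sk : forall k, summ (fun j => a j k)).
  { intros k. apply summ_le with (fun j => u j * v k); auto. apply ex_series_scal_r; auto. }
  assert (Sj : forall j, summ (a j)).
  { intros j. apply summ_le with (fun k => u j * v k); auto.
    apply ex_series_Rmult_l; auto. }
  assert (Hv0 : 0 <= Series v) by (apply Series_nonneg; auto).
  destruct (tannery (fun m j => csum (a j) m) (fun j => CSer (a j)) (fun j => u j * Series v) 0)
    as [T1 T2].
  - intros m j _. destruct m; [simpl; rewrite Cmod_0; apply Rmult_le_pos; auto|].
    eapply Rle_trans; [apply csum_Cmod_le|].
    apply Rle_trans with (sum_f_R0 (fun k => u j * v k) m).
    { apply sum_Rle. intros; auto. }
    rewrite (sum_eq _ (fun k => v k * u j)) by (intros; ring).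
    rewrite <- scal_sum. apply Rmult_le_compat_l; auto.
    apply sum_f_R0_le_Series; auto.
  - apply ex_series_scal_r; auto.
  - intros j. apply CSer_correct; auto.
  - assert (Hlim : clim (fun m => csum (fun k => CSer (fun j => a j k)) m) (CSer (fun j => CSer (a j)))).
    { apply clim_ext with (fun m => CSer (fun j => csum (a j) m)); auto.
      intros m. apply CSer_csum_swap; auto. }
    assert (Hs : summ (fun k => CSer (fun j => a j k))).
    { apply summ_le with (fun k => Series u * v k).
      - intros k. rewrite <- Series_scal_r. apply CSer_Cmod_le_b; auto. apply ex_series_scal_r; auto.
      - apply ex_series_Rmult_l; auto. }
    repeat split; auto. apply CSer_unique; auto.
Qed.

(** * The complex exponential *)

Definition Cexp (z : C) : C := (exp (Re z) * cos (Im z), exp (Re z) * sin (Im z)).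

Lemma Cexp_plus z w : Cexp (z + w)%C = (Cexp z * Cexp w)%C.
Proof.
  unfold Cexp. apply C_eq.
  - rewrite Re_Cmult, Re_Cplus, Im_Cplus. simpl. rewrite exp_plus, cos_plus. ring.
  - rewrite Im_Cmult, Re_Cplus, Im_Cplus. simpl. rewrite exp_plus, sin_plus. ring.
Qed.

Lemma Cexp_RtoC (x : R) : Cexp x = exp x.
Proof. unfold Cexp, RtoC. simpl. rewrite cos_0, sin_0. f_equal; ring. Qed.

Lemma Cexp_0 : Cexp 0 = 1.
Proof. rewrite Cexp_RtoC, exp_0. reflexivity. Qed.

Lemma Cmod_Cexp z : Cmod (Cexp z) = exp (Re z).
Proof.
  unfold Cmod, Cexp. simpl.
  replace (_ + _) with (Rsqr (exp (Re z)) * (Rsqr (sin (Im z)) + Rsqr (cos (Im z)))) by (unfold Rsqr; ring).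
  rewrite sin2_cos2, Rmult_1_r. apply sqrt_Rsqr. left; apply exp_pos.
Qed.

Lemma Cexp_neq_0 z : Cexp z <> 0.
Proof. apply Cmod_gt_0. rewrite Cmod_Cexp. apply exp_pos. Qed.

Lemma Cexp_opp z : Cexp (- z)%C = (/ Cexp z)%C.
Proof.
  assert (H : (Cexp z * Cexp (- z) = 1)%C).
  { rewrite <- Cexp_plus. replace (z + - z)%C with (RtoC 0) by ring. apply Cexp_0. }
  pose proof (Cexp_neq_0 z). rewrite <- (Cmult_1_l (/ Cexp z)%C), <- H. field. auto.
Qed.

Lemma RtoC_S n : RtoC (INR (S n)) = (1 + INR n)%C.
Proof. rewrite S_INR, RtoC_plus. ring. Qed.

Lemma Cexp_INR n z : Cexp (INR n * z)%C = (Cexp z ^ n)%C.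
Proof.
  induction n.
  - simpl. rewrite Cmult_0_l. apply Cexp_0.
  - rewrite RtoC_S. replace ((1 + INR n) * z)%C with (z + INR n * z)%C by ring.
    rewrite Cexp_plus, IHn. reflexivity.
Qed.

Lemma Cexp_PI : Cexp (PI * Ci)%C = (-(1))%C.
Proof.
  unfold Cexp, Ci, RtoC. apply C_eq; simpl; replace (PI * 0 - 0 * 1) with 0 by ring;
  replace (PI * 1 + 0 * 0) with PI by ring; rewrite exp_0, ?cos_PI, ?sin_PI; ring.
Qed.

Lemma Cexp_2PI : Cexp (2 * PI * Ci)%C = 1.
Proof.
  replace (2 * PI * Ci)%C with (PI * Ci + PI * Ci)%C by ring.
  rewrite Cexp_plus, Cexp_PI. ring.
Qed.

Lemma abs_sin_le x : Rabs (sin x) <= Rabs x.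
Proof.
  destruct (Rtotal_order x 0) as [H|[H|H]].
  - rewrite <- (Rabs_Ropp x), <- (Rabs_Ropp (sin x)), <- sin_neg.
    rewrite (Rabs_pos_eq (- x)) by lra.
    apply Rabs_le. split; [|left; apply sin_lt_x; lra].
    destruct (Rle_dec (- x) PI).
    + pose proof (sin_ge_0 (- x)). lra.
    + pose proof (SIN_bound (- x)). pose proof PI2_1. lra.
  - subst. rewrite sin_0, Rabs_R0. lra.
  - rewrite (Rabs_pos_eq x) by lra.
    apply Rabs_le. split; [|left; apply sin_lt_x; lra].
    destruct (Rle_dec x PI).
    + pose proof (sin_ge_0 x). lra.
    + pose proof (SIN_bound x). pose proof PI2_1. lra.
Qed.

Lemma one_minus_cos x : 1 - cos x = 2 * Rsqr (sin (x / 2)).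
Proof.
  replace x with (2 * (x / 2)) at 1 by field. rewrite cos_2a_sin. unfold Rsqr. ring.
Qed.

Lemma one_minus_cos_le x : 0 <= 1 - cos x <= x ^ 2 / 2.
Proof.
  rewrite one_minus_cos. split; [pose proof (Rle_0_sqr (sin (x / 2))); lra|].
  pose proof (abs_sin_le (x / 2)) as H. apply Rsqr_le_abs_1 in H. unfold Rsqr in *. nra.
Qed.

Lemma one_minus_cos_le1 x : 1 - cos x <= Rabs x.
Proof.
  rewrite one_minus_cos.
  pose proof (abs_sin_le (x / 2)) as H. rewrite (Rsqr_abs (sin (x / 2))). unfold Rsqr.
  assert (Rabs (sin (x / 2)) <= 1) by (apply Rabs_le, SIN_bound).
  pose proof (Rabs_pos (sin (x / 2))).
  unfold Rdiv in H at 2. rewrite Rabs_mult, (Rabs_pos_eq (/ 2)) in H by lra. nra.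
Qed.

Lemma MVT_abs_le (f f' : R -> R) (x B : R) :
  (forall t, is_derive f t (f' t)) -> (forall t, Rabs t <= Rabs x -> Rabs (f' t) <= B) ->
  Rabs (f x - f 0) <= B * Rabs x.
Proof.
  intros Hd HB. destruct (MVT_gen f 0 x f') as [c [Hc He]].
  - intros; apply Hd.
  - intros t _. apply continuity_pt_filterlim.
    apply (ex_derive_continuous (V := R_NormedModule)). eexists; apply Hd.
  - rewrite He, Rabs_mult, Rminus_0_r. apply Rmult_le_compat_r; [apply Rabs_pos|].
    apply HB. revert Hc. unfold Rmin, Rmax, Rabs.
    destruct Rle_dec; repeat destruct Rcase_abs; lra.
Qed.

Lemma abs_exp_sub1 x : Rabs (exp x - 1) <= Rabs x * exp (Rabs x).
Proof.
  rewrite <- exp_0, Rmult_comm. apply (MVT_abs_le exp exp).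
  - intros; apply is_derive_exp.
  - intros t Ht. rewrite Rabs_pos_eq by (left; apply exp_pos).
    pose proof (Rle_abs t). destruct (Req_dec t (Rabs x)) as [->|]; [lra|].
    left; apply exp_increasing; lra.
Qed.

Lemma exp_le_mono x y : x <= y -> exp x <= exp y.
Proof. intros [H| ->]; [left; apply exp_increasing; auto|lra]. Qed.

Lemma exp_pow (y : R) (m : nat) : exp y ^ m = exp (INR m * y).
Proof.
  induction m; [simpl; rewrite Rmult_0_l, exp_0; auto|].
  rewrite S_INR. simpl pow. rewrite IHm, <- exp_plus. f_equal. ring.
Qed.

(** Lets part of an exponential decay absorb a linear factor; this is how factors [n] and [j] are
    removed from majorants below. *)
Lemma mul_exp_neg_le (x r : R) : 0 < r -> x * exp (- (x * r)) <= / r.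
Proof.
  intros Hr. rewrite exp_Ropp. pose proof (exp_ineq1_le (x * r)).
  apply Rmult_le_reg_r with (exp (x * r) * r); [apply Rmult_lt_0_compat; [apply exp_pos|lra]|].
  replace (x * / exp (x * r) * (exp (x * r) * r)) with (x * r) by (field; apply Rgt_not_eq, exp_pos).
  replace (/ r * (exp (x * r) * r)) with (exp (x * r)) by (field; lra). lra.
Qed.

Lemma Ci_sqr : (Ci * Ci = - (1))%C.
Proof. apply C_eq; simpl; ring. Qed.

Lemma INR_S_pos k : 0 < INR (S k).
Proof. apply lt_0_INR; lia. Qed.

Lemma INR_S_ge1 k : 1 <= INR (S k).
Proof. rewrite S_INR. pose proof (pos_INR k). lra. Qed.

Lemma abs_exp_sub1_sub x : Rabs (exp x - 1 - x) <= Rabs x ^ 2 * exp (Rabs x).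
Proof.
  replace (exp x - 1 - x) with ((exp x - x) - (exp 0 - 0)) by (rewrite exp_0; ring).
  replace (Rabs x ^ 2 * exp (Rabs x)) with ((Rabs x * exp (Rabs x)) * Rabs x) by ring.
  apply (MVT_abs_le (fun x => exp x - x) (fun x => exp x - 1)).
  - intros t. auto_derive; auto; ring.
  - intros t Ht. eapply Rle_trans; [apply abs_exp_sub1|].
    apply Rmult_le_compat; auto using Rabs_pos. left; apply exp_pos. apply exp_le_mono; auto.
Qed.

Lemma abs_sin_sub x : Rabs (sin x - x) <= Rabs x ^ 2.
Proof.
  replace (sin x - x) with ((sin x - x) - (sin 0 - 0)) by (rewrite sin_0; ring).
  replace (Rabs x ^ 2) with (Rabs x * Rabs x) by ring.
  apply (MVT_abs_le (fun x => sin x - x) (fun x => cos x - 1)).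
  - intros t. auto_derive; auto; ring.
  - intros t Ht. rewrite Rabs_minus_sym.
    pose proof (one_minus_cos_le t). pose proof (one_minus_cos_le1 t).
    rewrite Rabs_pos_eq; lra.
Qed.

(** Real and imaginary parts are estimated separately by one-variable bounds; the constant 3 is not
    sharp. *)
Lemma Cexp_quad h : Cmod (Cexp h - 1 - h)%C <= 3 * Cmod h ^ 2 * exp (Cmod h).
Proof.
  eapply Rle_trans; [apply Cmod_le_ReIm|]. rewrite !Re_Cminus, !Im_Cminus. simpl.
  set (a := Re h). set (b := Im h).
  pose proof (abs_exp_sub1 a) as H1. pose proof (abs_exp_sub1_sub a) as H2.
  pose proof (abs_sin_sub b) as H3. pose proof (one_minus_cos_le b) as H4.
  assert (Hab : Cmod h ^ 2 = a ^ 2 + b ^ 2) by apply Cmod2_alt.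
  assert (He : exp (Rabs a) <= exp (Cmod h)) by (apply exp_le_mono, re_le_Cmod).
  assert (Hea : exp a <= exp (Rabs a)) by (apply exp_le_mono, Rle_abs).
  pose proof (exp_pos a) as Hp. pose proof (exp_pos (Rabs a)) as Hp'.
  change (Cmod h * (Cmod h * 1)) with (Cmod h ^ 2). rewrite Hab.
  rewrite <- (pow2_abs a), <- (pow2_abs b) in *.
  pose proof (Rabs_pos a). pose proof (Rabs_pos b).
  assert (T1 : Rabs (exp a * cos b - 1 - a) <= Rabs a ^ 2 * exp (Rabs a) + exp (Rabs a) * (Rabs b ^ 2 / 2)).
  { replace (exp a * cos b - 1 - a) with ((exp a - 1 - a) + - (exp a * (1 - cos b))) by ring.
    eapply Rle_trans; [apply Rabs_triang|]. rewrite Rabs_Ropp, Rabs_mult.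
    rewrite (Rabs_pos_eq (exp a)), (Rabs_pos_eq (1 - cos b)) by lra.
    apply Rplus_le_compat; auto. apply Rmult_le_compat; lra. }
  assert (T2 : Rabs (exp a * sin b - 0 - b) <= exp (Rabs a) * Rabs b ^ 2 + Rabs b * (Rabs a * exp (Rabs a))).
  { replace (exp a * sin b - 0 - b) with (exp a * (sin b - b) + b * (exp a - 1)) by ring.
    eapply Rle_trans; [apply Rabs_triang|]. rewrite !Rabs_mult.
    rewrite (Rabs_pos_eq (exp a)) by lra.
    apply Rplus_le_compat; apply Rmult_le_compat; try lra; apply Rabs_pos. }
  assert (0 <= (Rabs a - Rabs b) ^ 2) by apply pow2_ge_0.
  apply Rle_trans with (3 * (Rabs a ^ 2 + Rabs b ^ 2) * exp (Rabs a)).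
  { assert (0 <= exp (Rabs a) * (3 * (Rabs a ^ 2 + Rabs b ^ 2) - (Rabs a ^ 2 + Rabs b ^ 2 / 2 + Rabs b ^ 2 + Rabs a * Rabs b)))
      by (apply Rmult_le_pos; nra). nra. }
  apply Rmult_le_compat_l; nra.
Qed.

Lemma Cexp_sub1_le h : Cmod (Cexp h - 1)%C <= Cmod h * exp (Cmod h).
Proof.
  (* Mean value inequality along the segment from 0 to h, in the direction of the value. *)
  destruct (Req_dec (Cmod (Cexp h - 1)%C) 0) as [E|E].
  { rewrite E. apply Rmult_le_pos; [apply Cmod_ge_0|left; apply exp_pos]. }
  pose proof (Cmod_ge_0 (Cexp h - 1)%C) as Hm.
  set (m := Cmod (Cexp h - 1)%C) in *.
  set (c := ((Re (Cexp h - 1)%C) / m)). set (d := ((Im (Cexp h - 1)%C) / m)).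
  assert (Hcd : c ^ 2 + d ^ 2 = 1).
  { unfold c, d. pose proof (Cmod2_alt (Cexp h - 1)%C) as H. fold m in H.
    field_simplify; [|lra]. rewrite <- H. field. lra. }
  set (F := fun t => c * (exp (t * Re h) * cos (t * Im h)) + d * (exp (t * Re h) * sin (t * Im h))).
  set (F' := fun t => c * (exp (t * Re h) * (Re h * cos (t * Im h) - Im h * sin (t * Im h))) +
                      d * (exp (t * Re h) * (Re h * sin (t * Im h) + Im h * cos (t * Im h)))).
  assert (HF : Rabs (F 1 - F 0) <= (Cmod h * exp (Cmod h)) * Rabs 1).
  { apply MVT_abs_le with F'.
    - intros t. unfold F, F'. auto_derive; auto. ring.
    - intros t Ht. rewrite Rabs_R1 in Ht. unfold F'.
      replace (_ + _) with (exp (t * Re h) * (Re ((c, (- d)%R) * (h * (cos (t * Im h)%R, sin (t * Im h)%R)))%C))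
        by (rewrite !Re_Cmult, !Im_Cmult; simpl; ring).
      rewrite Rabs_mult, (Rabs_pos_eq (exp _)) by (left; apply exp_pos). rewrite Rmult_comm.
      apply Rmult_le_compat; try apply Rabs_pos; try (left; apply exp_pos).
      + eapply Rle_trans; [apply re_le_Cmod|]. rewrite !Cmod_mult.
        assert (E1 : Cmod (c, - d) = 1).
        { unfold Cmod. simpl fst; simpl snd. replace ((c ^ 2 + (- d) ^ 2)) with 1 by nra. apply sqrt_1. }
        assert (E2 : Cmod (cos (t * Im h), sin (t * Im h)) = 1).
        { unfold Cmod. simpl fst; simpl snd. transitivity (sqrt 1); [f_equal|apply sqrt_1].
          pose proof (sin2_cos2 (t * Im h)) as Hs. unfold Rsqr in Hs. nra. }
        rewrite E1, E2. lra.
      + apply exp_le_mono. eapply Rle_trans; [apply Rle_abs|]. rewrite Rabs_mult.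
        pose proof (re_le_Cmod h). pose proof (Rabs_pos (Re h)). pose proof (Rabs_pos t). nra. }
  rewrite Rabs_R1, Rmult_1_r in HF.
  replace (F 1 - F 0) with m in HF; [rewrite Rabs_pos_eq in HF; auto|].
  unfold F. rewrite !Rmult_1_l, !Rmult_0_l, exp_0, cos_0, sin_0.
  transitivity (c * Re (Cexp h - 1)%C + d * Im (Cexp h - 1)%C);
    [|rewrite Re_Cminus, Im_Cminus; simpl; ring].
  unfold c, d. pose proof (Cmod2_alt (Cexp h - 1)%C) as H. fold m in H.
  field_simplify; [|lra]. rewrite <- H. field. lra.
Qed.

(** * Complex differentiability *)

(* A quadratic remainder replaces the little-o; it is stable under locally dominated series. *)
Definition cder (f : C -> C) (z l : C) : Prop :=
  exists K d, 0 <= K /\ 0 < d /\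
    forall h, Cmod h < d -> Cmod (f (z + h) - f z - h * l)%C <= K * Cmod h ^ 2.

Lemma cder_ext f g z l d0 : 0 < d0 -> (forall h, Cmod h < d0 -> f (z + h)%C = g (z + h)%C) ->
  cder f z l -> cder g z l.
Proof.
  intros Hd0 He [K [d [HK [Hd H]]]]. exists K, (Rmin d d0).
  repeat split; auto. { apply Rmin_pos; auto. }
  intros h Hh. pose proof (Rmin_l d d0). pose proof (Rmin_r d d0).
  rewrite <- (He h) by lra.
  assert (E : g z = f z).
  { specialize (He 0). rewrite Cplus_0_r, Cmod_0 in He. symmetry; auto. }
  rewrite E. apply H. lra.
Qed.

Lemma cder_const c z : cder (fun _ => c) z 0.
Proof.
  exists 0, 1. repeat split; try lra. intros h _.
  replace (c - c - h * 0)%C with (RtoC 0) by ring. rewrite Cmod_0. lra.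
Qed.

Lemma cder_id z : cder (fun w => w) z 1.
Proof.
  exists 0, 1. repeat split; try lra. intros h _.
  replace (z + h - z - h * 1)%C with (RtoC 0) by ring. rewrite Cmod_0. lra.
Qed.

Lemma cder_eq f z l l' : l = l' -> cder f z l -> cder f z l'.
Proof. intros ->; auto. Qed.

Lemma cder_plus f g z a b : cder f z a -> cder g z b -> cder (fun w => f w + g w)%C z (a + b)%C.
Proof.
  intros [K1 [d1 [HK1 [Hd1 H1]]]] [K2 [d2 [HK2 [Hd2 H2]]]].
  exists (K1 + K2), (Rmin d1 d2). repeat split; [lra|apply Rmin_pos; auto|].
  intros h Hh. pose proof (Rmin_l d1 d2). pose proof (Rmin_r d1 d2).
  replace (f (z + h) + g (z + h) - (f z + g z) - h * (a + b))%C
    with ((f (z + h) - f z - h * a) + (g (z + h) - g z - h * b))%C by ring.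
  eapply Rle_trans; [apply Cmod_triangle|].
  specialize (H1 h ltac:(lra)). specialize (H2 h ltac:(lra)). lra.
Qed.

Lemma cder_mult f g z a b : cder f z a -> cder g z b ->
  cder (fun w => f w * g w)%C z (a * g z + f z * b)%C.
Proof.
  intros [K1 [d1 [HK1 [Hd1 H1]]]] [K2 [d2 [HK2 [Hd2 H2]]]].
  pose proof (Cmod_ge_0 a). pose proof (Cmod_ge_0 b).
  pose proof (Cmod_ge_0 (f z)). pose proof (Cmod_ge_0 (g z)).
  exists (Cmod a * Cmod b + K1 * (Cmod (g z) + Cmod b + K2) + K2 * (Cmod (f z) + Cmod a)), (Rmin 1 (Rmin d1 d2)).
  repeat split; [repeat apply Rplus_le_le_0_compat; apply Rmult_le_pos; lra| repeat apply Rmin_pos; lra|].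
  intros h Hh. pose proof (Rmin_l 1 (Rmin d1 d2)). pose proof (Rmin_r 1 (Rmin d1 d2)).
  pose proof (Rmin_l d1 d2). pose proof (Rmin_r d1 d2).
  specialize (H1 h ltac:(lra)). specialize (H2 h ltac:(lra)).
  set (e1 := (f (z + h) - f z - h * a)%C) in *. set (e2 := (g (z + h) - g z - h * b)%C) in *.
  replace (f (z + h) * g (z + h) - f z * g z - h * (a * g z + f z * b))%C
    with ((h * h) * (a * b) + e1 * (g z + h * b + e2) + e2 * (f z + h * a))%C by (unfold e1, e2; ring).
  pose proof (Cmod_ge_0 h).
  assert (Hh2 : Cmod h ^ 2 <= 1) by nra.
  assert (Hh2' : 0 <= Cmod h ^ 2) by nra.
  assert (B1 : Cmod (g z + h * b + e2)%C <= Cmod (g z) + Cmod b + K2).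
  { eapply Rle_trans; [apply Cmod_triangle|]. apply Rplus_le_compat; [|nra].
    eapply Rle_trans; [apply Cmod_triangle|]. apply Rplus_le_compat_l. rewrite Cmod_mult. nra. }
  assert (B2 : Cmod (f z + h * a)%C <= Cmod (f z) + Cmod a).
  { eapply Rle_trans; [apply Cmod_triangle|]. apply Rplus_le_compat_l. rewrite Cmod_mult. nra. }
  eapply Rle_trans; [apply Cmod_triangle|]. eapply Rle_trans; [apply Rplus_le_compat_r, Cmod_triangle|].
  rewrite !Cmod_mult in *.
  assert (Cmod e1 * Cmod (g z + h * b + e2)%C <= (K1 * Cmod h ^ 2) * (Cmod (g z) + Cmod b + K2))
    by (apply Rmult_le_compat; auto using Cmod_ge_0).
  assert (Cmod e2 * Cmod (f z + h * a)%C <= (K2 * Cmod h ^ 2) * (Cmod (f z) + Cmod a))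
    by (apply Rmult_le_compat; auto using Cmod_ge_0).
  nra.
Qed.

Lemma cder_scal c f z a : cder f z a -> cder (fun w => c * f w)%C z (c * a)%C.
Proof.
  intros H. eapply cder_eq; [|apply (cder_mult (fun _ => c) f z); [apply cder_const|exact H]]. ring.
Qed.

Lemma cder_minus f g z a b : cder f z a -> cder g z b -> cder (fun w => f w - g w)%C z (a - b)%C.
Proof.
  intros H1 H2. apply (cder_ext (fun w => f w + (-(1)) * g w)%C _ _ _ 1); [lra|intros; ring|].
  replace (a - b)%C with (a + (-(1)) * b)%C by ring. apply cder_plus; auto. apply cder_scal; auto.
Qed.

Lemma cder_comp f g z a b : cder f (g z) a -> cder g z b -> cder (fun w => f (g w)) z (b * a)%C.
Proof.
  intros [K1 [d1 [HK1 [Hd1 H1]]]] [K2 [d2 [HK2 [Hd2 H2]]]].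
  pose proof (Cmod_ge_0 a). pose proof (Cmod_ge_0 b).
  set (L := Cmod b + K2 + 1). assert (HL : 0 < L) by (unfold L; lra).
  exists (K1 * L ^ 2 + Cmod a * K2), (Rmin 1 (Rmin d2 (d1 / L))).
  repeat split.
  { apply Rplus_le_le_0_compat; apply Rmult_le_pos; auto. apply pow2_ge_0. }
  { repeat apply Rmin_pos; try lra. apply Rdiv_lt_0_compat; lra. }
  intros h Hh. pose proof (Rmin_l 1 (Rmin d2 (d1 / L))). pose proof (Rmin_r 1 (Rmin d2 (d1 / L))).
  pose proof (Rmin_l d2 (d1 / L)). pose proof (Rmin_r d2 (d1 / L)).
  specialize (H2 h ltac:(lra)). pose proof (Cmod_ge_0 h).
  set (k := (g (z + h) - g z)%C).
  assert (Hk : Cmod k <= L * Cmod h).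
  { replace k with (h * b + (g (z + h) - g z - h * b))%C by (unfold k; ring).
    eapply Rle_trans; [apply Cmod_triangle|]. rewrite Cmod_mult. unfold L.
    assert (K2 * Cmod h ^ 2 <= K2 * Cmod h) by (apply Rmult_le_compat_l; nra). lra. }
  assert (Hkd : Cmod k < d1).
  { eapply Rle_lt_trans; [apply Hk|]. apply Rlt_le_trans with (L * (d1 / L)).
    - apply Rmult_lt_compat_l; lra.
    - right. field. lra. }
  specialize (H1 k Hkd). replace (g z + k)%C with (g (z + h)%C) in H1 by (unfold k; ring).
  replace (f (g (z + h)) - f (g z) - h * (b * a))%C
    with ((f (g (z + h)) - f (g z) - k * a) + (g (z + h) - g z - h * b) * a)%C by (unfold k; ring).
  eapply Rle_trans; [apply Cmod_triangle|]. rewrite Cmod_mult.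
  pose proof (Cmod_ge_0 k).
  assert (K1 * Cmod k ^ 2 <= K1 * (L * Cmod h) ^ 2).
  { apply Rmult_le_compat_l; auto. apply pow_incr. lra. }
  nra.
Qed.

Lemma cder_inv (z : C) : z <> 0 -> cder (fun w => / w)%C z (- / (z * z))%C.
Proof.
  intros Hz. pose proof (proj1 (Cmod_gt_0 z) Hz) as Hm.
  exists (2 / Cmod z ^ 3), (Cmod z / 2). repeat split; try lra.
  { left. apply Rdiv_lt_0_compat; [lra|]. apply pow_lt; lra. }
  intros h Hh. pose proof (Cmod_triangle_inv z h) as Ht.
  assert (Hzh : (z + h)%C <> RtoC 0) by (apply Cmod_gt_0; lra).
  replace (/ (z + h) - / z - h * - / (z * z))%C with ((h * h) / (z * z * (z + h)))%C by (field; auto).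
  rewrite Cmod_div by (repeat apply Cmult_neq_0; auto). rewrite !Cmod_mult.
  pose proof (Cmod_ge_0 h).
  replace (2 / Cmod z ^ 3 * Cmod h ^ 2) with (Cmod h * Cmod h / (Cmod z * Cmod z * (Cmod z / 2))) by (field; lra).
  apply Rmult_le_compat_l; [nra|]. apply Rinv_le_contravar; [repeat apply Rmult_lt_0_compat; lra|].
  apply Rmult_le_compat_l; [nra|lra].
Qed.

Lemma cder_Cexp z : cder Cexp z (Cexp z).
Proof.
  exists (exp (Re z) * (3 * exp 1)), 1. repeat split; try lra.
  { pose proof (exp_pos (Re z)). pose proof (exp_pos 1). apply Rmult_le_pos; lra. }
  intros h Hh. rewrite Cexp_plus.
  replace (Cexp z * Cexp h - Cexp z - h * Cexp z)%C with (Cexp z * (Cexp h - 1 - h))%C by ring.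
  rewrite Cmod_mult, Cmod_Cexp, Rmult_assoc. apply Rmult_le_compat_l; [left; apply exp_pos|].
  eapply Rle_trans; [apply Cexp_quad|].
  replace (3 * exp 1 * Cmod h ^ 2) with (3 * Cmod h ^ 2 * exp 1) by ring.
  apply Rmult_le_compat_l; [pose proof (pow2_ge_0 (Cmod h)); lra|]. apply exp_le_mono; lra.
Qed.

Lemma cder_Cexp_comp f z a : cder f z a -> cder (fun w => Cexp (f w)) z (a * Cexp (f z))%C.
Proof. intros H. apply (cder_comp Cexp f); auto. apply cder_Cexp. Qed.

Lemma is_derive_quad (f : R -> R) (x l K d : R) : 0 <= K -> 0 < d ->
  (forall h, Rabs h < d -> Rabs (f (x + h) - f x - h * l) <= K * h ^ 2) -> is_derive f x l.
Proof.
  intros HK Hd H. apply is_derive_Reals. intros eps Heps.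
  assert (Hp : 0 < Rmin d (eps / (K + 1))).
  { apply Rmin_pos; auto. apply Rdiv_lt_0_compat; lra. }
  exists (mkposreal _ Hp). intros h Hh0 Hh. simpl in Hh.
  pose proof (Rmin_l d (eps / (K + 1))). pose proof (Rmin_r d (eps / (K + 1))).
  specialize (H h ltac:(lra)).
  replace ((f (x + h) - f x) / h - l) with ((f (x + h) - f x - h * l) / h) by (field; auto).
  unfold Rdiv. rewrite Rabs_mult, Rabs_inv.
  assert (Hah : 0 < Rabs h) by (apply Rabs_pos_lt; auto).
  apply Rmult_lt_reg_r with (Rabs h); auto. rewrite Rmult_assoc, Rinv_l, Rmult_1_r by lra.
  eapply Rle_lt_trans; [apply H|]. rewrite <- (pow2_abs h).
  apply Rle_lt_trans with (K * (eps / (K + 1)) * Rabs h).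
  { simpl. rewrite Rmult_1_r, <- Rmult_assoc. apply Rmult_le_compat_r; [lra|]. apply Rmult_le_compat_l; lra. }
  apply Rmult_lt_compat_r; auto. unfold Rdiv.
  apply Rmult_lt_reg_r with (K + 1); [lra|]. rewrite Rmult_assoc, Rmult_assoc, Rinv_l by lra. nra.
Qed.

(** Restriction to a line, the direction [v] entering by the chain rule; it brings the real mean
    value theorem and the uniqueness of real derivatives to bear on [cder]. *)
Lemma cder_line f (p v : C) (t : R) (l : C) : cder f (p + t * v)%C l ->
  is_derive (fun t : R => Re (f (p + t * v)%C)) t (Re (v * l)%C) /\
  is_derive (fun t : R => Im (f (p + t * v)%C)) t (Im (v * l)%C).
Proof.
  intros [K [d [HK [Hd H]]]]. pose proof (Cmod_ge_0 v) as Hv.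
  assert (G : forall h : R, Rabs h < d / (Cmod v + 1) ->
    Cmod (f (p + (t + h)%R * v) - f (p + t * v) - h * (v * l))%C <= K * Cmod v ^ 2 * h ^ 2).
  { intros h Hh.
    replace (p + (t + h)%R * v)%C with (p + t * v + h * v)%C by (rewrite RtoC_plus; ring).
    replace (h * (v * l))%C with (h * v * l)%C by ring.
    eapply Rle_trans; [apply H|].
    - rewrite Cmod_mult, Cmod_R. apply Rle_lt_trans with (Rabs h * (Cmod v + 1)).
      + apply Rmult_le_compat_l; [apply Rabs_pos|lra].
      + apply Rlt_le_trans with (d / (Cmod v + 1) * (Cmod v + 1)).
        * apply Rmult_lt_compat_r; lra.
        * right; field; lra.
    - rewrite Cmod_mult, Cmod_R, Rpow_mult_distr, pow2_abs. right; ring. }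
  assert (Hd' : 0 < d / (Cmod v + 1)) by (apply Rdiv_lt_0_compat; lra).
  assert (HK' : 0 <= K * Cmod v ^ 2) by (apply Rmult_le_pos; auto; apply pow2_ge_0).
  split; apply is_derive_quad with (K * Cmod v ^ 2) (d / (Cmod v + 1)); auto; intros h Hh;
    specialize (G h Hh).
  - rewrite <- Re_RtoC_mult, <- !Re_Cminus. eapply Rle_trans; [apply re_le_Cmod|]. exact G.
  - rewrite <- Im_RtoC_mult, <- !Im_Cminus. eapply Rle_trans; [apply im_le_Cmod|]. exact G.
Qed.

Lemma is_derive_0_const (f : R -> R) a b :
  (forall t, Rmin a b <= t <= Rmax a b -> is_derive f t 0) -> f a = f b.
Proof.
  intros H. destruct (MVT_gen f a b (fun _ => 0)) as [c [_ Hc]].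
  - intros; apply H; lra.
  - intros t Ht. apply continuity_pt_filterlim.
    apply (ex_derive_continuous (V := R_NormedModule)). eexists; apply H; auto.
  - lra.
Qed.

(** The half-plane is convex, and along the segment from [z1] to [z2] both components have
    derivative 0. This takes the place of the complex logarithm and of analytic continuation. *)
Lemma cder_0_const (f : C -> C) (z1 z2 : C) : 0 < Re z1 -> 0 < Re z2 ->
  (forall z, 0 < Re z -> cder f z 0) -> f z1 = f z2.
Proof.
  intros H1 H2 H.
  assert (G : forall t, Rmin 0 1 <= t <= Rmax 0 1 -> cder f (z1 + t * (z2 - z1))%C 0).
  { intros t Ht. rewrite Rmin_left, Rmax_right in Ht by lra. apply H.
    rewrite Re_Cplus, Re_RtoC_mult, Re_Cminus. nra. }
  assert (E1 : (z1 + (0:R) * (z2 - z1))%C = z1) by ring.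
  assert (E2 : (z1 + (1:R) * (z2 - z1))%C = z2) by ring.
  apply C_eq.
  - transitivity (Re (f (z1 + (0:R) * (z2 - z1))%C)); [rewrite E1; reflexivity|].
    transitivity (Re (f (z1 + (1:R) * (z2 - z1))%C)); [|rewrite E2; reflexivity].
    apply (is_derive_0_const (fun t : R => Re (f (z1 + t * (z2 - z1))%C))).
    intros t Ht. destruct (cder_line f z1 (z2 - z1)%C t 0 (G t Ht)) as [D _].
    rewrite Cmult_0_r in D. exact D.
  - transitivity (Im (f (z1 + (0:R) * (z2 - z1))%C)); [rewrite E1; reflexivity|].
    transitivity (Im (f (z1 + (1:R) * (z2 - z1))%C)); [|rewrite E2; reflexivity].
    apply (is_derive_0_const (fun t : R => Im (f (z1 + t * (z2 - z1))%C))).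
    intros t Ht. destruct (cder_line f z1 (z2 - z1)%C t 0 (G t Ht)) as [_ D].
    rewrite Cmult_0_r in D. exact D.
Qed.

(** Since the majorant [b] does not depend on [h], the sum of the quadratic remainders is again a
    quadratic remainder. *)
Lemma cder_series (f f' : nat -> C -> C) (z : C) (b : nat -> R) (d : R) :
  0 < d -> (forall h, Cmod h < d -> summ (fun n => f n (z + h)%C)) -> summ (fun n => f' n z) ->
  (forall n h, Cmod h < d -> Cmod (f n (z + h) - f n z - h * f' n z)%C <= b n * Cmod h ^ 2) ->
  ex_series b -> (forall n, 0 <= b n) ->
  cder (fun w => CSer (fun n => f n w)) z (CSer (fun n => f' n z)).
Proof.
  intros Hd Hs Hs' Hq Hb Pb. exists (Series b), d. repeat split; auto.
  { apply Series_nonneg; auto. }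
  intros h Hh.
  assert (S0 : summ (fun n => f n z)).
  { specialize (Hs 0). rewrite Cmod_0, Cplus_0_r in Hs. auto. }
  rewrite <- CSer_scal, <- !CSer_minus; auto using summ_minus, summ_scal.
  rewrite <- Series_scal_r. apply CSer_Cmod_le_b; auto. apply ex_series_scal_r; auto.
Qed.

(** * Partial fractions of the hyperbolic cotangent and its derivative *)

Lemma PI_bounds : 3.1415 < PI < 3.1416.
Proof.
  pose proof (PI_2_3_7_ineq 4) as H. 
  unfold PI_2_3_7_tg, tg_alt, Ratan_seq in H. simpl in H. lra.
Qed.

(** [csh] is the hyperbolic sine, [ce w + 1/2] is half the hyperbolic cotangent of [w / 2], and
    [cphi w] is both the derivative of [- ce] and [1 / (4 sinh (w / 2) ^ 2)]. *)
Definition csh (y : C) : C := ((Cexp y - Cexp (- y)) / 2)%C.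
Definition ce (w : C) : C := (/ (Cexp w - 1))%C.
Definition cphi (w : C) : C := (Cexp w / ((Cexp w - 1) * (Cexp w - 1)))%C.

Lemma Cmod2_csh y : Cmod (csh y) ^ 2 =
  ((exp (Re y) - exp (- Re y)) / 2) ^ 2 + (sin (Im y)) ^ 2.
Proof.
  rewrite Cmod2_alt. unfold csh.
  replace ((Cexp y - Cexp (- y)) / 2)%C with ((/ 2)%R * (Cexp y - Cexp (- y)))%C
    by (rewrite RtoC_inv by lra; field).
  rewrite Re_RtoC_mult, Im_RtoC_mult, Re_Cminus, Im_Cminus. 
  change (Re (Cexp (- y))) with (exp (- Re y) * cos (- Im y)).
  change (Im (Cexp (- y))) with (exp (- Re y) * sin (- Im y)).
  change (Re (Cexp y)) with (exp (Re y) * cos (Im y)).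
  change (Im (Cexp y)) with (exp (Re y) * sin (Im y)).
  rewrite cos_neg, sin_neg, exp_Ropp.
  set (E := exp (Re y)). assert (HE : E <> 0) by (apply Rgt_not_eq, exp_pos).
  pose proof (sin2_cos2 (Im y)) as H. unfold Rsqr in H.
  replace (sin (Im y) ^ 2) with (sin (Im y) * sin (Im y)) by ring.
  set (s := sin (Im y)) in *. set (c := cos (Im y)) in *.
  replace ((/ 2 * (E * c - / E * c)) ^ 2 + (/ 2 * (E * s - / E * - s)) ^ 2)
    with ((/2 * (E - /E)) ^ 2 * (s * s + c * c) + s * s) by (field; auto).
  rewrite H. field; auto.
Qed.

Lemma sinh_half_lower a : (a / 2) ^ 2 <= ((exp a - exp (- a)) / 2) ^ 2.
Proof.
  assert (G : forall a, 0 <= a -> a <= exp a - exp (- a)).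
  { intros b Hb. pose proof (exp_ineq1_le b) as H1.
    assert (H2 : exp (- b) <= 1) by (rewrite <- exp_0; apply exp_le_mono; lra). lra. }
  destruct (Rle_dec 0 a) as [H|H].
  - specialize (G a H). apply pow_incr. lra.
  - specialize (G (- a) ltac:(lra)). rewrite Ropp_involutive in G.
    replace ((a / 2) ^ 2) with ((- a / 2) ^ 2) by field.
    replace (((exp a - exp (- a)) / 2) ^ 2) with (((exp (- a) - exp a) / 2) ^ 2) by field.
    apply pow_incr. lra.
Qed.

Lemma abs_sin_lower b : Rabs b <= 3 * PI / 4 -> Rabs b / 20 <= Rabs (sin b).
Proof.
  assert (G : forall b, 0 <= b <= 3 * PI / 4 -> b / 20 <= sin b).
  { clear b. intros b Hb. pose proof PI_bounds.
    replace b with (2 * (b / 2)) at 2 by field. rewrite sin_2a.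
    set (u := b / 2). assert (Hu : 0 <= u <= 1.1782) by (unfold u; lra).
    pose proof (one_minus_cos_le u) as Hc.
    assert (Hs : u * (1 - u ^ 2 / 2) <= sin u).
    { destruct (MVT_gen sin 0 u cos) as [c [Hc1 Hc2]].
      - intros; apply is_derive_sin.
      - intros; apply continuity_sin.
      - rewrite sin_0, !Rminus_0_r in Hc2. rewrite Hc2.
        rewrite Rmin_left, Rmax_right in Hc1 by lra.
        pose proof (one_minus_cos_le c). rewrite Rmult_comm. apply Rmult_le_compat_r; [lra|]. nra. }
    assert (0.3 <= 1 - u ^ 2 / 2) by nra.
    replace (b / 20) with (u / 10) by (unfold u; field).
    assert (0.3 * u <= sin u) by nra. nra. }
  intros H. destruct (Rle_dec 0 b) as [Hb|Hb].
  - rewrite Rabs_pos_eq in * by lra. specialize (G b ltac:(lra)).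
    eapply Rle_trans; [apply G|apply Rle_abs].
  - rewrite <- (Rabs_Ropp (sin b)), <- sin_neg. rewrite <- Rabs_Ropp in *.
    rewrite (Rabs_pos_eq (- b)) in * by lra. specialize (G (- b) ltac:(lra)).
    eapply Rle_trans; [apply G|apply Rle_abs].
Qed.

(** The strip contains no zero of the hyperbolic sine but 0. It has to be wider than
    [|Im y| <= PI / 2], because the scaled lattice points displaced by [w] reach up to
    [(PI + 1) / 2]. The constant 20 is merely convenient. *)
Lemma csh_lower y : Rabs (Im y) <= 3 * PI / 4 -> Cmod y / 20 <= Cmod (csh y).
Proof.
  intros H. apply abs_sin_lower in H. pose proof (sinh_half_lower (Re y)) as H2.
  apply Rsqr_incr_0_var; [|apply Cmod_ge_0].
  rewrite !Rsqr_pow2, Cmod2_csh.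
  replace ((Cmod y / 20) ^ 2) with (Cmod y ^ 2 / 400) by field. rewrite Cmod2_alt.
  rewrite <- (pow2_abs (sin (Im y))), <- (pow2_abs (Im y)).
  pose proof (Rabs_pos (Im y)).
  assert ((Rabs (Im y) / 20) ^ 2 <= Rabs (sin (Im y)) ^ 2) by (apply pow_incr; lra).
  pose proof (pow2_ge_0 (Re y)). lra.
Qed.

Lemma csh_quad y : Cmod (csh y - y)%C <= 3 * Cmod y ^ 2 * exp (Cmod y).
Proof.
  pose proof (Cexp_quad y) as H1. pose proof (Cexp_quad (- y)%C) as H2. rewrite Cmod_opp in H2.
  replace (csh y - y)%C with ((/2)%R * ((Cexp y - 1 - y) - (Cexp (- y) - 1 - - y)))%C.
  - rewrite Cmod_mult, Cmod_R, Rabs_pos_eq by lra.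
    pose proof (Cmod_triangle_minus (Cexp y - 1 - y) (Cexp (- y) - 1 - - y)). lra.
  - unfold csh. rewrite RtoC_inv by lra. field.
Qed.

Lemma is_lim_seq_inv_pow2 : is_lim_seq (fun n => / 2 ^ n) 0.
Proof.
  apply is_lim_seq_ext with (fun n => (/ 2) ^ n). { intros; apply pow_inv. }
  apply is_lim_seq_geom. rewrite Rabs_pos_eq; lra.
Qed.

Lemma pow2_pos n : 0 < 2 ^ n.
Proof. apply pow_lt; lra. Qed.

Lemma pow2_ge1 n : 1 <= 2 ^ n.
Proof. apply pow_R1_Rle; lra. Qed.

Lemma RtoC_neq0 (x : R) : x <> 0 -> RtoC x <> 0.
Proof. intros H E. apply H. apply RtoC_inj in E. exact E. Qed.

Lemma clim_csh u : clim (fun n => (2 ^ n)%R * csh (u / (2 ^ n)%R))%C u.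
Proof.
  apply clim_squeeze0 with (fun n => 3 * Cmod u ^ 2 * exp (Cmod u) * / 2 ^ n).
  - exists 0%nat. intros n _. pose proof (pow2_pos n) as Hp. pose proof (pow2_ge1 n) as Hg.
    set (M := 2 ^ n) in *. assert (HM : RtoC M <> 0) by (apply RtoC_neq0; lra).
    replace (M * csh (u / M) - u)%C with (M * (csh (u / M) - u / M))%C by (field; auto).
    rewrite Cmod_mult, Cmod_R, Rabs_pos_eq by lra.
    pose proof (csh_quad (u / M)%C) as H.
    assert (E : Cmod (u / M)%C = Cmod u / M) by (rewrite Cmod_div, Cmod_R, Rabs_pos_eq; auto; lra).
    rewrite E in H. pose proof (Cmod_ge_0 u).
    assert (Hle : Cmod u / M <= Cmod u).
    { unfold Rdiv. rewrite <- (Rmult_1_r (Cmod u)) at 2. apply Rmult_le_compat_l; auto.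
      rewrite <- Rinv_1. apply Rinv_le_contravar; lra. }
    apply Rle_trans with (M * (3 * (Cmod u / M) ^ 2 * exp (Cmod u))).
    + apply Rmult_le_compat_l; [lra|]. eapply Rle_trans; [apply H|].
      apply Rmult_le_compat_l; [pose proof (pow2_ge_0 (Cmod u / M)); lra|]. apply exp_le_mono; auto.
    + right. field. lra.
  - replace (Finite 0) with (Rbar_mult (3 * Cmod u ^ 2 * exp (Cmod u)) 0) by (simpl; f_equal; ring).
    apply is_lim_seq_scal_l, is_lim_seq_inv_pow2.
Qed.

Lemma clim_inv u (l : C) : l <> 0 -> clim u l -> clim (fun n => / u n)%C (/ l)%C.
Proof.
  intros Hl H. pose proof (proj1 (Cmod_gt_0 l) Hl) as Hm. intros eps Heps.
  destruct (H (Rmin (Cmod l / 2) (eps * (Cmod l * (Cmod l / 2))))) as [N HN].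
  { apply Rmin_pos; [lra|]. repeat apply Rmult_lt_0_compat; lra. }
  exists N. intros n Hn. specialize (HN n Hn).
  pose proof (Rmin_l (Cmod l / 2) (eps * (Cmod l * (Cmod l / 2)))).
  pose proof (Rmin_r (Cmod l / 2) (eps * (Cmod l * (Cmod l / 2)))).
  pose proof (Cmod_triangle_inv l (u n - l)) as Ht.
  replace (l + (u n - l))%C with (u n) in Ht by ring.
  assert (Hu : u n <> RtoC 0) by (apply Cmod_gt_0; lra).
  replace (/ u n - / l)%C with ((l - u n) / (l * u n))%C by (field; auto).
  rewrite Cmod_div, Cmod_mult, Cmod_minus_sym by (apply Cmult_neq_0; auto).
  apply Rmult_lt_reg_r with (Cmod l * Cmod (u n)); [apply Rmult_lt_0_compat; lra|].
  unfold Rdiv. rewrite Rmult_assoc, Rinv_l, Rmult_1_r by (apply Rgt_not_eq, Rmult_lt_0_compat; lra).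
  eapply Rlt_le_trans; [apply HN|]. eapply Rle_trans; [eassumption|].
  apply Rmult_le_compat_l; [lra|]. apply Rmult_le_compat_l; lra.
Qed.

Lemma clim_mult u v a b : clim u a -> clim v b -> clim (fun n => u n * v n)%C (a * b)%C.
Proof.
  intros Hu Hv. destruct (clim_bounded v b Hv) as [K [HK [N HN]]].
  intros eps Heps.
  pose proof (clim_scal a v b Hv (eps / 2) ltac:(lra)) as [N1 H1].
  destruct (Hu (eps / 2 / K)) as [N2 H2]. { apply Rdiv_lt_0_compat; lra. }
  exists (N + N1 + N2)%nat. intros n Hn.
  specialize (HN n ltac:(lia)). specialize (H1 n ltac:(lia)). specialize (H2 n ltac:(lia)).
  replace (u n * v n - a * b)%C with ((u n - a) * v n + (a * v n - a * b))%C by ring.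
  eapply Rle_lt_trans; [apply Cmod_triangle|]. rewrite Cmod_mult.
  assert (Cmod (u n - a)%C * Cmod (v n) <= eps / 2 / K * K).
  { apply Rmult_le_compat; auto using Cmod_ge_0. lra. }
  replace (eps / 2 / K * K) with (eps / 2) in * by (field; lra). lra.
Qed.

Lemma INR_pow2 n : INR (2 ^ n) = 2 ^ n.
Proof. rewrite pow_INR. reflexivity. Qed.

(** Halving sends the point of index [k] at level [n] to the indices [k] and [2 ^ n + k] at level
    [n + 1], the second being the shift by [PI * Ci]. The first conjunct travels along so that the
    duplication formula is never applied at a pole. *)
Lemma dup_sum (g : C -> C) (kap w : C) :
  (forall y, Cexp y <> 1 -> g y = (kap * (g (y / 2) + g (y / 2 + PI * Ci)))%C) ->
  Cexp w <> 1 -> forall n,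
  (forall k, (k < 2 ^ n)%nat -> Cexp ((w + 2 * PI * Ci * INR k) / (2 ^ n)%R) <> 1)%C /\
  g w = (kap ^ n * csum (fun k => g ((w + 2 * PI * Ci * INR k) / (2 ^ n)%R)) (2 ^ n))%C.
Proof.
  intros Hg Hw. 
  assert (H2 : RtoC 2 <> 0) by (apply RtoC_neq0; lra).
  induction n as [|n [IH1 IH2]].
  - split.
    + intros k Hk. simpl in Hk. assert (k = 0%nat) by lia; subst.
      simpl pow. replace ((w + 2 * PI * Ci * INR 0) / 1)%C with w; auto. simpl. field.
    + simpl. rewrite Cmult_1_l, Cplus_0_l. f_equal. field.
  - pose proof (pow2_pos n) as Hp. set (M := 2 ^ n) in *.
    assert (HM : RtoC M <> 0) by (apply RtoC_neq0; lra).
    assert (EM : (2 ^ S n)%R = (2 * M)%R) by reflexivity.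
    split.
    + intros k Hk E.
      assert (Hk' : exists k', (k' < 2 ^ n)%nat /\ (k = k' \/ k = 2 ^ n + k')%nat).
      { destruct (Nat.lt_ge_cases k (2 ^ n)) as [L|L]; [exists k; auto|].
        exists (k - 2 ^ n)%nat. simpl in Hk. split; [lia|]. right. lia. }
      destruct Hk' as [k' [Hk1 Hk2]]. apply (IH1 k' Hk1).
      assert (E2 : Cexp ((w + 2 * PI * Ci * INR k) / (2 ^ S n)%R + (w + 2 * PI * Ci * INR k) / (2 ^ S n)%R)%C = 1).
      { rewrite Cexp_plus, E. ring. }
      destruct Hk2 as [-> | ->].
      * rewrite <- E2. f_equal. rewrite EM, RtoC_mult. field. auto.
      * rewrite plus_INR, INR_pow2 in E2. fold M in E2.
        replace ((w + 2 * PI * Ci * (M + INR k')%R) / (2 ^ S n)%R + (w + 2 * PI * Ci * (M + INR k')%R) / (2 ^ S n)%R)%C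
          with ((w + 2 * PI * Ci * INR k') / M + 2 * PI * Ci)%C in E2.
        -- rewrite Cexp_plus, Cexp_2PI, Cmult_1_r in E2. exact E2.
        -- rewrite EM, RtoC_mult, RtoC_plus. field. auto.
    + rewrite IH2.
      replace (2 ^ S n)%nat with (2 ^ n + 2 ^ n)%nat by (simpl; lia).
      rewrite csum_add, <- csum_plus. simpl Cpow.
      replace (kap * kap ^ n)%C with (kap ^ n * kap)%C by ring.
      match goal with |- (_ * ?A = kap ^ n * kap * ?B)%C =>
        cut (A = kap * B)%C; [intros ->; ring|] end.
      rewrite <- csum_scal. apply csum_ext. intros k Hk.
      rewrite Hg by (apply IH1; auto). f_equal. f_equal; f_equal.
      * rewrite EM, RtoC_mult. field. auto.
      * rewrite plus_INR, INR_pow2. fold M. rewrite EM, RtoC_mult, RtoC_plus. field. auto.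
Qed.

(** Index 0 is the central point, [L] its antipode, and [S k] is paired with [2 L - 1 - k], which is
    [- S k] modulo [2 L]. *)
Lemma csum_fold (f : nat -> C) L : (0 < L)%nat ->
  csum f (2 * L) = (f 0%nat + csum (fun k => f (S k) + f (2 * L - 1 - k)%nat) (L - 1) + f L)%C.
Proof.
  intros HL. destruct L as [|m]; [lia|]. replace (S m - 1)%nat with m by lia.
  replace (2 * S m)%nat with (S m + S m)%nat by lia.
  rewrite csum_add. rewrite (csum_S_l (fun k => f (S m + k)%nat)).
  rewrite (csum_S_l f). rewrite (csum_rev (fun k => f (S m + S k)%nat) m).
  rewrite (csum_ext (fun k => (f (S k) + f (S m + S m - 1 - k)%nat)%C) (fun k => (f (S k) + f (S m + S (m - 1 - k))%nat)%C)).
  - rewrite csum_plus, Nat.add_0_r. ring.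
  - intros k Hk. do 2 f_equal. lia.
Qed.

(** Padding with zeros makes dominated convergence applicable to sums whose length grows. *)
Lemma csum_CSer (a : nat -> C) m : summ (fun k => if (k <? m)%nat then a k else RtoC 0) /\
  CSer (fun k => if (k <? m)%nat then a k else RtoC 0) = csum a m.
Proof.
  set (b := fun k => if (k <? m)%nat then a k else RtoC 0).
  assert (Hs : summ b).
  { apply (ex_series_incr_n (fun n => Cmod (b n)) m).
    apply ex_series_ext with (fun k => 0 ^ S k).
    - intros k. unfold b. replace (m + k <? m)%nat with false.
      + rewrite Cmod_0. simpl; ring.
      + symmetry. apply Nat.ltb_ge. lia.
    - apply (ex_series_incr_1 (fun n => 0 ^ n)). apply ex_series_geom. rewrite Rabs_R0; lra. }
  split; auto. apply CSer_unique; auto.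
  apply clim_ext_ev with (fun _ => csum a m) m; [|apply clim_const].
  intros n Hn. replace n with (m + (n - m))%nat by lia. rewrite csum_add.
  rewrite <- (Cplus_0_r (csum a m)). f_equal.
  - apply csum_ext. intros k Hk. unfold b. apply Nat.ltb_lt in Hk. rewrite Hk. auto.
  - generalize (n - m)%nat. induction n0; simpl; auto. rewrite <- IHn0. unfold b.
    replace (m + n0 <? m)%nat with false by (symmetry; apply Nat.ltb_ge; lia). ring.
Qed.

Definition om (k : nat) : C := (2 * PI * Ci * INR k)%C.

Lemma Im_om k : Im (om k) = 2 * PI * INR k.
Proof. unfold om, Ci. rewrite !Im_Cmult. rewrite !Re_Cmult. simpl. ring. Qed.

Lemma ex_series_inv_sq : ex_series (fun k => / INR (S k) ^ 2).
Proof.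
  apply ex_series_le_R with (fun k => 2 * (/ INR (S k) - / INR (S (S k)))).
  - intros k. pose proof (INR_S_pos k) as H. rewrite (S_INR (S k)).
    assert (H1 : 1 <= INR (S k)) by apply INR_S_ge1.
    split; [left; apply Rinv_0_lt_compat; nra|].
    set (x := INR (S k)) in *.
    replace (2 * (/ x - / (x + 1))) with (2 / (x * (x + 1))) by (field; lra).
    apply Rmult_le_reg_r with (x ^ 2 * (x + 1)); [nra|].
    replace (/ x ^ 2 * (x ^ 2 * (x + 1))) with (x + 1) by (field; lra).
    replace (2 / (x * (x + 1)) * (x ^ 2 * (x + 1))) with (2 * x) by (field; lra). lra.
  - apply ex_series_Rmult_l. exists 1. apply is_series_sum_f_R0.
    apply is_lim_seq_ext with (fun n => 1 - / INR (S (S n))).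
    + induction n; [simpl; field|]. rewrite tech5, <- IHn. ring.
    + replace (Finite 1) with (Finite (1 - 0)) by (f_equal; ring).
      apply is_lim_seq_minus'; [apply is_lim_seq_const|].
      apply (is_lim_seq_incr_1 (fun n => / INR (S n))), (is_lim_seq_incr_1 (fun n => / INR n)).
      replace (Finite 0) with (Rbar_inv p_infty) by reflexivity.
      apply is_lim_seq_inv; [apply is_lim_seq_INR|discriminate].
Qed.

Lemma pow2_unbounded (X : R) : exists N, forall n, (N <= n)%nat -> X <= 2 ^ n.
Proof.
  destruct (INR_unbounded X) as [N HN]. exists N. intros n Hn.
  rewrite <- INR_pow2. apply Rle_trans with (INR N); [lra|]. apply le_INR.
  pose proof (Nat.pow_gt_lin_r 2 n ltac:(lia)). lia.
Qed.

(* Iterating the duplication formula writes [g w] as a sum over [2 ^ n] points; folding it around the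
   origin makes dominated convergence applicable as [n] grows. *)
Lemma partial_fraction_duplication (g : C -> C) (kap w A0 : C) (l : nat -> C) (b : nat -> R) (N0 : nat) :
  (forall y, Cexp y <> 1 -> g y = (kap * (g (y / 2) + g (y / 2 + PI * Ci)))%C) ->
  (forall y, g (y + 2 * PI * Ci)%C = g y) -> Cexp w <> 1 ->
  clim (fun n => kap ^ n * g (w / (2 ^ n)%R))%C A0 ->
  clim (fun n => kap ^ n * g (w / (2 ^ n)%R + PI * Ci))%C 0 ->
  (forall k, clim (fun n => kap ^ n * (g ((w + om (S k)) / (2 ^ n)%R) + g ((w - om (S k)) / (2 ^ n)%R)))%C (l k)) ->
  ex_series b -> (forall k, 0 <= b k) ->
  (forall n k, (N0 <= n)%nat -> (2 * S k < 2 ^ n)%nat ->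
     Cmod (kap ^ n * (g ((w + om (S k)) / (2 ^ n)%R) + g ((w - om (S k)) / (2 ^ n)%R)))%C <= b k) ->
  summ l /\ g w = (A0 + CSer l)%C.
Proof.
  intros Hdup Hper Hw HA Hpi Hl Hb Pb Hbound.
  set (pr := fun n k => (kap ^ n * (g ((w + om (S k)) / (2 ^ n)%R) + g ((w - om (S k)) / (2 ^ n)%R)))%C).
  set (a := fun n k => if (k <? 2 ^ (n - 1) - 1)%nat then pr n k else RtoC 0).
  assert (E2 : forall n, (1 <= n)%nat -> (2 ^ n = 2 * 2 ^ (n - 1))%nat).
  { intros n Hn. replace n with (S (n - 1)) at 1 by lia. reflexivity. }
  destruct (tannery a l b (N0 + 1)) as [T1 T2]; auto.
  - intros n k Hn. unfold a. destruct (Nat.ltb_spec k (2 ^ (n - 1) - 1)).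
    + apply Hbound; [lia|]. rewrite E2 by lia. lia.
    + rewrite Cmod_0. auto.
  - intros k. destruct (pow2_unbounded (INR (2 * S (S k)))) as [N HN].
    apply clim_ext_ev with (fun n => pr n k) (N + 1)%nat; [|apply Hl].
    intros n Hn. unfold a. specialize (HN n ltac:(lia)). rewrite <- INR_pow2 in HN. apply INR_le in HN.
    rewrite E2 in HN by lia.
    destruct (Nat.ltb_spec k (2 ^ (n - 1) - 1)); auto. lia.
  - split; auto. 
    apply clim_unique with (fun n => kap ^ n * g (w / (2 ^ n)%R) + CSer (a n) + kap ^ n * g (w / (2 ^ n)%R + PI * Ci))%C.
    2: { replace (A0 + CSer l)%C with (A0 + CSer l + 0)%C by ring. repeat apply clim_plus; auto. }
    apply clim_ext_ev with (fun _ => g w) 1%nat; [|apply clim_const].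
    intros n Hn. destruct (dup_sum g kap w Hdup Hw n) as [_ ->].
    set (L := (2 ^ (n - 1))%nat).
    assert (HL : (0 < L)%nat) by (unfold L; apply Nat.neq_0_lt_0, Nat.pow_nonzero; lia).
    rewrite (E2 n Hn) at 1. fold L. rewrite csum_fold by auto.
    unfold a. fold L. rewrite (proj2 (csum_CSer (pr n) (L - 1))). unfold pr. rewrite csum_scal.
    assert (HM : (2 ^ n)%R = (2 * INR L)%R).
    { rewrite <- INR_pow2, (E2 n Hn), mult_INR. reflexivity. }
    rewrite HM. assert (HLr : RtoC (INR L) <> 0) by (apply RtoC_neq0, not_0_INR; lia).
    assert (H2 : RtoC 2 <> 0) by (apply RtoC_neq0; lra).
    rewrite !Cmult_plus_distr_l. f_equal; [f_equal|].
    + do 2 f_equal. simpl. f_equal. ring.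
    + f_equal. apply csum_ext. intros k Hk. f_equal.
      (* Periodicity replaces the index [2 L - S k] by [- S k]. *)
      rewrite <- (Hper ((w - om (S k)) / (2 * INR L)%R)%C). f_equal. unfold om.
      rewrite !minus_INR by lia. rewrite mult_INR. rewrite RtoC_S. simpl (INR 1). simpl (INR 2).
      rewrite !RtoC_minus, !RtoC_mult. replace (RtoC (1 + 1)) with (RtoC 2) by (f_equal; ring). field. auto.
    + do 2 f_equal. rewrite RtoC_mult. field. auto.
Qed.

(** * Duplication formulas and the two expansions *)

Lemma Cexp_half w : Cexp w = (Cexp (w / 2) * Cexp (w / 2))%C.
Proof. rewrite <- Cexp_plus. f_equal. field. Qed.

Lemma Cexp_sub1_csh w : (Cexp w - 1 = 2 * Cexp (w / 2) * csh (w / 2))%C.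
Proof.
  unfold csh. rewrite Cexp_opp, (Cexp_half w). field. apply Cexp_neq_0.
Qed.

Lemma cphi_csh w : csh (w / 2)%C <> 0 -> cphi w = (/ (2 * csh (w / 2) * (2 * csh (w / 2))))%C.
Proof.
  intros H. unfold cphi. rewrite Cexp_sub1_csh, (Cexp_half w). field. split; auto. apply Cexp_neq_0.
Qed.

Lemma ce_csh w : csh (w / 2)%C <> 0 -> ce w = (Cexp (- (w / 2)) / (2 * csh (w / 2)))%C.
Proof.
  intros H. unfold ce. rewrite Cexp_sub1_csh, Cexp_opp. field. split; auto. apply Cexp_neq_0.
Qed.

Lemma Cexp_shift_PI y : Cexp (y + PI * Ci)%C = (- Cexp y)%C.
Proof. rewrite Cexp_plus, Cexp_PI. ring. Qed.

Lemma Cexp_shift_2PI y : Cexp (y + 2 * PI * Ci)%C = Cexp y.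
Proof. rewrite Cexp_plus, Cexp_2PI. ring. Qed.

Lemma Cexp_half_neq (y : C) : Cexp y <> 1 ->
  (Cexp (y / 2) - 1)%C <> 0 /\ (- Cexp (y / 2) - 1)%C <> 0 /\ (Cexp (y / 2) * Cexp (y / 2) - 1)%C <> 0.
Proof.
  intros H. rewrite (Cexp_half y) in H. set (E := Cexp (y / 2)) in *.
  assert (G : (E * E - 1)%C <> 0).
  { intros G. apply H. replace (E * E)%C with (E * E - 1 + 1)%C by ring. rewrite G. ring. }
  repeat split; auto.
  - intros G'. apply G. replace (E * E - 1)%C with ((E - 1) * (E + 1))%C by ring. rewrite G'. ring.
  - intros G'. apply G. replace (E * E - 1)%C with ((- E - 1) * (- E + 1))%C by ring. rewrite G'. ring.
Qed.

Lemma cphi_dup y : Cexp y <> 1 -> cphi y = ((/ 4)%R * (cphi (y / 2) + cphi (y / 2 + PI * Ci)))%C.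
Proof.
  intros H. destruct (Cexp_half_neq y H) as [H1 [H2 H3]].
  unfold cphi. rewrite Cexp_shift_PI, (Cexp_half y), RtoC_inv by lra.
  field. repeat split; auto.
Qed.

(** The same duplication holds for [ce] itself; adding [1/2] makes the function odd, so that
    opposite points combine to a summable [O (1 / k ^ 2)]. *)
Lemma ce_dup y : Cexp y <> 1 ->
  (ce y + / 2 = (/ 2)%R * ((ce (y / 2) + / 2) + (ce (y / 2 + PI * Ci) + / 2)))%C.
Proof.
  intros H. destruct (Cexp_half_neq y H) as [H1 [H2 H3]].
  unfold ce. rewrite Cexp_shift_PI, (Cexp_half y), RtoC_inv by lra.
  field. repeat split; auto.
Qed.

(** Addition formula [coth a + coth b = sinh (a + b) / (sinh a * sinh b)]. For the points
    [w + om (S k)] and [w - om (S k)] the sum is [2 w], independent of [k], so the numerator is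
    too. *)
Lemma ce_pair p q : csh (p / 2)%C <> 0 -> csh (q / 2)%C <> 0 ->
  ((ce p + / 2) + (ce q + / 2) = 2 * csh ((p + q) / 2) / (2 * csh (p / 2) * (2 * csh (q / 2))))%C.
Proof.
  intros Hp Hq. unfold ce. rewrite !Cexp_sub1_csh.
  replace (csh ((p + q) / 2))%C with
    ((Cexp (p / 2) * Cexp (q / 2) - / (Cexp (p / 2) * Cexp (q / 2))) / 2)%C.
  2: { unfold csh. rewrite Cexp_opp. replace ((p + q) / 2)%C with (p / 2 + q / 2)%C by field.
       rewrite Cexp_plus. auto. }
  pose proof (Cexp_neq_0 (p / 2)) as E1. pose proof (Cexp_neq_0 (q / 2)) as E2.
  unfold csh in *. rewrite !Cexp_opp in *.
  set (P := Cexp (p / 2)) in *. set (Q := Cexp (q / 2)) in *.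
  assert (Hp' : (P * P - 1)%C <> 0).
  { intros G. apply Hp. replace ((P - / P) / 2)%C with ((P * P - 1) / (2 * P))%C by (field; auto). rewrite G. field; auto. }
  assert (Hq' : (Q * Q - 1)%C <> 0).
  { intros G. apply Hq. replace ((Q - / Q) / 2)%C with ((Q * Q - 1) / (2 * Q))%C by (field; auto). rewrite G. field; auto. }
  field. repeat split; auto.
Qed.

Section PartialFractions.

Variable w : C.
Variable c : R.
Hypothesis Hw0 : w <> 0.
Hypothesis Hw1 : Cexp w <> 1.
Hypothesis Hc : 0 < c.
Hypothesis Hlow : forall k, c * INR (S k) <= Cmod (w + om (S k))%C /\ c * INR (S k) <= Cmod (w - om (S k))%C.

(** Tends to [u] and is at least [|u| / 20] in modulus on the strip. The exponent is [S n] because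
    [cphi] and [ce] involve half of their argument. *)
Let y (n : nat) (u : C) : C := ((2 ^ S n)%R * csh (u / (2 ^ S n)%R))%C.

Lemma pf_half n (u : C) : (u / (2 ^ n)%R / 2 = u / (2 ^ S n)%R)%C.
Proof.
  simpl pow. rewrite RtoC_mult. field. apply RtoC_neq0; pose proof (pow2_pos n); lra.
Qed.

Lemma Im_div_R (u : C) (M : R) : 0 < M -> Im (u / M)%C = Im u / M.
Proof.
  intros H. replace (u / M)%C with ((/ M)%R * u)%C.
  - rewrite Im_RtoC_mult. field. lra.
  - rewrite RtoC_inv by lra. field. apply RtoC_neq0; lra.
Qed.

Lemma pf_y_lower n u : Rabs (Im u) <= 3 * PI / 4 * 2 ^ S n -> Cmod u / 20 <= Cmod (y n u).
Proof.
  intros H. pose proof (pow2_pos (S n)) as Hp. unfold y.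
  rewrite Cmod_mult, Cmod_R, Rabs_pos_eq by lra.
  assert (G : Cmod (u / (2 ^ S n)%R)%C / 20 <= Cmod (csh (u / (2 ^ S n)%R)%C)).
  { apply csh_lower. rewrite Im_div_R by auto. unfold Rdiv. rewrite Rabs_mult, Rabs_inv, (Rabs_pos_eq (2 ^ S n)) by lra.
    apply Rmult_le_reg_r with (2 ^ S n); auto. rewrite Rmult_assoc, Rinv_l by lra. lra. }
  rewrite Cmod_div, Cmod_R, Rabs_pos_eq in G by (try apply RtoC_neq0; lra).
  apply Rmult_le_compat_l with (r := 2 ^ S n) in G; [|lra].
  eapply Rle_trans; [|apply G]. right. field. lra.
Qed.

Lemma pf_y_neq0 n u : Rabs (Im u) <= 3 * PI / 4 * 2 ^ S n -> u <> 0 -> csh (u / (2 ^ n)%R / 2)%C <> 0.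
Proof.
  intros H Hu. rewrite pf_half. apply Cmod_gt_0 in Hu. apply pf_y_lower in H.
  intros E. unfold y in H. rewrite E, Cmult_0_r, Cmod_0 in H. lra.
Qed.

Lemma pf_clim_y u : clim (fun n => y n u) u.
Proof. apply (clim_ext (fun n => (2 ^ (n + 1))%R * csh (u / (2 ^ (n + 1))%R))%C).
  - intros n. rewrite Nat.add_1_r. reflexivity.
  - apply (clim_incr (fun n => (2 ^ n)%R * csh (u / (2 ^ n)%R))%C). apply clim_csh.
Qed.

Lemma pf_im_ev u : exists N, forall n, (N <= n)%nat -> Rabs (Im u) <= 3 * PI / 4 * 2 ^ S n.
Proof.
  destruct (pow2_unbounded (Rabs (Im u))) as [N HN]. exists N. intros n Hn.
  specialize (HN n Hn). pose proof PI_bounds. pose proof (pow2_pos n). simpl. nra.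
Qed.

Lemma pf_shift_ev : exists N, forall n, (N <= n)%nat ->
  Rabs (Im (w / (2 ^ S n)%R + PI * Ci / 2)%C) <= 3 * PI / 4 /\ 1 <= Cmod (w / (2 ^ S n)%R + PI * Ci / 2)%C.
Proof.
  destruct (pow2_unbounded (Rabs (Im w))) as [N HN]. exists N. intros n Hn.
  specialize (HN n Hn). pose proof PI_bounds. pose proof (pow2_pos n).
  assert (E : Im (w / (2 ^ S n)%R + PI * Ci / 2)%C = Im w / 2 ^ S n + PI / 2).
  { rewrite Im_Cplus, !Im_div_R by (try apply pow2_pos; lra).
    unfold Ci. rewrite Im_Cmult. simpl. field. lra. }
  assert (B : Rabs (Im w / 2 ^ S n) <= 1 / 2).
  { unfold Rdiv. rewrite Rabs_mult, Rabs_inv, (Rabs_pos_eq (2 ^ S n)) by (simpl; lra).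
    apply Rmult_le_reg_r with (2 ^ S n); [simpl; lra|]. rewrite Rmult_assoc, Rinv_l by (simpl; lra). simpl. lra. }
  apply Rabs_le_between in B. split.
  - rewrite E. apply Rabs_le. lra.
  - eapply Rle_trans; [|apply im_le_Cmod]. rewrite E. rewrite Rabs_pos_eq; lra.
Qed.

Lemma Cpow_RtoC (x : R) n : (RtoC x ^ n)%C = RtoC (x ^ n).
Proof. induction n; simpl; auto. rewrite IHn, RtoC_mult. auto. Qed.

Lemma pf_im_bound n k : Rabs (Im w) <= 2 ^ n -> (2 * S k < 2 ^ n)%nat ->
  Rabs (Im (w + om (S k))%C) <= 3 * PI / 4 * 2 ^ S n /\ Rabs (Im (w - om (S k))%C) <= 3 * PI / 4 * 2 ^ S n.
Proof.
  intros H Hk. apply lt_INR in Hk. rewrite INR_pow2, mult_INR in Hk. simpl (INR 2) in Hk.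
  rewrite Im_Cplus, Im_Cminus, Im_om. pose proof PI_bounds. pose proof (INR_S_pos k).
  assert (0 < 2 * PI * INR (S k)) by nra.
  apply Rabs_le_between in H.
  assert (2 * PI * INR (S k) <= PI * 2 ^ n) by nra.
  assert (2 ^ n * (PI + 1) <= 3 * PI / 4 * 2 ^ S n) by (simpl; pose proof (pow2_pos n); nra).
  split; apply Rabs_le; lra.
Qed.

Lemma pf_neq0 k : (w + om (S k))%C <> 0 /\ (w - om (S k))%C <> 0.
Proof.
  pose proof (INR_S_pos k). destruct (Hlow k).
  assert (0 < c * INR (S k)) by nra. split; apply Cmod_gt_0; lra.
Qed.

Lemma pf_y_bound n k : Rabs (Im w) <= 2 ^ n -> (2 * S k < 2 ^ n)%nat ->
  c * INR (S k) / 20 <= Cmod (y n (w + om (S k))%C) /\ c * INR (S k) / 20 <= Cmod (y n (w - om (S k))%C).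
Proof.
  intros H Hk. destruct (pf_im_bound n k H Hk) as [B1 B2]. apply pf_y_lower in B1, B2.
  destruct (Hlow k). split; lra.
Qed.

Lemma pf_cphi_y n u : csh (u / (2 ^ n)%R / 2)%C <> 0 ->
  ((/ 4)%R ^ n * cphi (u / (2 ^ n)%R) = / (y n u * y n u))%C.
Proof.
  intros H. rewrite cphi_csh by auto. rewrite pf_half in *. unfold y.
  rewrite Cpow_RtoC, pow_inv. replace (4 ^ n) with (2 ^ n * 2 ^ n) by (rewrite <- Rpow_mult_distr; f_equal; ring).
  pose proof (pow2_pos n). rewrite RtoC_inv by nra. simpl pow in *. rewrite !RtoC_mult in *.
  field. repeat split; auto; apply RtoC_neq0; lra.
Qed.

Lemma clim_kap (x : R) : 0 < x < 1 -> clim (fun n => RtoC x ^ n)%C 0.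
Proof.
  intros H. apply clim_squeeze0 with (fun n => x ^ n).
  - exists 0%nat. intros n _. rewrite Cpow_RtoC.
    replace (RtoC (x ^ n) - 0)%C with (RtoC (x ^ n)) by ring. rewrite Cmod_R, Rabs_pos_eq; [lra|].
    apply pow_le; lra.
  - apply is_lim_seq_geom. rewrite Rabs_pos_eq; lra.
Qed.

Lemma clim_0_bounded u v K N : clim u 0 -> (forall n, (N <= n)%nat -> Cmod (v n) <= K) ->
  clim (fun n => u n * v n)%C 0.
Proof.
  intros Hu Hv eps Heps.
  destruct (Hu (eps / (Rabs K + 1))) as [N1 H1].
  { apply Rdiv_lt_0_compat; auto. pose proof (Rabs_pos K); lra. }
  exists (N + N1)%nat. intros n Hn. specialize (H1 n ltac:(lia)). specialize (Hv n ltac:(lia)).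
  replace (u n - 0)%C with (u n) in H1 by ring.
  replace (u n * v n - 0)%C with (u n * v n)%C by ring. rewrite Cmod_mult.
  pose proof (Rle_abs K). pose proof (Cmod_ge_0 (v n)). pose proof (Cmod_ge_0 (u n)).
  apply Rle_lt_trans with (Cmod (u n) * (Rabs K + 1)); [apply Rmult_le_compat_l; lra|].
  apply Rmult_lt_reg_r with (/ (Rabs K + 1)); [apply Rinv_0_lt_compat; lra|].
  rewrite Rmult_assoc, Rinv_r by lra. lra.
Qed.

Lemma pf_inv_sq_bound K : ex_series (fun k => K * / INR (S k) ^ 2).
Proof. apply ex_series_Rmult_l, ex_series_inv_sq. Qed.

Lemma pf_shift_half n : ((w / (2 ^ n)%R + PI * Ci) / 2 = w / (2 ^ S n)%R + PI * Ci / 2)%C.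
Proof.
  rewrite <- pf_half. field. apply RtoC_neq0. pose proof (pow2_pos n); lra.
Qed.

(** Not restricted to [Re w > 0]: the value at [w = PI * Ci] will give the sum of the inverse
    squares. *)
Lemma cphi_partial_fraction :
  summ (fun k => / ((w + om (S k)) * (w + om (S k))) + / ((w - om (S k)) * (w - om (S k))))%C /\
  cphi w = (/ (w * w) + CSer (fun k => / ((w + om (S k)) * (w + om (S k))) + / ((w - om (S k)) * (w - om (S k)))))%C.
Proof.
  assert (Lim : forall u : C, u <> 0 -> clim (fun n => (/ 4)%R ^ n * cphi (u / (2 ^ n)%R))%C (/ (u * u))%C).
  { intros u Hu. destruct (pf_im_ev u) as [N HN].
    apply clim_ext_ev with (fun n => / (y n u * y n u))%C N.
    - intros n Hn. symmetry. apply pf_cphi_y. apply pf_y_neq0; auto.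
    - apply clim_inv; [apply Cmult_neq_0; auto|]. apply clim_mult; apply pf_clim_y. }
  destruct (pow2_unbounded (Rabs (Im w))) as [N0 HN0].
  (* [800 = 2 * 20 ^ 2]: two points in a pair, each with [|y|] at least [c * INR (S k) / 20]. *)
  apply partial_fraction_duplication with (kap := RtoC (/ 4)) (b := fun k => 800 / c ^ 2 * / INR (S k) ^ 2) (N0 := N0); auto.
  - apply cphi_dup.
  - intros v. unfold cphi. rewrite Cexp_shift_2PI. auto.
  (* [100 = (20 / 2) ^ 2]: at the antipode the argument of [csh] has modulus at least 1. *)
  - destruct pf_shift_ev as [N HN]. apply clim_0_bounded with 100 N; [apply clim_kap; lra|].
    intros n Hn. destruct (HN n Hn) as [B1 B2]. apply csh_lower in B1.
    rewrite cphi_csh; rewrite pf_shift_half.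
    + set (X := csh _) in *. rewrite Cmod_inv, !Cmod_mult, Cmod_R, Rabs_pos_eq.
      * rewrite <- (Rinv_inv 100). apply Rinv_le_contravar; nra.
      * lra.
      * assert (HX : X <> RtoC 0) by (apply Cmod_gt_0; lra).
        apply Cmult_neq_0; apply Cmult_neq_0; try exact HX; apply RtoC_neq0; lra.
    + apply Cmod_gt_0. lra.
  - intros k. destruct (pf_neq0 k).
    apply clim_ext with (fun n => (/ 4)%R ^ n * cphi ((w + om (S k)) / (2 ^ n)%R) + (/ 4)%R ^ n * cphi ((w - om (S k)) / (2 ^ n)%R))%C.
    { intros; ring. }
    apply clim_plus; auto.
  - apply pf_inv_sq_bound.
  - intros k. pose proof (INR_S_pos k). apply Rmult_le_pos; [|left; apply Rinv_0_lt_compat; nra].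
    apply Rlt_le, Rdiv_lt_0_compat; [lra|nra].
  - intros n k Hn Hk. specialize (HN0 n Hn). destruct (pf_im_bound n k HN0 Hk) as [B1 B2].
    destruct (pf_neq0 k) as [Z1 Z2]. destruct (pf_y_bound n k HN0 Hk) as [Y1 Y2].
    rewrite Cmult_plus_distr_l, !pf_cphi_y by (apply pf_y_neq0; auto).
    eapply Rle_trans; [apply Cmod_triangle|].
    pose proof (INR_S_pos k). set (m := INR (S k)) in *.
    assert (Hcm : 0 < c * m) by nra.
    assert (Inv : forall X : C, c * m / 20 <= Cmod X -> Cmod (/ (X * X))%C <= 400 / c ^ 2 * / m ^ 2).
    { intros X HX. assert (X <> 0) by (apply Cmod_gt_0; lra).
      rewrite Cmod_inv, Cmod_mult by (apply Cmult_neq_0; auto).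
      replace (400 / c ^ 2 * / m ^ 2) with (/ ((c * m / 20) * (c * m / 20))) by (field; lra).
      apply Rinv_le_contravar; nra. }
    pose proof (Inv _ Y1). pose proof (Inv _ Y2).
    replace (800 / c ^ 2 * / m ^ 2) with (400 / c ^ 2 * / m ^ 2 + 400 / c ^ 2 * / m ^ 2) by (field; lra). lra.
Qed.

Lemma pf_ce_pair_y n k : csh ((w + om (S k)) / (2 ^ n)%R / 2)%C <> 0 -> csh ((w - om (S k)) / (2 ^ n)%R / 2)%C <> 0 ->
  ((/ 2)%R ^ n * ((ce ((w + om (S k)) / (2 ^ n)%R) + / 2) + (ce ((w - om (S k)) / (2 ^ n)%R) + / 2)) =
   2 * ((2 ^ n)%R * csh (w / (2 ^ n)%R)) * / (y n (w + om (S k)) * y n (w - om (S k))))%C.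
Proof.
  intros H1 H2. rewrite ce_pair by auto. rewrite !pf_half in *. unfold y.
  pose proof (pow2_pos n) as Hp. assert (HM : RtoC (2 ^ n) <> 0) by (apply RtoC_neq0; lra).
  replace (((w + om (S k)) / (2 ^ n)%R + (w - om (S k)) / (2 ^ n)%R) / 2)%C with (w / (2 ^ n)%R)%C
    by (field; auto).
  rewrite Cpow_RtoC, pow_inv, RtoC_inv by lra. simpl pow in *. rewrite !RtoC_mult in *.
  field. repeat split; auto.
Qed.

Lemma ce_partial_fraction :
  summ (fun k => 2 * w * / ((w + om (S k)) * (w - om (S k))))%C /\
  (ce w + / 2 = / w + CSer (fun k => 2 * w * / ((w + om (S k)) * (w - om (S k)))))%C.
Proof.
  pose proof (clim_csh w) as Lw.
  destruct (pow2_unbounded (Rabs (Im w))) as [N0 HN0].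
  destruct (clim_bounded _ _ Lw) as [K [HK [N1 HN1]]].
  (* [K] bounds [2 ^ n * csh (w / 2 ^ n)], the common numerator of the pairs. *)
  apply (partial_fraction_duplication (fun w => (ce w + / 2)%C)) with
    (kap := RtoC (/ 2)) (b := fun k => 800 * K / c ^ 2 * / INR (S k) ^ 2) (N0 := (N0 + N1)%nat); auto.
  - apply ce_dup.
  - intros v. unfold ce. rewrite Cexp_shift_2PI. auto.
  - destruct (pf_im_ev w) as [N HN].
    apply clim_ext_ev with (fun n => Cexp (- w / (2 ^ S n)%R) * / y n w + (/ 2)%R ^ n * / 2)%C N.
    + intros n Hn. specialize (HN n Hn). pose proof (pf_y_neq0 n w HN Hw0) as Hz.
      rewrite ce_csh by auto. rewrite !pf_half in *. unfold y.
      replace (- w / (2 ^ S n)%R)%C with (- (w / (2 ^ S n)%R))%C.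
      2: { field. apply RtoC_neq0. pose proof (pow2_pos (S n)); lra. }
      rewrite Cpow_RtoC, pow_inv. pose proof (pow2_pos n). rewrite RtoC_inv by lra.
      simpl pow in *. rewrite !RtoC_mult in *. field. repeat split; auto. apply RtoC_neq0; lra.
    + replace (/ w)%C with (1 * / w + 0 * / 2)%C by (field; auto).
      apply clim_plus; [apply clim_mult|].
      * apply clim_squeeze0 with (fun n => Cmod w * exp (Cmod w) * / 2 ^ n).
        -- exists 0%nat. intros n _. eapply Rle_trans; [apply Cexp_sub1_le|].
           pose proof (pow2_pos n). pose proof (pow2_ge1 n). pose proof (Cmod_ge_0 w).
           assert (E : Cmod (- w / (2 ^ S n)%R)%C = Cmod w / 2 ^ S n).
           { rewrite Cmod_div, Cmod_opp, Cmod_R, Rabs_pos_eq; auto. simpl; lra. apply RtoC_neq0; simpl; lra. }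
           rewrite E.
           assert (B : Cmod w / 2 ^ S n <= Cmod w * / 2 ^ n).
           { apply Rmult_le_compat_l; auto. apply Rinv_le_contravar; simpl; lra. }
           assert (B2 : Cmod w * / 2 ^ n <= Cmod w).
           { rewrite <- (Rmult_1_r (Cmod w)) at 2. apply Rmult_le_compat_l; auto.
             rewrite <- Rinv_1. apply Rinv_le_contravar; lra. }
           replace (Cmod w * exp (Cmod w) * / 2 ^ n) with (Cmod w * / 2 ^ n * exp (Cmod w)) by ring.
           apply Rmult_le_compat; auto.
           ++ apply Rmult_le_pos; auto. left. apply Rinv_0_lt_compat. simpl; lra.
           ++ left; apply exp_pos.
           ++ apply exp_le_mono. lra.
        -- replace (Finite 0) with (Rbar_mult (Cmod w * exp (Cmod w)) 0) by (simpl; f_equal; ring).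
           apply is_lim_seq_scal_l, is_lim_seq_inv_pow2.
      * apply clim_inv; auto. apply pf_clim_y.
      * apply clim_ext with (fun n => / 2 * (/ 2)%R ^ n)%C; [intros; ring|].
        rewrite Cmult_comm. apply clim_scal, clim_kap; lra.
  - destruct pf_shift_ev as [N HN]. apply clim_0_bounded with (exp (Cmod w) * 10 + / 2) N; [apply clim_kap; lra|].
    intros n Hn. destruct (HN n Hn) as [B1 B2]. apply csh_lower in B1.
    eapply Rle_trans; [apply Cmod_triangle|]. apply Rplus_le_compat.
    + assert (HX : csh (w / (2 ^ S n)%R + PI * Ci / 2)%C <> 0) by (apply Cmod_gt_0; lra).
      rewrite ce_csh; rewrite pf_shift_half; auto.
      rewrite Cmod_div by (apply Cmult_neq_0; auto; apply RtoC_neq0; lra).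
      rewrite Cmod_mult, Cmod_Cexp, Cmod_R, (Rabs_pos_eq 2) by lra.
      apply Rmult_le_compat.
      * left; apply exp_pos.
      * left; apply Rinv_0_lt_compat. lra.
      * apply exp_le_mono. eapply Rle_trans; [apply Rle_abs|].
        change (Re (- (w / (2 ^ S n)%R + PI * Ci / 2))%C) with (- Re (w / (2 ^ S n)%R + PI * Ci / 2)%C).
        rewrite Rabs_Ropp, Re_Cplus.
        replace (Re (PI * Ci / 2)%C) with 0 by (unfold Ci; rewrite ?Re_Cmult; simpl; field).
        rewrite Rplus_0_r. eapply Rle_trans; [apply re_le_Cmod|].
        pose proof (pow2_pos n). pose proof (pow2_ge1 n). pose proof (Cmod_ge_0 w).
        rewrite Cmod_div, Cmod_R, Rabs_pos_eq by (try apply RtoC_neq0; simpl; lra).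
        rewrite <- (Rmult_1_r (Cmod w)) at 2. apply Rmult_le_compat_l; auto.
        rewrite <- Rinv_1. apply Rinv_le_contravar; simpl; lra.
      * rewrite <- (Rinv_inv 10). apply Rinv_le_contravar; lra.
    + rewrite Cmod_inv, Cmod_R, Rabs_pos_eq by (try apply RtoC_neq0; lra). lra.
  - intros k. destruct (pf_neq0 k) as [Z1 Z2].
    destruct (pf_im_ev (w + om (S k))%C) as [M1 HM1]. destruct (pf_im_ev (w - om (S k))%C) as [M2 HM2].
    apply clim_ext_ev with (fun n => 2 * ((2 ^ n)%R * csh (w / (2 ^ n)%R)) * / (y n (w + om (S k)) * y n (w - om (S k))))%C (M1 + M2)%nat.
    + intros n Hn. symmetry. apply pf_ce_pair_y; apply pf_y_neq0; auto; [apply HM1|apply HM2]; lia.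
    + apply clim_mult; [apply clim_scal; auto|]. apply clim_inv; [apply Cmult_neq_0; auto|].
      apply clim_mult; apply pf_clim_y.
  - apply pf_inv_sq_bound.
  - intros k. pose proof (INR_S_pos k). apply Rmult_le_pos; [|left; apply Rinv_0_lt_compat; nra].
    apply Rlt_le, Rdiv_lt_0_compat; [lra|nra].
  - intros n k Hn Hk. specialize (HN0 n ltac:(lia)). destruct (pf_im_bound n k HN0 Hk) as [B1 B2].
    specialize (HN1 n ltac:(lia)).
    destruct (pf_neq0 k) as [Z1 Z2]. destruct (pf_y_bound n k HN0 Hk) as [Y1 Y2].
    rewrite pf_ce_pair_y by (apply pf_y_neq0; auto).
    pose proof (INR_S_pos k). set (m := INR (S k)) in *.
    assert (Hcm : 0 < c * m) by nra.
    set (X1 := y n (w + om (S k))%C) in *. set (X2 := y n (w - om (S k))%C) in *.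
    assert (X1 <> 0) by (apply Cmod_gt_0; lra). assert (X2 <> 0) by (apply Cmod_gt_0; lra).
    rewrite Cmod_mult, (Cmod_mult 2), Cmod_inv, (Cmod_mult X1), (Cmod_R 2), (Rabs_pos_eq 2) by (try apply Cmult_neq_0; auto; lra).
    replace (800 * K / c ^ 2 * / m ^ 2) with (2 * K * / ((c * m / 20) * (c * m / 20))) by (field; lra).
    apply Rmult_le_compat.
    + apply Rmult_le_pos; [lra|apply Cmod_ge_0].
    + left; apply Rinv_0_lt_compat. apply Rmult_lt_0_compat; lra.
    + lra.
    + apply Rinv_le_contravar; nra.
Qed.

End PartialFractions.

(** * The quasi-modular transformation of the weight two Eisenstein series *)

Definition omr (t : R) : C := (2 * PI * Ci * t)%C.

Lemma om_omr k : om k = omr (INR k).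
Proof. reflexivity. Qed.

Lemma Re_omr t : Re (omr t) = 0.
Proof. unfold omr, Ci. rewrite !Re_Cmult, !Im_Cmult. simpl. ring. Qed.

Lemma Im_omr t : Im (omr t) = 2 * PI * t.
Proof. unfold omr, Ci. rewrite !Im_Cmult. rewrite !Re_Cmult. simpl. ring. Qed.

(** With [X] the modulus, [j Re z <= X] and [2 PI |t| <= X + j |Im z|]; inserting the first into the
    second bounds [|t|]. Having both bounds allows the decay of a product to be shared between [j]
    and [t]. *)
Lemma lattice_lower (z : C) (j t : R) : 0 < Re z -> 0 < j ->
  j * Re z <= Cmod (j * z + omr t)%C /\
  2 * PI * Re z / (Re z + Rabs (Im z)) * Rabs t <= Cmod (j * z + omr t)%C.
Proof.
  intros Hr Hj. set (X := Cmod (j * z + omr t)%C).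
  assert (H1 : j * Re z <= X).
  { eapply Rle_trans; [|apply re_le_Cmod]. rewrite Re_Cplus, Re_RtoC_mult, Re_omr, Rplus_0_r. apply Rle_abs. }
  assert (H2 : 2 * PI * Rabs t <= X + j * Rabs (Im z)).
  { pose proof (im_le_Cmod (j * z + omr t)%C) as H. fold X in H.
    rewrite Im_Cplus, Im_RtoC_mult, Im_omr in H. pose proof PI_bounds.
    assert (E : 2 * PI * Rabs t = Rabs (2 * PI * t)) by (rewrite Rabs_mult, (Rabs_pos_eq (2 * PI)); lra).
    rewrite E. replace (2 * PI * t) with ((j * Im z + 2 * PI * t) + - (j * Im z)) by ring.
    eapply Rle_trans; [apply Rabs_triang|]. rewrite Rabs_Ropp, (Rabs_mult j), (Rabs_pos_eq j) by lra. lra. }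
  split; auto. pose proof (Rabs_pos (Im z)) as Hi.
  apply Rmult_le_reg_r with (Re z + Rabs (Im z)); [lra|].
  replace (2 * PI * Re z / (Re z + Rabs (Im z)) * Rabs t * (Re z + Rabs (Im z))) with (2 * PI * Rabs t * Re z) by (field; lra).
  nra.
Qed.

Lemma Re_RtoC (x : R) : Re x = x.
Proof. reflexivity. Qed.

Lemma Re_pos_neq0 (z : C) : 0 < Re z -> z <> 0.
Proof. intros H ->. simpl in H. lra. Qed.

Lemma Cexp_neq1 (w : C) : 0 < Re w -> Cexp w <> 1.
Proof.
  intros H E. pose proof (Cmod_Cexp w) as G. rewrite E, Cmod_1 in G.
  pose proof (exp_increasing 0 (Re w) H). rewrite exp_0 in *. lra.
Qed.

Lemma omr_opp t : omr (- t) = (- omr t)%C.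
Proof. unfold omr. rewrite RtoC_opp. ring. Qed.

Lemma omr_plus s t : omr (s + t) = (omr s + omr t)%C.
Proof. unfold omr. rewrite RtoC_plus. ring. Qed.

Lemma lattice_low_om (w : C) : 0 < Re w -> exists c, 0 < c /\
  forall k, c * INR (S k) <= Cmod (w + om (S k))%C /\ c * INR (S k) <= Cmod (w - om (S k))%C.
Proof.
  intros H. exists (2 * PI * Re w / (Re w + Rabs (Im w))). pose proof (Rabs_pos (Im w)). pose proof PI_bounds.
  split. { apply Rdiv_lt_0_compat; [|lra]. nra. }
  intros k. pose proof (INR_S_pos k).
  destruct (lattice_lower w 1 (INR (S k)) H Rlt_0_1) as [_ L1].
  destruct (lattice_lower w 1 (- INR (S k)) H Rlt_0_1) as [_ L2].
  rewrite Rabs_Ropp in L2. rewrite (Rabs_pos_eq (INR (S k))) in L1, L2 by lra.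
  rewrite omr_opp, Cmult_1_l in L2. rewrite Cmult_1_l in L1. split; auto.
Qed.

Lemma cphi_pf (w : C) : 0 < Re w ->
  summ (fun k => / ((w + om (S k)) * (w + om (S k))) + / ((w - om (S k)) * (w - om (S k))))%C /\
  cphi w = (/ (w * w) + CSer (fun k => / ((w + om (S k)) * (w + om (S k))) + / ((w - om (S k)) * (w - om (S k)))))%C.
Proof.
  intros H. destruct (lattice_low_om w H) as [c [Hc Hl]].
  apply (cphi_partial_fraction w c); auto using Re_pos_neq0, Cexp_neq1.
Qed.

Lemma ce_pf (w : C) : 0 < Re w ->
  summ (fun k => 2 * w * / ((w + om (S k)) * (w - om (S k))))%C /\
  (ce w + / 2 = / w + CSer (fun k => 2 * w * / ((w + om (S k)) * (w - om (S k)))))%C.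
Proof.
  intros H. destruct (lattice_low_om w H) as [c [Hc Hl]].
  apply (ce_partial_fraction w c); auto. apply Re_pos_neq0; auto. apply Cexp_neq1; auto.
Qed.

(** * The sum of the inverse squares *)

Definition zeta2 : R := Series (fun k => / INR (S k) ^ 2).

Lemma is_series_pairs (a : nat -> R) : ex_series a ->
  is_series (fun i => a (2 * i)%nat + a (2 * i + 1)%nat) (Series a).
Proof.
  intros Ha. apply is_series_sum_f_R0.
  apply is_lim_seq_ext with (fun n => sum_f_R0 a (2 * n + 1)).
  - induction n; [reflexivity|].
    replace (2 * S n + 1)%nat with (S (S (2 * n + 1))) by lia.
    rewrite !tech5, IHn. replace (S (2 * n + 1)) with (2 * S n)%nat by lia.
    replace (S (2 * S n)) with (2 * S n + 1)%nat by lia. ring.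
  - pose proof (Series_correct _ Ha) as H. apply is_series_sum_f_R0 in H.
    apply (is_lim_seq_subseq _ _ (fun n => (2 * n + 1)%nat)) in H; auto.
    apply eventually_subseq. intros; lia.
Qed.

(** At [w = PI * Ci] all the lattice points are odd multiples of [PI * Ci], so the expansion of
    [cphi], which equals [- 1/4] there, gives the sum over odd squares. The even squares contribute
    a quarter of the whole. *)
Lemma basel : zeta2 = PI ^ 2 / 6.
Proof.
  pose proof PI_bounds as HPI.
  set (o := fun k => / (2 * INR k + 1) ^ 2).
  assert (Ho : ex_series o).
  { apply ex_series_le_R with (fun k => / INR (S k) ^ 2); [|apply ex_series_inv_sq].
    intros k. unfold o. pose proof (pos_INR k). rewrite S_INR. split.
    - left; apply Rinv_0_lt_compat; nra.
    - apply Rinv_le_contravar; [nra|]. apply pow_incr. lra. }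
  assert (HO : Series o = PI ^ 2 / 8).
  { assert (Ew : Cexp (PI * Ci)%C <> 1).
    { rewrite Cexp_PI. intros E. apply (f_equal Re) in E. simpl in E. lra. }
    destruct (cphi_partial_fraction (PI * Ci)%C 1) as [_ E]; auto; try lra.
    - intros G. apply (f_equal Im) in G. unfold Ci in G. rewrite Im_Cmult in G. simpl in G. lra.
    - intros k. pose proof (INR_S_pos k) as Hk.
      assert (INR (S k) = INR k + 1) by apply S_INR. pose proof (pos_INR k).
      split.
      + eapply Rle_trans; [|apply im_le_Cmod]. rewrite Im_Cplus, Im_om.
        unfold Ci. rewrite Im_Cmult. simpl Im. simpl Re. eapply Rle_trans; [|apply Rle_abs]. nra.
      + rewrite Cmod_minus_sym. eapply Rle_trans; [|apply im_le_Cmod]. rewrite Im_Cminus, Im_om.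
        unfold Ci. rewrite Im_Cmult. simpl Im. simpl Re. eapply Rle_trans; [|apply Rle_abs]. nra.
    - assert (HP : RtoC PI <> 0) by (apply RtoC_neq0; lra).
      rewrite (CSer_ext _ (fun k => (- / PI ^ 2 * (o (S k) + o k))%R : C)) in E.
      + rewrite RtoC_series, Series_scal_l, Series_plus in E; auto; [|apply (ex_series_incr_1 o); auto].
        pose proof (Series_incr_1 o Ho) as E1. unfold o at 2 in E1. simpl INR in E1.
        unfold cphi in E. rewrite Cexp_PI in E.
        apply (f_equal Re) in E. rewrite Re_Cplus in E.
        replace (PI * Ci * (PI * Ci))%C with (RtoC (- PI ^ 2)) in E.
        2: { transitivity (PI * PI * (Ci * Ci))%C; [|ring]. rewrite Ci_sqr, RtoC_opp, RtoC_pow. simpl. ring. }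
        rewrite <- RtoC_inv in E by nra.
        replace (- (1) / ((- (1) - 1) * (- (1) - 1)))%C with (RtoC (- / 4)) in E.
        2: { rewrite RtoC_opp, RtoC_inv by lra. field. }
        rewrite !Re_RtoC in E.
        set (T := Series (fun k => o (S k))) in *. set (P2 := PI ^ 2) in *.
        assert (0 < P2) by (unfold P2; nra).
        assert (E' : Series o = 1 + T) by (rewrite E1; field).
        assert (E2 : - P2 * (- / 4) = - P2 * (/ - P2 + - / P2 * (T + Series o))) by (rewrite <- E; auto).
        replace (- P2 * (/ - P2 + - / P2 * (T + Series o))) with (1 + (T + Series o)) in E2 by (field; lra).
        lra.
      + intros k. unfold o, om. rewrite !RtoC_S, !S_INR.
        set (n := INR k). assert (Hn : 0 <= n) by apply pos_INR.
        assert (N1 : RtoC (2 * n + 1) <> 0) by (apply RtoC_neq0; lra).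
        assert (N2 : RtoC (2 * (n + 1) + 1) <> 0) by (apply RtoC_neq0; lra).
        replace (PI * Ci + 2 * PI * Ci * (1 + n))%C with (PI * Ci * (2 * (n + 1) + 1)%R)%C
          by (rewrite !RtoC_plus, !RtoC_mult, !RtoC_plus; ring).
        replace (PI * Ci - 2 * PI * Ci * (1 + n))%C with (- (PI * Ci * (2 * n + 1)%R))%C
          by (rewrite !RtoC_plus, !RtoC_mult; ring).
        assert (HA : forall x : R, (x <> 0)%R -> (/ (PI * Ci * x * (PI * Ci * x)) = (- / PI ^ 2 * / x ^ 2)%R)%C).
        { intros x Hx. replace (PI * Ci * x * (PI * Ci * x))%C with (RtoC (- (PI ^ 2 * x ^ 2))).
          - rewrite <- RtoC_inv by (apply Ropp_neq_0_compat, Rmult_integral_contrapositive_currified; apply pow_nonzero; lra).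
            f_equal. field. lra.
          - transitivity (PI * PI * (x * x) * (Ci * Ci))%C; [|ring]. rewrite Ci_sqr.
            rewrite RtoC_opp, RtoC_mult, !RtoC_pow. simpl. ring. }
        rewrite HA by lra.
        replace (- (PI * Ci * (2 * n + 1)%R) * - (PI * Ci * (2 * n + 1)%R))%C
          with (PI * Ci * (2 * n + 1)%R * (PI * Ci * (2 * n + 1)%R))%C by ring.
        rewrite HA by lra. rewrite <- RtoC_plus. f_equal. ring. }
  assert (Hz : zeta2 = Series o + / 4 * zeta2).
  { unfold zeta2 at 1. rewrite <- (is_series_unique _ _ (is_series_pairs _ ex_series_inv_sq)).
    unfold zeta2. rewrite <- Series_scal_l, <- Series_plus; auto.
    - apply Series_ext. intros k. unfold o. rewrite !S_INR, plus_INR, mult_INR. simpl (INR 2). simpl (INR 1).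
      pose proof (pos_INR k). field. lra.
    - apply ex_series_Rmult_l, ex_series_inv_sq. }
  rewrite HO in Hz. lra.
Qed.

Lemma Cminus_0_r (a : C) : (a - 0)%C = a.
Proof. ring. Qed.

Lemma Re_inv_pos (z : C) : 0 < Re z -> 0 < Re (/ z)%C.
Proof.
  intros H. unfold Cinv, Re in *. simpl in *. apply Rdiv_lt_0_compat; auto.
  pose proof (pow2_ge_0 (snd z)). nra.
Qed.

Lemma Re_dual_pos (x : R) (z : C) : 0 < x -> 0 < Re z -> 0 < Re (x / z)%C.
Proof.
  intros Hx H. unfold Cdiv. rewrite Re_RtoC_mult. apply Rmult_lt_0_compat; auto. apply Re_inv_pos; auto.
Qed.

Lemma Re_INR_pos n (z : C) : 0 < Re z -> 0 < Re (INR (S n) * z)%C.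
Proof. intros H. rewrite Re_RtoC_mult. apply Rmult_lt_0_compat; auto. apply INR_S_pos. Qed.

Lemma clim_inv_INR (u : nat -> C) l K :
  (forall n, Cmod (u n - l)%C <= K * / INR (S n)) -> clim u l.
Proof.
  intros H. apply clim_squeeze0 with (fun n => K * / INR (S n)).
  - exists 0%nat. intros; apply H.
  - replace (Finite 0) with (Rbar_mult K 0) by (simpl; f_equal; ring).
    apply is_lim_seq_scal_l. apply (is_lim_seq_incr_1 (fun n => / INR n)).
    replace (Finite 0) with (Rbar_inv p_infty) by reflexivity.
    apply is_lim_seq_inv; [apply is_lim_seq_INR|discriminate].
Qed.

(** Multiplication by [2 PI i / z] turns the lattice of [z] into that of the dual variable and
    exchanges the roles of the two generators; sums over columns thereby become partial
    fractions. *)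
Lemma dual_lattice_point (z : C) (a b : R) : z <> 0 ->
  (b * ((4 * PI ^ 2)%R / z) + omr a = omr 1 / z * (a * z - omr b))%C.
Proof.
  intros Hz. unfold omr, Cdiv. rewrite RtoC_mult, RtoC_pow.
  transitivity (2 * PI * Ci * a * (z * / z) + - (4 * PI ^ 2 * b * / z) * (Ci * Ci))%C.
  - rewrite Ci_sqr, Cinv_r by auto. simpl. ring.
  - simpl. ring.
Qed.

Lemma omr_1_sqr : (omr 1 * omr 1)%C = RtoC (- (4 * PI ^ 2)).
Proof.
  unfold omr. transitivity (4 * PI * PI * (Ci * Ci))%C; [ring|].
  rewrite Ci_sqr, RtoC_opp, RtoC_mult, RtoC_pow. simpl. ring.
Qed.

Lemma omr_1_neq0 : omr 1 <> 0.
Proof. intros E. apply (f_equal Im) in E. rewrite Im_omr in E. simpl in E. pose proof PI_bounds. lra. Qed.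

(** * Eisenstein summation over the lattice *)

Section Eisenstein.

Variable z : C.
Hypothesis Hz : 0 < Re z.

Let W (j : nat) (t : R) : C := (INR (S j) * z + omr t)%C.
Let eT (j : nat) (t : R) : C := (/ (W j t * W j t))%C.
(* Telescopes in [t]; subtracting it from [eT] leaves an absolutely convergent double series. *)
Let tT (j : nat) (t : R) : C := (/ (W j (t - / 2) * W j (t + / 2)))%C.
Let fold2 (f : R -> C) (k : nat) : C :=
  match k with O => f 0 | S _ => (f (INR k) + f (- INR k)%R)%C end.
Let c : R := 2 * PI * Re z / (Re z + Rabs (Im z)).

Lemma eis_c_pos : 0 < c.
Proof.
  unfold c. pose proof PI_bounds. pose proof (Rabs_pos (Im z)).
  apply Rdiv_lt_0_compat; [|lra]. apply Rmult_lt_0_compat; lra.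
Qed.

Lemma eis_W_low j t : INR (S j) * Re z <= Cmod (W j t) /\ c * Rabs t <= Cmod (W j t).
Proof. apply lattice_lower; auto. apply INR_S_pos. Qed.

Lemma eis_W_neq0 j t : W j t <> 0.
Proof.
  destruct (eis_W_low j t) as [H _]. pose proof (INR_S_pos j).
  apply Cmod_gt_0. nra.
Qed.

(** The product of the two neighbours of [W] is [W ^ 2 + PI ^ 2], so the difference is of order
    [|W| ^ (-4)]. *)
Lemma eis_diff j t : (eT j t - tT j t = (PI ^ 2)%R * / (W j t * W j t * (W j (t - / 2) * W j (t + / 2))))%C.
Proof.
  pose proof (eis_W_neq0 j t). pose proof (eis_W_neq0 j (t - / 2)). pose proof (eis_W_neq0 j (t + / 2)).
  assert (E : (W j (t - / 2) * W j (t + / 2) - W j t * W j t = (PI ^ 2)%R)%C).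
  { unfold W, Rminus. rewrite !omr_plus, omr_opp.
    transitivity (- (omr (/ 2) * omr (/ 2)))%C; [ring|]. unfold omr.
    transitivity (- (PI * PI * (Ci * Ci) * ((2 * / 2) * (2 * / 2))))%C.
    - rewrite RtoC_inv by lra. ring.
    - rewrite Ci_sqr, RtoC_pow. simpl. field. }
  rewrite <- E. unfold eT, tT. field. auto.
Qed.

(** Of the four factors in the denominator two are bounded below through [j] and two through [t],
    which gives a majorant of product form. *)
Lemma eis_bound : exists K, 0 < K /\ forall j k,
  Cmod (fold2 (fun t => eT j t - tT j t)%C k) <= (K * / INR (S j) ^ 2) * / INR (S k) ^ 2.
Proof.
  pose proof eis_c_pos as Hc. pose proof PI_bounds as HP.
  set (r := Re z). assert (Hr : 0 < r) by exact Hz.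
  (* [K1] serves [k = 0]. In [K2] the 16 collects 2 from [|t - 1/2| >= |t| / 2], 2 from the two
     signs and 4 from [t + 1 <= 2 t]. *)
  set (K1 := PI ^ 2 * / r ^ 4). set (K2 := 16 * (PI ^ 2 * / (r ^ 2 * c ^ 2))).
  assert (HP2 : 0 < PI ^ 2) by nra.
  assert (HK1 : 0 < K1) by (apply Rmult_lt_0_compat; [|apply Rinv_0_lt_compat, pow_lt]; auto).
  assert (HK2 : 0 < K2).
  { apply Rmult_lt_0_compat; [lra|]. apply Rmult_lt_0_compat; auto. apply Rinv_0_lt_compat.
    apply Rmult_lt_0_compat; apply pow_lt; auto. }
  assert (Dm : forall j t, Cmod (eT j t - tT j t)%C =
    PI ^ 2 * / (Cmod (W j t) * Cmod (W j t) * (Cmod (W j (t - / 2)) * Cmod (W j (t + / 2))))).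
  { intros j t. rewrite eis_diff. pose proof (eis_W_neq0 j t).
    pose proof (eis_W_neq0 j (t - / 2)). pose proof (eis_W_neq0 j (t + / 2)).
    rewrite Cmod_mult, Cmod_R, Rabs_pos_eq, Cmod_inv, !Cmod_mult by (try lra; repeat apply Cmult_neq_0; auto).
    auto. }
  exists (K1 + K2). split; [lra|]. intros j k. pose proof (INR_S_pos j) as Hj.
  assert (Hj1 : 1 <= INR (S j)) by apply INR_S_ge1.
  set (J := INR (S j)) in *.
  destruct k as [|k]; unfold fold2; cbv beta.
  - rewrite Dm. replace (INR 1) with 1 by reflexivity.
    pose proof (proj1 (eis_W_low j 0)). pose proof (proj1 (eis_W_low j (0 - / 2))).
    pose proof (proj1 (eis_W_low j (0 + / 2))). fold J in H, H0, H1. fold r in H, H0, H1.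
    assert (HJr : 0 < J * r) by nra.
    apply Rle_trans with (PI ^ 2 * / (J * r * (J * r) * (J * r * (J * r)))).
    + apply Rmult_le_compat_l; [lra|]. apply Rinv_le_contravar.
      * repeat apply Rmult_lt_0_compat; auto.
      * assert (0 <= J * r * (J * r)) by nra.
        apply Rmult_le_compat; auto; apply Rmult_le_compat; lra.
    + replace (PI ^ 2 * / (J * r * (J * r) * (J * r * (J * r)))) with (K1 * / J ^ 2 * / J ^ 2) by (unfold K1; field; lra).
      replace ((K1 + K2) * / J ^ 2 * / 1 ^ 2) with ((K1 + K2) * / J ^ 2 * 1) by (field; lra).
      assert (0 < / J ^ 2) by (apply Rinv_0_lt_compat; nra).
      assert (/ J ^ 2 <= 1) by (rewrite <- Rinv_1; apply Rinv_le_contravar; nra).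
      apply Rmult_le_compat; nra.
  - set (t := INR (S k)). assert (Ht : 1 <= t) by (unfold t; apply INR_S_ge1).
    replace (INR (S (S k))) with (t + 1) by (unfold t; rewrite (S_INR (S k)); ring).
    assert (B : forall s, Rabs s = t -> Cmod (eT j s - tT j s)%C <= K2 / 8 * / J ^ 2 * / t ^ 2).
    { intros s Hs. rewrite Dm.
      destruct (eis_W_low j s) as [A1 A2]. destruct (eis_W_low j (s - / 2)) as [A3 A4].
      destruct (eis_W_low j (s + / 2)) as [A5 A6]. fold J in A1, A3, A5. fold r in A1, A3, A5. rewrite Hs in A2.
      assert (Q : (c * (t / 2) <= Cmod (W j (s - / 2)) /\ J * r <= Cmod (W j (s + / 2)) /\ c * (t/2) <= Cmod (W j (s + / 2)))).
      { assert (t / 2 <= Rabs (s - / 2)) by (revert Hs; unfold Rabs; repeat destruct Rcase_abs; intros; lra).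
        assert (t / 2 <= Rabs (s + / 2)) by (revert Hs; unfold Rabs; repeat destruct Rcase_abs; intros; lra).
        repeat split; auto; eapply Rle_trans; try eassumption; apply Rmult_le_compat_l; lra. }
      destruct Q as [Q1 [Q2 _]].
      assert (HJr : 0 < J * r) by nra. assert (Hct : 0 < c * t) by nra.
      apply Rle_trans with (PI ^ 2 * / (J * r * (c * t) * (c * (t / 2) * (J * r)))).
      - apply Rmult_le_compat_l; [lra|]. apply Rinv_le_contravar.
        + assert (0 < c * (t / 2)) by lra. apply Rmult_lt_0_compat; apply Rmult_lt_0_compat; assumption.
        + apply Rmult_le_compat; try (apply Rmult_le_compat; lra); apply Rmult_le_pos; lra.
      - right. unfold K2. field. lra. }
    assert (Ht' : Rabs t = t) by (apply Rabs_pos_eq; lra).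
    pose proof (B t Ht') as B1. pose proof (B (- t) ltac:(rewrite Rabs_Ropp; auto)) as B2.
    eapply Rle_trans; [apply Cmod_triangle|].
    apply Rle_trans with (K2 / 4 * / J ^ 2 * / t ^ 2); [lra|].
    assert (0 < / J ^ 2) by (apply Rinv_0_lt_compat; nra).
    apply Rle_trans with (K2 * / J ^ 2 * / (t + 1) ^ 2).
    + replace (K2 / 4 * / J ^ 2 * / t ^ 2) with (K2 * / J ^ 2 * / (2 * t) ^ 2) by (field; lra).
      apply Rmult_le_compat_l; [nra|]. apply Rinv_le_contravar; [nra|]. apply pow_incr; lra.
    + apply Rmult_le_compat_r; [left; apply Rinv_0_lt_compat; nra|]. apply Rmult_le_compat_r; lra.
Qed.

Lemma eis_telescope j m : csum (fold2 (tT j)) (S m) =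
  (/ omr 1 * (/ W j (- (INR m + / 2)) - / W j (INR m + / 2)))%C.
Proof.
  pose proof omr_1_neq0 as Ho.
  assert (Hs : forall t : R, (tT j t = / omr 1 * (/ W j (t - / 2) - / W j (t + / 2)))%C).
  { intros t. pose proof (eis_W_neq0 j (t - / 2)). pose proof (eis_W_neq0 j (t + / 2)). unfold tT.
    assert (E : omr 1 = (W j (t + / 2) - W j (t - / 2))%C).
    { unfold W. replace (t + / 2) with (t - / 2 + 1) by field. rewrite omr_plus. ring. }
    transitivity (/ omr 1 * (omr 1 / (W j (t - / 2) * W j (t + / 2))))%C; [field; auto|].
    f_equal. rewrite E at 1. field. auto. }
  induction m as [|m IH].
  - change (csum (fold2 (tT j)) 1) with (0 + tT j 0)%C. rewrite Hs. simpl INR.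
    replace (- (0 + / 2)) with (0 - / 2) by ring. ring.
  - change (csum (fold2 (tT j)) (S (S m))) with (csum (fold2 (tT j)) (S m) + fold2 (tT j) (S m))%C.
    rewrite IH. unfold fold2. rewrite !Hs, S_INR.
    replace (INR m + 1 - / 2) with (INR m + / 2) by field.
    replace (- (INR m + 1) + / 2) with (- (INR m + / 2)) by field.
    replace (- (INR m + 1) - / 2) with (- (INR m + 1 + / 2)) by field. ring.
Qed.

Lemma eis_csum_fold2 j m :
  csum (fold2 (fun t => eT j t - tT j t)%C) m = (csum (fold2 (eT j)) m - csum (fold2 (tT j)) m)%C.
Proof.
  induction m; simpl; [ring|]. rewrite IHm. unfold fold2. destruct m; ring.
Qed.

(** Within a row the telescoped terms sum to 0, so subtracting them leaves the row sum unchanged. *)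
Lemma eis_row j : clim (csum (fold2 (fun t => eT j t - tT j t)%C)) (cphi (INR (S j) * z)).
Proof.
  apply (clim_decr _ _ 1).
  apply clim_ext with (fun m => csum (fold2 (eT j)) (S m) - csum (fold2 (tT j)) (S m))%C.
  { intros m. rewrite Nat.add_1_r, eis_csum_fold2. auto. }
  replace (cphi (INR (S j) * z)) with (cphi (INR (S j) * z) - / omr 1 * 0)%C by ring.
  apply clim_minus.
  - destruct (cphi_pf _ (Re_INR_pos j z Hz)) as [P1 ->].
    apply CSer_correct in P1.
    apply clim_ext with (fun m => / (INR (S j) * z * (INR (S j) * z)) +
      csum (fun k => / ((INR (S j) * z + om (S k)) * (INR (S j) * z + om (S k))) +
                     / ((INR (S j) * z - om (S k)) * (INR (S j) * z - om (S k))))%C m)%C.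
    + intros m. rewrite csum_S_l. f_equal.
      * unfold fold2, eT, W. replace (omr 0) with (RtoC 0) by (unfold omr; ring). rewrite Cplus_0_r. auto.
      * apply csum_ext. intros k _. unfold fold2, eT, W. rewrite omr_opp, om_omr. reflexivity.
    + apply clim_plus; auto. apply clim_const.
  - apply clim_ext with (fun m => / omr 1 * (/ W j (- (INR m + / 2)) - / W j (INR m + / 2)))%C.
    { intros; symmetry; apply eis_telescope. }
    apply clim_scal. apply clim_inv_INR with (4 / c). intros m.
    pose proof eis_c_pos as Hc. pose proof (pos_INR m) as Hm. rewrite S_INR.
    assert (B : forall t, Rabs t = INR m + / 2 -> Cmod (/ W j t)%C <= 2 / c * / (INR m + 1)).
    { intros t Ht. rewrite Cmod_inv by apply eis_W_neq0. destruct (eis_W_low j t) as [_ H]. rewrite Ht in H.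
      replace (2 / c * / (INR m + 1)) with (/ (c * ((INR m + 1) / 2))) by (field; lra).
      apply Rinv_le_contravar; [nra|]. eapply Rle_trans; [|apply H]. apply Rmult_le_compat_l; lra. }
    replace (/ W j (- (INR m + / 2)) - / W j (INR m + / 2) - 0)%C with (/ W j (- (INR m + / 2)) - / W j (INR m + / 2))%C by ring.
    eapply Rle_trans; [apply Cmod_triangle_minus|].
    pose proof (B (INR m + / 2) ltac:(apply Rabs_pos_eq; lra)).
    pose proof (B (- (INR m + / 2)) ltac:(rewrite Rabs_Ropp; apply Rabs_pos_eq; lra)).
    replace (4 / c * / (INR m + 1)) with (2 / c * / (INR m + 1) + 2 / c * / (INR m + 1)) by (field; lra). lra.
Qed.

Lemma eis_fubini : summ (fun j => cphi (INR (S j) * z)) /\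
  clim (fun m => csum (fun k => CSer (fun j => fold2 (fun t => eT j t - tT j t)%C k)) m)
    (CSer (fun j => cphi (INR (S j) * z))).
Proof.
  destruct eis_bound as [K [HK HB]].
  destruct (series_fubini (fun j k => fold2 (fun t => eT j t - tT j t)%C k)
    (fun j => K * / INR (S j) ^ 2) (fun k => / INR (S k) ^ 2)) as [F1 [F2 [F3 _]]]; auto.
  - apply ex_series_Rmult_l, ex_series_inv_sq.
  - apply ex_series_inv_sq.
  - intros j. pose proof (INR_S_pos j). apply Rmult_le_pos; [lra|]. left; apply Rinv_0_lt_compat; nra.
  - intros j. pose proof (INR_S_pos j). left; apply Rinv_0_lt_compat; nra.
  - assert (E : forall j, CSer (fold2 (fun t => eT j t - tT j t)%C) = cphi (INR (S j) * z)).
    { intros j. apply CSer_unique; auto. apply eis_row. }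
    split.
    + apply (summ_ext (fun j => CSer (fold2 (fun t => eT j t - tT j t)%C))); auto.
    + rewrite (CSer_ext _ (fun j => CSer (fold2 (fun t => eT j t - tT j t)%C))); auto.
Qed.

Lemma eis_summ_tT t : summ (fun j => tT j t).
Proof.
  apply summ_le with (fun j => / Re z ^ 2 * / INR (S j) ^ 2); [|apply ex_series_Rmult_l, ex_series_inv_sq].
  intros j. unfold tT. pose proof (eis_W_neq0 j (t - / 2)). pose proof (eis_W_neq0 j (t + / 2)).
  rewrite Cmod_inv, Cmod_mult by (apply Cmult_neq_0; auto).
  destruct (eis_W_low j (t - / 2)) as [A1 _]. destruct (eis_W_low j (t + / 2)) as [A2 _].
  pose proof (INR_S_pos j).
  replace (/ Re z ^ 2 * / INR (S j) ^ 2) with (/ (INR (S j) * Re z * (INR (S j) * Re z))) by (field; lra).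
  assert (0 < INR (S j) * Re z) by nra.
  apply Rinv_le_contravar; [nra|]. apply Rmult_le_compat; lra.
Qed.

Lemma eis_summ_eT t : summ (fun j => eT j t).
Proof.
  apply summ_le with (fun j => / Re z ^ 2 * / INR (S j) ^ 2); [|apply ex_series_Rmult_l, ex_series_inv_sq].
  intros j. unfold eT. pose proof (eis_W_neq0 j t).
  rewrite Cmod_inv, Cmod_mult by (apply Cmult_neq_0; auto).
  destruct (eis_W_low j t) as [A1 _]. pose proof (INR_S_pos j).
  replace (/ Re z ^ 2 * / INR (S j) ^ 2) with (/ (INR (S j) * Re z * (INR (S j) * Re z))) by (field; lra).
  assert (0 < INR (S j) * Re z) by nra.
  apply Rinv_le_contravar; [nra|]. apply Rmult_le_compat; lra.
Qed.

Lemma eis_summ_fold2 f k : (forall t, summ (fun j => f j t)) -> summ (fun j => fold2 (f j) k).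
Proof. intros H. destruct k; simpl; auto. apply (summ_plus (fun j => f j _)); auto. Qed.

Let z' : C := ((4 * PI ^ 2)%R / z)%C.

Lemma eis_z'_pos : 0 < Re z'.
Proof. apply Re_dual_pos; auto. pose proof PI_bounds; nra. Qed.

(* Columns are again partial fractions, in the dual variable [4 * PI ^ 2 / z]. *)
Lemma eis_column k : CSer (fun j => fold2 (eT j) (S k)) =
  (- (4 * PI ^ 2)%R / (z * z) * (cphi (INR (S k) * z') - / ((INR (S k) * z') * (INR (S k) * z'))))%C.
Proof.
  destruct (cphi_pf _ (Re_INR_pos k z' eis_z'_pos)) as [P1 ->].
  assert (Hz0 : z <> 0) by (apply Re_pos_neq0; auto).
  match goal with |- _ = (_ * (?a + ?b - ?a))%C => replace (a + b - a)%C with b by ring end.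
  rewrite <- CSer_scal by auto. apply CSer_ext. intros j.
  unfold fold2, eT.
  assert (E : forall a b : R, (b * z' + omr a = omr 1 / z * (a * z - omr b))%C) by (intros; apply dual_lattice_point; auto).
  assert (E1 : (INR (S k) * z' + om (S j))%C = (omr 1 / z * W j (- INR (S k)))%C).
  { rewrite om_omr, E. unfold W. rewrite omr_opp. reflexivity. }
  assert (E2 : (INR (S k) * z' - om (S j))%C = (- (omr 1 / z * W j (INR (S k))))%C).
  { transitivity (INR (S k) * z' + omr (- INR (S j)))%C; [rewrite omr_opp; reflexivity|].
    rewrite E. unfold W. rewrite RtoC_opp. ring. }
  rewrite E1, E2. pose proof (eis_W_neq0 j (INR (S k))). pose proof (eis_W_neq0 j (- INR (S k))).
  pose proof omr_1_sqr as Ho.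
  rewrite <- RtoC_opp, <- Ho.
  pose proof omr_1_neq0 as Ho1.
  field. repeat split; auto.
Qed.

(** Summed over [j] first, the telescoped terms do not disappear: the ends at [t = m + 1/2] and
    [t = - (m + 1/2)] form the partial fractions of [ce] at a half-integer multiple of [z']. As [m]
    grows only the constant [1/2] survives, and it is the source of the anomalous term. *)
Lemma eis_boundary m :
  summ (fun j => csum (fold2 (tT j)) (S m)) /\
  CSer (fun j => csum (fold2 (tT j)) (S m)) =
  (/ z * (ce ((INR m + / 2)%R * z') + / 2 - / ((INR m + / 2)%R * z')))%C.
Proof.
  split. { apply CSer_csum_swap. intros k. apply eis_summ_fold2, eis_summ_tT. }
  set (tau := INR m + / 2). assert (Htau : 0 < tau) by (unfold tau; pose proof (pos_INR m); lra).
  assert (Hw : 0 < Re (tau * z')%C) by (rewrite Re_RtoC_mult; pose proof eis_z'_pos; nra).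
  destruct (ce_pf _ Hw) as [P1 ->].
  match goal with |- _ = (_ * (?a + ?b - ?a))%C => replace (a + b - a)%C with b by ring end.
  rewrite <- CSer_scal by auto. apply CSer_ext. intros j. rewrite eis_telescope. fold tau.
  assert (Hz0 : z <> 0) by (apply Re_pos_neq0; auto).
  assert (E : forall a b : R, (b * z' + omr a = omr 1 / z * (a * z - omr b))%C) by (intros; apply dual_lattice_point; auto).
  assert (E1 : (tau * z' + om (S j))%C = (omr 1 / z * W j (- tau))%C).
  { rewrite om_omr, E. unfold W. rewrite omr_opp. reflexivity. }
  assert (E2 : (tau * z' - om (S j))%C = (- (omr 1 / z * W j tau))%C).
  { transitivity (tau * z' + omr (- INR (S j)))%C; [rewrite omr_opp; reflexivity|].
    rewrite E. unfold W. rewrite RtoC_opp. ring. }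
  rewrite E1, E2. pose proof (eis_W_neq0 j tau). pose proof (eis_W_neq0 j (- tau)).
  pose proof omr_1_sqr as Ho.
  pose proof omr_1_neq0 as Ho1.
  assert (Ez : z' = (- (omr 1 * omr 1) / z)%C).
  { unfold z'. rewrite Ho, RtoC_opp. unfold Cdiv. ring. }
  assert (Es : (W j tau - W j (- tau) = 2 * tau * omr 1)%C).
  { unfold W. rewrite omr_opp. unfold omr. ring. }
  transitivity (/ omr 1 * ((W j tau - W j (- tau)) / (W j tau * W j (- tau))))%C; [field; auto|].
  rewrite Es, Ez. field. auto.
Qed.

Lemma eis_boundary_lim :
  clim (fun m => / z * (ce ((INR m + / 2)%R * z') + / 2 - / ((INR m + / 2)%R * z')))%C (/ (2 * z))%C.
Proof.
  assert (Hz0 : z <> 0) by (apply Re_pos_neq0; auto). pose proof eis_z'_pos as Hz'.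
  replace (/ (2 * z))%C with (/ z * (0 + / 2 - 0))%C by (field; auto).
  apply clim_scal. set (r := Re z') in *.
  assert (Hm : forall m, 0 < (INR m + / 2) * r /\ / ((INR m + / 2) * r) <= 2 / r * / INR (S m)).
  { intros m. pose proof (pos_INR m). rewrite S_INR. split; [nra|].
    replace (2 / r * / (INR m + 1)) with (/ ((INR m + 1) / 2 * r)) by (field; lra).
    apply Rinv_le_contravar; [nra|]. apply Rmult_le_compat_r; lra. }
  apply clim_minus; [apply clim_plus; [|apply clim_const]|]; apply clim_inv_INR with (2 / r); intros m; cbv beta;
    destruct (Hm m) as [H1 H2]; (eapply Rle_trans; [|apply H2]).
  - unfold ce. rewrite Cminus_0_r.
    set (u := ((INR m + / 2)%R * z')%C). assert (Hu : Re u = (INR m + / 2) * r) by (unfold u; apply Re_RtoC_mult).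
    assert (B : (INR m + / 2) * r <= Cmod (Cexp u - 1)%C).
    { replace (Cexp u - 1)%C with (Cexp u + - (1))%C by ring.
      eapply Rle_trans; [|apply Cmod_triangle_inv].
      rewrite Cmod_Cexp, Cmod_m1, Hu. pose proof (exp_ineq1_le ((INR m + / 2) * r)). lra. }
    rewrite Cmod_inv by (apply Cmod_gt_0; lra). apply Rinv_le_contravar; auto.
  - rewrite Cminus_0_r.
    assert (B : (INR m + / 2) * r <= Cmod ((INR m + / 2)%R * z')%C).
    { eapply Rle_trans; [|apply re_le_Cmod]. rewrite Re_RtoC_mult. fold r. apply Rle_abs. }
    rewrite Cmod_inv by (apply Cmod_gt_0; lra). apply Rinv_le_contravar; auto.
Qed.

(** Convergence at the dual point is assumed because the section fixes [z]; afterwards [cS_summ]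
    provides it everywhere. Column 0 gives the term [PI ^ 2 / 6], and the inverse squares subtracted
    in [eis_column] give [(4 PI ^ 2 / z ^ 2) (PI ^ 2 / 6) / z' ^ 2 = 1 / 24]. *)
Lemma eis_transform_aux : summ (fun j => cphi (INR (S j) * z')) ->
  CSer (fun j => cphi (INR (S j) * z)) =
  ((PI ^ 2 / 6)%R / (z * z) + (/ 24)%R - / (2 * z)
    - (4 * PI ^ 2)%R / (z * z) * CSer (fun j => cphi (INR (S j) * z')))%C.
Proof.
  intros Hs'. pose proof PI_bounds as HP.
  assert (Hz0 : z <> 0) by (apply Re_pos_neq0; auto).
  assert (HPC : RtoC PI <> 0) by (apply RtoC_neq0; lra).
  assert (Hsq : forall u : C, u <> 0 -> summ (fun k => / (INR (S k) * u * (INR (S k) * u)))%C /\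
     CSer (fun k => / (INR (S k) * u * (INR (S k) * u)))%C = ((PI ^ 2 / 6)%R / (u * u))%C).
  { intros u Hu. rewrite <- basel.
    assert (E : forall k, (/ (u * u) * RtoC (/ INR (S k) ^ 2) = / (INR (S k) * u * (INR (S k) * u)))%C).
    { intros k. pose proof (INR_S_pos k) as Hk. set (X := INR (S k)) in *.
      assert (RtoC X <> 0) by (apply RtoC_neq0; lra).
      replace (RtoC (/ X ^ 2)) with (/ (X * X))%C.
      - field. auto.
      - rewrite <- RtoC_mult, <- RtoC_inv by nra. f_equal. f_equal. ring. }
    assert (S0 : summ (fun k => RtoC (/ INR (S k) ^ 2))).
    { unfold summ. apply ex_series_ext with (fun k => / INR (S k) ^ 2); [|apply ex_series_inv_sq].
      intros k. rewrite Cmod_R, Rabs_pos_eq; auto. left; apply Rinv_0_lt_compat. pose proof (INR_S_pos k); nra. }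
    split.
    - apply (summ_ext _ _ E). apply summ_scal; auto.
    - rewrite <- (CSer_ext _ _ E), CSer_scal by auto. rewrite RtoC_series. unfold zeta2, Cdiv. ring. }
  eapply clim_unique; [apply eis_fubini|].
  apply (clim_decr _ _ 1).
  apply clim_ext with (fun m =>
    (CSer (fun j => fold2 (eT j) 0%nat) +
     - (4 * PI ^ 2)%R / (z * z) * (csum (fun k => cphi (INR (S k) * z')) m - csum (fun k => / (INR (S k) * z' * (INR (S k) * z')))%C m))
    - / z * (ce ((INR m + / 2)%R * z') + / 2 - / ((INR m + / 2)%R * z')))%C.
  { intros m. rewrite Nat.add_1_r. rewrite <- (proj2 (eis_boundary m)).
    assert (Sk : forall k, summ (fun j => fold2 (tT j) k)) by (intros; apply eis_summ_fold2, eis_summ_tT).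
    pose proof (proj2 (CSer_csum_swap (fun j k => fold2 (tT j) k) (S m) Sk) :
      CSer (fun j => csum (fold2 (tT j)) (S m)) = csum (fun k => CSer (fun j => fold2 (tT j) k)) (S m)) as Q.
    rewrite Q.
    assert (Ek : forall k, CSer (fun j => fold2 (fun t => eT j t - tT j t)%C k) =
      (CSer (fun j => fold2 (eT j) k) - CSer (fun j => fold2 (tT j) k))%C).
    { intros k. rewrite <- CSer_minus; auto; [|apply eis_summ_fold2, eis_summ_eT].
      apply CSer_ext. intros j. unfold fold2. destruct k; ring. }
    rewrite (csum_ext (fun k => CSer (fun j => fold2 (fun t => eT j t - tT j t)%C k))
      (fun k => CSer (fun j => fold2 (eT j) k) + - (1) * CSer (fun j => fold2 (tT j) k))%C (S m)).
    2: { intros k _. rewrite Ek. ring. }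
    rewrite csum_plus, csum_scal. rewrite (csum_S_l (fun k => CSer (fun j => fold2 (eT j) k))).
    rewrite (csum_ext (fun k => CSer (fun j => fold2 (eT j) (S k)))
      (fun k => - (4 * PI ^ 2)%R / (z * z) * (cphi (INR (S k) * z') + - (1) * / ((INR (S k) * z') * (INR (S k) * z'))))%C m).
    2: { intros k _. rewrite eis_column. ring. }
    rewrite csum_scal, csum_plus, csum_scal. ring. }
  assert (Hz'0 : z' <> 0) by (apply Re_pos_neq0, eis_z'_pos).
  destruct (Hsq z Hz0) as [Q1 Q2]. destruct (Hsq z' Hz'0) as [Q3 Q4].
  replace ((PI ^ 2 / 6)%R / (z * z) + (/ 24)%R - / (2 * z)
    - (4 * PI ^ 2)%R / (z * z) * CSer (fun j => cphi (INR (S j) * z')))%C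
    with ((PI ^ 2 / 6)%R / (z * z) + - (4 * PI ^ 2)%R / (z * z) *
      (CSer (fun j => cphi (INR (S j) * z')) - (PI ^ 2 / 6)%R / (z' * z')) - / (2 * z))%C.
  2: { unfold z'. rewrite RtoC_div, RtoC_mult, RtoC_pow, RtoC_inv by lra. simpl Cpow. field. auto. }
  apply clim_minus; [|apply eis_boundary_lim].
  apply clim_plus.
  - rewrite (CSer_ext _ (fun k => / (INR (S k) * z * (INR (S k) * z)))%C).
    + rewrite Q2. apply clim_const.
    + intros j. unfold fold2, eT, W. replace (omr 0) with (RtoC 0) by (unfold omr; ring). rewrite Cplus_0_r. auto.
  - apply clim_scal, clim_minus; [apply CSer_correct; auto|].
    rewrite <- Q4. apply CSer_correct; auto.
Qed.

End Eisenstein.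

(** The Lambert series of the divisor sums: up to normalization, the weight two Eisenstein series
    without its constant term. *)
Definition cS (z : C) : C := CSer (fun j => cphi (INR (S j) * z)).

Lemma cS_summ (z : C) : 0 < Re z -> summ (fun j => cphi (INR (S j) * z)).
Proof. intros H. apply (eis_fubini z H). Qed.

Lemma cS_transform (z : C) : 0 < Re z ->
  cS z = ((PI ^ 2 / 6)%R / (z * z) + (/ 24)%R - / (2 * z)
    - (4 * PI ^ 2)%R / (z * z) * cS ((4 * PI ^ 2)%R / z))%C.
Proof.
  intros H. apply eis_transform_aux; auto. apply cS_summ.
  apply Re_dual_pos; auto. pose proof PI_bounds; nra.
Qed.

(** * The modular transformation of the partition product *)

(* [Lam z] is the logarithm of [prod_n 1 / (1 - exp (- n z))]. *)
Definition Lam (z : C) : C := CSer (fun j => (/ INR (S j))%R * ce (INR (S j) * z))%C.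

Lemma exp_neg_lt1 b : 0 < b -> 0 < exp (- b) < 1.
Proof. intros H. split; [apply exp_pos|]. rewrite <- exp_0. apply exp_increasing; lra. Qed.

Lemma Cexp_sub1_lower (w : C) b : 0 < b <= Re w -> exp (Re w) * (1 - exp (- b)) <= Cmod (Cexp w - 1)%C.
Proof.
  intros [Hb Hw]. pose proof (exp_neg_lt1 b Hb).
  replace (Cexp w - 1)%C with (Cexp w + - (1))%C by ring.
  eapply Rle_trans; [|apply Cmod_triangle_inv]. rewrite Cmod_Cexp, Cmod_m1.
  assert (1 <= exp (Re w) * exp (- b)); [|lra].
  rewrite <- exp_plus, <- exp_0. apply exp_le_mono. lra.
Qed.

Lemma Cmod_ce_le (w : C) b : 0 < b <= Re w -> Cmod (ce w) <= exp (- Re w) / (1 - exp (- b)).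
Proof.
  intros H. pose proof (Cexp_sub1_lower w b H) as L. pose proof (exp_neg_lt1 b ltac:(lra)) as Hb.
  pose proof (exp_pos (Re w)).
  assert (0 < exp (Re w) * (1 - exp (- b))) by (apply Rmult_lt_0_compat; lra).
  unfold ce. rewrite Cmod_inv by (apply Cmod_gt_0; lra). rewrite exp_Ropp.
  replace (/ exp (Re w) / (1 - exp (- b))) with (/ (exp (Re w) * (1 - exp (- b)))) by (field; lra).
  apply Rinv_le_contravar; auto.
Qed.

Lemma ex_series_exp (r : R) : 0 < r -> ex_series (fun j => exp (- (INR (S j) * r))) /\
  Series (fun j => exp (- (INR (S j) * r))) = exp (- r) / (1 - exp (- r)).
Proof.
  intros H. pose proof (exp_neg_lt1 r H) as Hb.
  assert (E : forall j, exp (- r) * exp (- r) ^ j = exp (- (INR (S j) * r))).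
  { intros j. rewrite exp_pow, <- exp_plus, S_INR. f_equal. ring. }
  assert (G : ex_series (fun j => exp (- r) ^ j)) by (apply ex_series_geom; rewrite Rabs_pos_eq; lra).
  split.
  - apply (ex_series_ext (fun j => exp (- r) * exp (- r) ^ j)); [exact E|]. apply ex_series_Rmult_l; auto.
  - rewrite <- (Series_ext _ _ E), Series_scal_l, Series_geom by (rewrite Rabs_pos_eq; lra). reflexivity.
Qed.

Lemma Lam_term_le (z : C) b j : 0 < b <= Re z ->
  Cmod ((/ INR (S j))%R * ce (INR (S j) * z))%C <= / (1 - exp (- b)) * exp (- (INR (S j) * Re z)).
Proof.
  intros H. pose proof (INR_S_pos j) as Hj.
  assert (Hj1 : 1 <= INR (S j)) by apply INR_S_ge1.
  rewrite Cmod_mult, Cmod_R, Rabs_pos_eq by (left; apply Rinv_0_lt_compat; auto).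
  pose proof (Cmod_ce_le (INR (S j) * z)%C b) as L. rewrite Re_RtoC_mult in L.
  specialize (L ltac:(nra)). pose proof (exp_neg_lt1 b ltac:(lra)) as Hb.
  assert (/ INR (S j) <= 1) by (rewrite <- Rinv_1; apply Rinv_le_contravar; lra).
  pose proof (Cmod_ge_0 (ce (INR (S j) * z))). unfold Rdiv in L. rewrite (Rmult_comm (exp _)) in L. nra.
Qed.

Lemma Lam_summ (z : C) : 0 < Re z -> summ (fun j => (/ INR (S j))%R * ce (INR (S j) * z))%C.
Proof.
  intros H. apply summ_le with (fun j => / (1 - exp (- Re z)) * exp (- (INR (S j) * Re z))).
  - intros j. apply Lam_term_le. lra.
  - apply ex_series_Rmult_l. apply ex_series_exp; auto.
Qed.

Lemma Cmod_Lam_le (z : C) b : 0 < b <= Re z -> Cmod (Lam z) <= exp (- Re z) / (1 - exp (- b)) ^ 2.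
Proof.
  intros H. pose proof (exp_neg_lt1 b ltac:(lra)) as Hb.
  assert (Hz : exp (- Re z) <= exp (- b)) by (apply exp_le_mono; lra). pose proof (exp_pos (- Re z)).
  destruct (ex_series_exp (Re z) ltac:(lra)) as [S1 S2].
  apply Rle_trans with (Series (fun j => / (1 - exp (- b)) * exp (- (INR (S j) * Re z)))).
  - apply CSer_Cmod_le_b; [|apply ex_series_Rmult_l; auto]. intros j. apply Lam_term_le; auto.
  - rewrite Series_scal_l, S2.
    replace (exp (- Re z) / (1 - exp (- b)) ^ 2) with (/ (1 - exp (- b)) * (exp (- Re z) / (1 - exp (- b)))) by (field; lra).
    apply Rmult_le_compat_l; [left; apply Rinv_0_lt_compat; lra|].
    apply Rmult_le_compat_l; [lra|]. apply Rinv_le_contravar; lra.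
Qed.

(** The remainder has to keep exponential decay in [Re w] so as to be summable over [w = j z], and
    its constant may depend only on [b], which is uniform in [j]. Allowing [|eta|] up to [Re w / 4]
    costs half of the decay. *)
Lemma ce_quad (w eta : C) (b : R) : 0 < b -> b <= Re w / 2 -> Cmod eta <= Re w / 4 ->
  Cmod (ce (w + eta) - ce w - eta * - cphi w)%C <=
  (/ (1 - exp (- b))) ^ 2 * (3 + / (1 - exp (- b))) * Cmod eta ^ 2 * exp (- (Re w / 2)).
Proof.
  intros Hb Hbw He. pose proof (exp_neg_lt1 b Hb) as Hb1.
  set (ka := / (1 - exp (- b))). assert (Hka : 1 <= ka).
  { unfold ka. rewrite <- Rinv_1. apply Rinv_le_contravar; lra. }
  assert (Hre : Rabs (Re eta) <= Cmod eta) by apply re_le_Cmod. apply Rabs_le_between in Hre.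
  assert (Hw : 0 < Re w) by lra.
  pose proof (Cexp_sub1_lower w b ltac:(lra)) as L1.
  assert (Re (w + eta)%C = Re w + Re eta) as Hre2 by apply Re_Cplus.
  pose proof (Cexp_sub1_lower (w + eta)%C b ltac:(lra)) as L2. rewrite Hre2 in L2.
  set (E := Cexp w) in *. set (rho := (Cexp eta - 1 - eta)%C).
  assert (HE' : Cexp (w + eta)%C = (E * (1 + eta + rho))%C) by (rewrite Cexp_plus; unfold rho; fold E; ring).
  set (E' := Cexp (w + eta)%C) in *.
  pose proof (exp_pos (Re w)). pose proof (exp_pos (Re w + Re eta)).
  assert (P1 : 0 < exp (Re w) * (1 - exp (- b))) by (apply Rmult_lt_0_compat; lra).
  assert (P2 : 0 < exp (Re w + Re eta) * (1 - exp (- b))) by (apply Rmult_lt_0_compat; lra).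
  assert (N1 : (E - 1)%C <> 0) by (apply Cmod_gt_0; lra).
  assert (N2 : (E' - 1)%C <> 0) by (apply Cmod_gt_0; lra).
  replace (ce (w + eta) - ce w - eta * - cphi w)%C with
    ((E / (E - 1)) * (- rho + eta * (E / (E - 1)) * (Cexp eta - 1)) * / (E' - 1))%C.
  2: { unfold ce, cphi. fold E E'.
       replace (Cexp eta - 1)%C with (eta + rho)%C by (unfold rho; ring).
       transitivity ((E * (- rho * (E - 1) + eta * E * (eta + rho))) / ((E - 1) * (E - 1) * (E' - 1)))%C; [field; auto|].
       transitivity ((- (E' - E) * (E - 1) + eta * E * (E' - 1)) / ((E - 1) * (E - 1) * (E' - 1)))%C; [|field; auto].
       f_equal. rewrite HE'. ring. }
  assert (Q1 : Cmod (E / (E - 1))%C <= ka).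
  { rewrite Cmod_div by auto. unfold E at 1. rewrite Cmod_Cexp. unfold ka.
    apply Rmult_le_reg_r with (Cmod (E - 1)%C); [lra|]. unfold Rdiv. rewrite Rmult_assoc, Rinv_l by lra.
    apply Rmult_le_reg_l with (1 - exp (- b)); [lra|].
    replace ((1 - exp (- b)) * (/ (1 - exp (- b)) * Cmod (E - 1)%C)) with (Cmod (E - 1)%C) by (field; lra). lra. }
  assert (Q2 : Cmod (/ (E' - 1))%C <= ka * exp (- (3 * Re w / 4))).
  { rewrite Cmod_inv by auto. unfold ka.
    apply Rle_trans with (/ (exp (Re w + Re eta) * (1 - exp (- b)))).
    - apply Rinv_le_contravar; auto.
    - rewrite Rinv_mult, Rmult_comm. apply Rmult_le_compat_l; [left; apply Rinv_0_lt_compat; lra|].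
      rewrite <- exp_Ropp. apply exp_le_mono. lra. }
  assert (Q3 : Cmod rho <= 3 * Cmod eta ^ 2 * exp (Re w / 4)).
  { eapply Rle_trans; [apply Cexp_quad|]. apply Rmult_le_compat_l; [pose proof (pow2_ge_0 (Cmod eta)); lra|].
    apply exp_le_mono; auto. }
  assert (Q4 : Cmod (Cexp eta - 1)%C <= Cmod eta * exp (Re w / 4)).
  { eapply Rle_trans; [apply Cexp_sub1_le|]. apply Rmult_le_compat_l; [apply Cmod_ge_0|]. apply exp_le_mono; auto. }
  pose proof (Cmod_ge_0 eta) as He0. pose proof (exp_pos (Re w / 4)) as Hp4.
  assert (Q5 : Cmod (- rho + eta * (E / (E - 1)) * (Cexp eta - 1))%C <= (3 + ka) * Cmod eta ^ 2 * exp (Re w / 4)).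
  { eapply Rle_trans; [apply Cmod_triangle|]. rewrite Cmod_opp, !Cmod_mult.
    assert (Cmod eta * Cmod (E / (E - 1))%C * Cmod (Cexp eta - 1)%C <= Cmod eta * ka * (Cmod eta * exp (Re w / 4))).
    { apply Rmult_le_compat; auto using Cmod_ge_0.
      - apply Rmult_le_pos; auto using Cmod_ge_0.
      - apply Rmult_le_compat_l; auto. }
    nra. }
  rewrite !Cmod_mult.
  apply Rle_trans with (ka * ((3 + ka) * Cmod eta ^ 2 * exp (Re w / 4)) * (ka * exp (- (3 * Re w / 4)))).
  - apply Rmult_le_compat; auto using Cmod_ge_0.
    + apply Rmult_le_pos; apply Cmod_ge_0.
    + apply Rmult_le_compat; auto using Cmod_ge_0.
  - right. replace (exp (- (Re w / 2))) with (exp (Re w / 4) * exp (- (3 * Re w / 4))).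
    + ring.
    + rewrite <- exp_plus. f_equal. field.
Qed.

(** The factor [1 / j] cancels the inner derivative. In the remainder one factor [j] survives and is
    absorbed by [mul_exp_neg_le]. *)
Lemma cder_Lam (z : C) : 0 < Re z -> cder Lam z (- cS z)%C.
Proof.
  intros H. set (r := Re z). assert (Hr : 0 < r) by exact H.
  set (ka := / (1 - exp (- (r / 2)))). pose proof (exp_neg_lt1 (r / 2) ltac:(lra)) as Hb1.
  assert (Hka : 0 < ka) by (apply Rinv_0_lt_compat; lra).
  set (K := ka ^ 2 * (3 + ka)). assert (HK : 0 < K) by (apply Rmult_lt_0_compat; [apply pow_lt|]; lra).
  apply cder_eq with (CSer (fun j => - cphi (INR (S j) * z))%C).
  { unfold cS. rewrite (CSer_ext _ (fun j => - (1) * cphi (INR (S j) * z))%C) by (intros; ring).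
    rewrite CSer_scal by (apply cS_summ; auto). ring. }
  apply (cder_series (fun j w => (/ INR (S j))%R * ce (INR (S j) * w))%C (fun j w => - cphi (INR (S j) * w))%C z
    (fun j => K * (4 / r) * exp (- (INR (S j) * (r / 4)))) (r / 4)).
  - lra.
  - intros h Hh. apply Lam_summ. rewrite Re_Cplus. pose proof (re_le_Cmod h) as Hre.
    apply Rabs_le_between in Hre. fold r. lra.
  - apply summ_ext with (fun j => - (1) * cphi (INR (S j) * z))%C; [intros; ring|].
    apply summ_scal, cS_summ; auto.
  - intros j h Hh. pose proof (INR_S_pos j) as Hj. set (J := INR (S j)) in *.
    assert (Hj1 : 1 <= J) by (unfold J; apply INR_S_ge1).
    replace ((/ J)%R * ce (J * (z + h)) - (/ J)%R * ce (J * z) - h * - cphi (J * z))%C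
      with ((/ J)%R * (ce (J * z + J * h) - ce (J * z) - (J * h) * - cphi (J * z)))%C.
    2: { rewrite RtoC_inv by lra. replace (J * (z + h))%C with (J * z + J * h)%C by ring.
         field. apply RtoC_neq0; lra. }
    rewrite Cmod_mult, Cmod_R, Rabs_pos_eq by (left; apply Rinv_0_lt_compat; auto).
    assert (HRe : Re (J * z)%C = J * r) by apply Re_RtoC_mult.
    assert (HJh : Cmod (J * h)%C = J * Cmod h) by (rewrite Cmod_mult, Cmod_R, Rabs_pos_eq; lra).
    pose proof (ce_quad (J * z)%C (J * h)%C (r / 2) ltac:(lra)) as Q. rewrite HRe, HJh in Q.
    specialize (Q ltac:(nra) ltac:(nra)). fold ka K in Q.
    pose proof (Cmod_ge_0 h) as Hh0.
    apply Rle_trans with (/ J * (K * (J * Cmod h) ^ 2 * exp (- (J * r / 2)))).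
    { apply Rmult_le_compat_l; [left; apply Rinv_0_lt_compat; auto|]. exact Q. }
    replace (/ J * (K * (J * Cmod h) ^ 2 * exp (- (J * r / 2)))) with ((K * Cmod h ^ 2) * (J * exp (- (J * r / 2)))) by (field; lra).
    replace (K * (4 / r) * exp (- (J * (r / 4))) * Cmod h ^ 2) with ((K * Cmod h ^ 2) * (4 / r * exp (- (J * (r / 4))))) by ring.
    apply Rmult_le_compat_l; [apply Rmult_le_pos; [lra|apply pow2_ge_0]|].
    replace (exp (- (J * r / 2))) with (exp (- (J * (r / 4))) * exp (- (J * (r / 4)))) by (rewrite <- exp_plus; f_equal; field).
    rewrite <- Rmult_assoc. apply Rmult_le_compat_r; [left; apply exp_pos|].
    eapply Rle_trans; [apply mul_exp_neg_le; lra|]. right. field. lra.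
  - apply ex_series_Rmult_l. apply ex_series_exp. lra.
  - intros j. apply Rmult_le_pos; [|left; apply exp_pos]. apply Rmult_le_pos; [lra|].
    left; apply Rdiv_lt_0_compat; lra.
Qed.

Definition LamR (x : R) : R := Series (fun j => / INR (S j) * / (exp (INR (S j) * x) - 1)).

Lemma Lam_RtoC (x : R) : 0 < x -> Lam x = LamR x.
Proof.
  intros Hx. unfold Lam, LamR. rewrite <- RtoC_series. apply CSer_ext. intros j.
  rewrite RtoC_mult. f_equal. unfold ce. rewrite <- RtoC_mult, Cexp_RtoC, <- RtoC_minus, <- RtoC_inv; auto.
  apply Rgt_not_eq. pose proof (INR_S_pos j). pose proof (exp_ineq1 (INR (S j) * x)). 
  assert (0 < INR (S j) * x) by nra. lra.
Qed.

(** * Integration of the Eisenstein transformation *)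

Definition dual (z : C) : C := ((4 * PI ^ 2)%R / z)%C.

Lemma Re_dual (z : C) : 0 < Re z -> 0 < Re (dual z).
Proof. apply Re_dual_pos. pose proof PI_bounds; nra. Qed.

(** What remains of the logarithm of the eta transformation once the elementary exponents are
    removed: a branch of half the logarithm of [z / (2 PI)], its derivative being the anomalous
    term. *)
Definition Beta (z : C) : C := (Lam z - Lam (dual z) - (PI ^ 2 / 6)%R * / z + (/ 24)%R * z)%C.

Lemma cder_dual (z : C) : z <> 0 -> cder dual z (- (4 * PI ^ 2)%R / (z * z))%C.
Proof.
  intros H. unfold dual, Cdiv. eapply cder_eq; [|apply cder_scal, cder_inv; auto]. ring.
Qed.

Lemma cder_Beta (z : C) : 0 < Re z -> cder Beta z (/ (2 * z))%C.
Proof.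
  intros H. assert (Hz : z <> 0) by (apply Re_pos_neq0; auto).
  eapply cder_eq; [|apply cder_plus; [apply cder_minus; [apply cder_minus|]|]].
  2: apply cder_Lam; auto.
  2: { apply (cder_comp Lam dual); [apply cder_Lam, Re_dual; auto|apply cder_dual; auto]. }
  2: { apply cder_scal, cder_inv; auto. }
  2: { apply cder_scal, cder_id. }
  rewrite (cS_transform z H). fold (dual z).
  field. auto.
Qed.

Lemma Cexp_const_ratio (f : C -> C) (z : C) :
  (forall z, 0 < Re z -> cder f z (/ z)%C) -> f (RtoC (2 * PI)) = 0 -> 0 < Re z ->
  Cexp (f z) = (z / (2 * PI)%R)%C.
Proof.
  intros Hd H0 Hz. pose proof PI_bounds as HP.
  assert (G : (Cexp (f z) * / z = Cexp (f (RtoC (2 * PI))) * / RtoC (2 * PI))%C).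
  { apply (cder_0_const (fun z => Cexp (f z) * / z)%C); auto; [simpl; lra|].
    intros w Hw. assert (Hw0 : w <> 0) by (apply Re_pos_neq0; auto).
    eapply cder_eq; [|apply cder_mult; [apply cder_Cexp_comp, Hd; auto|apply cder_inv; auto]].
    cbv beta. field. auto. }
  rewrite H0, Cexp_0 in G. assert (Hz0 : z <> 0) by (apply Re_pos_neq0; auto).
  transitivity (Cexp (f z) * / z * z)%C; [field; auto|]. rewrite G. field. apply RtoC_neq0; lra.
Qed.

Lemma dual_RtoC (x : R) : x <> 0 -> dual x = RtoC (4 * PI ^ 2 / x).
Proof. intros H. unfold dual. rewrite RtoC_div by auto. auto. Qed.

(** At the fixed point of [dual] the two values of [Lam] coincide and both elementary terms are
    [PI / 12] in absolute value. *)
Lemma Beta_2PI : Beta (RtoC (2 * PI)) = 0.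
Proof.
  pose proof PI_bounds. unfold Beta. rewrite dual_RtoC by lra.
  replace (4 * PI ^ 2 / (2 * PI)) with (2 * PI) by (field; lra).
  rewrite <- RtoC_inv, <- !RtoC_mult by lra.
  replace (PI ^ 2 / 6 * / (2 * PI)) with (PI / 12) by (field; lra).
  replace (/ 24 * (2 * PI)) with (PI / 12) by field. ring.
Qed.

Lemma Beta_exp2 (z : C) : 0 < Re z -> Cexp (2 * Beta z) = (z / (2 * PI)%R)%C.
Proof.
  intros H. apply (Cexp_const_ratio (fun z => 2 * Beta z)%C); auto.
  - intros w Hw. eapply cder_eq; [|apply cder_scal, cder_Beta; auto].
    field. apply Re_pos_neq0; auto.
  - rewrite Beta_2PI. ring.
Qed.

(** [Beta_exp2] determines [Beta] only modulo [PI * Ci]; on the positive axis [Beta] is real, which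
    removes the ambiguity. The values at multiples of [2 PI] normalize [LamF_transform]. *)
Lemma Beta_real (x : R) : 0 < x -> Beta x = RtoC (/ 2 * ln (x / (2 * PI))).
Proof.
  intros Hx. pose proof PI_bounds.
  assert (E : exists b : R, Beta x = b).
  { unfold Beta. rewrite dual_RtoC by lra. rewrite !Lam_RtoC; auto.
    - rewrite <- RtoC_inv, <- !RtoC_mult, <- !RtoC_minus, <- RtoC_plus by lra. eexists; reflexivity.
    - apply Rdiv_lt_0_compat; auto. nra. }
  destruct E as [b Hb]. pose proof (Beta_exp2 x Hx) as G. rewrite Hb in *.
  rewrite <- RtoC_mult, Cexp_RtoC, <- RtoC_div in G by lra. apply RtoC_inj in G.
  f_equal. rewrite <- G, ln_exp. field.
Qed.

Definition LamF (s : R) (z : C) : C := (3 * Lam z + Lam ((2 * s)%R * z) - Lam (2 * z) - Lam (s * z))%C.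
Definition LamD (s : R) (z : C) : C :=
  (3 * Lam (dual z) + Lam (dual ((2 * s)%R * z)) - Lam (dual (2 * z)) - Lam (dual (s * z)))%C.

(** Each [Beta] has derivative [1 / (2 z)] at every scale, and [3 + 1 - 1 - 1 = 2] of them make
    [1 / z]. At [2 PI] the combination is [(ln (2 s) - ln 2 - ln s) / 2 = 0], so no constant
    appears. *)
Lemma LamF_transform (s : R) (z : C) : 0 < s -> 0 < Re z ->
  Cexp (LamF s z) =
  (z / (2 * PI)%R * Cexp ((PI ^ 2 / 6 * (5 / 2 - / (2 * s)))%R / z - ((1 + s) / 24)%R * z) * Cexp (LamD s z))%C.
Proof.
  intros Hs Hz. pose proof PI_bounds as HP.
  set (f := fun z => (3 * Beta z + Beta ((2 * s)%R * z) - Beta (2 * z) - Beta (s * z))%C).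
  assert (Hz0 : z <> 0) by (apply Re_pos_neq0; auto).
  assert (Hs0 : RtoC s <> 0) by (apply RtoC_neq0; lra).
  assert (Hc : forall (c : R) w, 0 < c -> 0 < Re w -> cder (fun w => Beta (c * w)%C) w (/ (2 * w))%C).
  { intros c w Hc Hw. eapply cder_eq; [|apply (cder_comp Beta (fun w => c * w)%C); [apply cder_Beta|apply cder_scal, cder_id]].
    - field. split; [|apply RtoC_neq0; lra]. apply Re_pos_neq0; auto.
    - rewrite Re_RtoC_mult. nra. }
  assert (E : Cexp (f z) = (z / (2 * PI)%R)%C).
  { apply Cexp_const_ratio; auto.
    - intros w Hw. unfold f.
      eapply cder_eq; [|apply cder_minus; [apply cder_minus; [apply cder_plus|]|]].
      2: apply cder_scal, cder_Beta; auto.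
      2: apply Hc; auto; lra.
      2: apply Hc; auto; lra.
      2: apply Hc; auto; lra.
      field. apply Re_pos_neq0; auto.
    - unfold f. rewrite Beta_2PI, <- !RtoC_mult, !Beta_real by nra.
      replace (2 * s * (2 * PI) / (2 * PI)) with (2 * s) by (field; lra).
      replace (2 * (2 * PI) / (2 * PI)) with 2 by (field; lra).
      replace (s * (2 * PI) / (2 * PI)) with s by (field; lra).
      rewrite ln_mult by lra. rewrite !RtoC_mult, RtoC_plus. ring. }
  rewrite <- E, <- !Cexp_plus. f_equal. unfold f, Beta, LamF, LamD.
  rewrite !RtoC_div, ?RtoC_mult, ?RtoC_minus, ?RtoC_plus, ?RtoC_div, ?RtoC_inv, ?RtoC_mult by lra.
  field. auto.
Qed.

(** * Power series in [exp (- z)] on the right half-plane *)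

Lemma ex_series_ext_R (a b : nat -> R) : (forall n, a n = b n) -> ex_series a -> ex_series b.
Proof. apply ex_series_ext. Qed.

(** Absolute convergence is required at every [r > 0]; the room between two values of [r] makes the
    class stable under multiplication by [n]. *)
Definition coefs (b : nat -> R) : Prop :=
  forall r, 0 < r -> ex_series (fun n => Rabs (b n) * exp (- (INR n * r))).

Definition qterm (b : nat -> R) (z : C) (n : nat) : C := (b n * Cexp (- (INR n * z)))%C.

Lemma Cmod_qterm b z n : Cmod (qterm b z n) = Rabs (b n) * exp (- (INR n * Re z)).
Proof.
  unfold qterm. rewrite Cmod_mult, Cmod_R, Cmod_Cexp. do 2 f_equal.
  change (Re (- (INR n * z))%C) with (- Re (INR n * z)%C). rewrite Re_RtoC_mult. auto.
Qed.

Lemma qterm_summ b z : coefs b -> 0 < Re z -> summ (qterm b z).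
Proof.
  intros Hb Hz. unfold summ. eapply ex_series_ext_R; [|apply (Hb (Re z) Hz)].
  intros n. symmetry. apply Cmod_qterm.
Qed.

Lemma coefs_plus b d : coefs b -> coefs d -> coefs (fun n => b n + d n).
Proof.
  intros Hb Hd r Hr.
  apply ex_series_le_R with (fun n => Rabs (b n) * exp (- (INR n * r)) + Rabs (d n) * exp (- (INR n * r))).
  - intros n. pose proof (exp_pos (- (INR n * r))). split.
    + apply Rmult_le_pos; [apply Rabs_pos|lra].
    + rewrite <- Rmult_plus_distr_r. apply Rmult_le_compat_r; [lra|apply Rabs_triang].
  - apply (ex_series_plus (V := R_NormedModule)); auto.
Qed.

Lemma coefs_scal c b : coefs b -> coefs (fun n => c * b n).
Proof.
  intros Hb r Hr.
  apply ex_series_ext_R with (fun n => Rabs c * (Rabs (b n) * exp (- (INR n * r)))).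
  - intros n. rewrite Rabs_mult. apply eq_sym, Rmult_assoc.
  - apply ex_series_Rmult_l; auto.
Qed.

Lemma coefs_INR b : coefs b -> coefs (fun n => INR n * b n).
Proof.
  intros Hb r Hr.
  apply ex_series_le_R with (fun n => 2 / r * (Rabs (b n) * exp (- (INR n * (r / 2))))).
  - intros n. pose proof (pos_INR n) as Hn. pose proof (exp_pos (- (INR n * r))). pose proof (Rabs_pos (b n)).
    rewrite Rabs_mult, (Rabs_pos_eq (INR n)) by lra. split.
    + apply Rmult_le_pos; [apply Rmult_le_pos|]; lra.
    + replace (exp (- (INR n * r))) with (exp (- (INR n * (r / 2))) * exp (- (INR n * (r / 2)))) by (rewrite <- exp_plus; f_equal; field).
      set (e := exp (- (INR n * (r / 2)))). assert (He : 0 < e) by apply exp_pos.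
      assert (Hk : INR n * e <= 2 / r).
      { eapply Rle_trans; [apply mul_exp_neg_le; lra|]. right. field. lra. }
      replace (INR n * Rabs (b n) * (e * e)) with ((INR n * e) * (Rabs (b n) * e)) by ring.
      apply Rmult_le_compat_r; auto. apply Rmult_le_pos; lra.
  - apply ex_series_Rmult_l, Hb. lra.
Qed.

Lemma coefs_const c : coefs (fun _ => c).
Proof.
  intros r Hr. apply ex_series_Rmult_l. apply (ex_series_incr_1 (fun n => exp (- (INR n * r)))).
  apply (proj1 (ex_series_exp r Hr)).
Qed.

Lemma Re_CSer a : Re (CSer a) = Series (fun n => Re (a n)).
Proof. reflexivity. Qed.

Lemma Im_CSer a : Im (CSer a) = Series (fun n => Im (a n)).
Proof. reflexivity. Qed.

Lemma CSer_mult (a b : nat -> C) : summ a -> summ b ->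
  summ (fun n => csum (fun k => a k * b (n - k)%nat)%C (S n)) /\
  CSer (fun n => csum (fun k => a k * b (n - k)%nat)%C (S n)) = (CSer a * CSer b)%C.
Proof.
  intros Ha Hb.
  assert (Habs : forall f : nat -> R, (forall n, 0 <= f n) -> ex_series f -> ex_series (fun n => Rabs (f n))).
  { intros f Hf. apply ex_series_ext_R. intros n. symmetry. apply Rabs_pos_eq; auto. }
  assert (Ha' : forall P : C -> R, (forall c, Rabs (P c) <= Cmod c) -> ex_series (fun n => Rabs (P (a n)))).
  { intros P HP. apply ex_series_le_R with (fun n => Cmod (a n)); auto. intros; split; auto using Rabs_pos. }
  assert (Hb' : forall P : C -> R, (forall c, Rabs (P c) <= Cmod c) -> ex_series (fun n => Rabs (P (b n)))).
  { intros P HP. apply ex_series_le_R with (fun n => Cmod (b n)); auto. intros; split; auto using Rabs_pos. }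
  assert (Hs : summ (fun n => csum (fun k => a k * b (n - k)%nat)%C (S n))).
  { apply summ_le with (fun n => sum_f_R0 (fun k => Cmod (a k) * Cmod (b (n - k)%nat)) n).
    - intros n. eapply Rle_trans; [apply csum_Cmod_le|]. right. apply sum_eq. intros; apply Cmod_mult.
    - eexists. apply (is_series_mult (fun k => Cmod (a k)) (fun k => Cmod (b k))).
      + apply Series_correct, Ha.
      + apply Series_correct, Hb.
      + apply Habs; auto. intros; apply Cmod_ge_0.
      + apply Habs; auto. intros; apply Cmod_ge_0. }
  split; auto.
  assert (M : forall P Q : C -> R, (forall c, Rabs (P c) <= Cmod c) -> (forall c, Rabs (Q c) <= Cmod c) ->
    is_series (fun n => sum_f_R0 (fun k => P (a k) * Q (b (n - k)%nat)) n) (Series (fun n => P (a n)) * Series (fun n => Q (b n)))).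
  { intros P Q HP HQ. apply (is_series_mult (fun n => P (a n)) (fun n => Q (b n))); auto.
    - apply Series_correct, ex_series_Rabs, Ha', HP.
    - apply Series_correct, ex_series_Rabs, Hb', HQ. }
  pose proof (M Re Re re_le_Cmod re_le_Cmod) as M1. pose proof (M Im Im im_le_Cmod im_le_Cmod) as M2.
  pose proof (M Re Im re_le_Cmod im_le_Cmod) as M3. pose proof (M Im Re im_le_Cmod re_le_Cmod) as M4.
  apply C_eq; [rewrite Re_Cmult|rewrite Im_Cmult]; rewrite !Re_CSer, !Im_CSer; apply is_series_unique.
  - pose proof (is_series_minus _ _ _ _ M1 M2) as Q. eapply is_series_ext; [|exact Q].
    intros n. cbv beta. rewrite csum_Re. symmetry.
    rewrite (sum_eq _ (fun k => Re (a k) * Re (b (n - k)%nat) - Im (a k) * Im (b (n - k)%nat))) by (intros; apply Re_Cmult).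
    apply minus_sum.
  - pose proof (is_series_plus _ _ _ _ M3 M4) as Q. eapply is_series_ext; [|exact Q].
    intros n. cbv beta. rewrite csum_Im. symmetry.
    rewrite (sum_eq _ (fun k => Re (a k) * Im (b (n - k)%nat) + Im (a k) * Re (b (n - k)%nat))) by (intros; apply Im_Cmult).
    apply sum_plus.
Qed.

Definition conv (b d : nat -> R) (n : nat) : R := sum_f_R0 (fun k => b k * d (n - k)%nat) n.

Lemma qterm_conv b d z n :
  csum (fun k => qterm b z k * qterm d z (n - k))%C (S n) = qterm (conv b d) z n.
Proof.
  rewrite (csum_ext _ (fun k => Cexp (- (INR n * z)) * RtoC (b k * d (n - k)%nat)%R)%C).
  - rewrite csum_scal. unfold qterm. rewrite Cmult_comm. f_equal.
    apply C_eq; [rewrite csum_Re|rewrite csum_Im]; simpl; auto.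
    rewrite sum_cte. ring.
  - intros k Hk. unfold qterm. rewrite RtoC_mult.
    replace (Cexp (- (INR n * z))) with (Cexp (- (INR k * z)) * Cexp (- (INR (n - k) * z)))%C; [ring|].
    rewrite <- Cexp_plus. f_equal. rewrite minus_INR, RtoC_minus by lia. ring.
Qed.

Lemma conv_summ b d z : coefs b -> coefs d -> 0 < Re z ->
  summ (qterm (conv b d) z) /\ CSer (qterm (conv b d) z) = (CSer (qterm b z) * CSer (qterm d z))%C.
Proof.
  intros Hb Hd Hz. destruct (CSer_mult (qterm b z) (qterm d z)) as [M1 M2]; auto using qterm_summ.
  split.
  - eapply summ_ext; [|apply M1]. intros; apply qterm_conv.
  - rewrite <- M2. apply CSer_ext. intros; symmetry; apply qterm_conv.
Qed.

(** Identity theorem: when the coefficients below [n] vanish, dividing by [x ^ n] gives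
    [|u n| <= x * M] for all small [x], with [M] independent of [x]. *)
Lemma series_zero_coef (u : nat -> R) :
  (forall x, 0 < x < 1 -> ex_series (fun n => Rabs (u n) * x ^ n) /\ Series (fun n => u n * x ^ n) = 0) ->
  forall n, u n = 0.
Proof.
  intros H n. induction n as [n IH] using (well_founded_induction Nat.lt_wf_0).
  assert (Habs : forall x k, 0 < x < 1 -> ex_series (fun i => Rabs (u (k + i)%nat) * x ^ i)).
  { intros x k Hx. destruct (H x Hx) as [H1 _]. apply (ex_series_incr_n _ k) in H1.
    apply ex_series_ext_R with (fun i => / x ^ k * (Rabs (u (k + i)%nat) * x ^ (k + i))).
    - intros i. transitivity (Rabs (u (k + i)%nat) * (x ^ (k + i) * / x ^ k)); [ring|]. f_equal. 
      rewrite pow_add. field. apply pow_nonzero; lra.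
    - apply ex_series_Rmult_l; auto. }
  assert (Hrel : forall (v : nat -> R) x, 0 < x < 1 -> ex_series (fun i => Rabs (v i) * x ^ i) -> ex_series (fun i => v i * x ^ i)).
  { intros v x Hx Hv. apply ex_series_Rabs. eapply ex_series_ext_R; [|exact Hv].
    intros i. cbv beta. rewrite Rabs_mult, (Rabs_pos_eq (x ^ i)); auto. apply pow_le; lra. }
  set (M := Series (fun i => Rabs (u (S n + i)%nat) * (/ 2) ^ i)).
  assert (Hu : forall x, 0 < x <= / 2 -> Rabs (u n) <= x * M).
  { intros x Hx. destruct (H x ltac:(lra)) as [_ H2].
    assert (Z : Series (fun i => u (n + i)%nat * x ^ i) = 0).
    { apply Rmult_eq_reg_l with (x ^ n); [|apply pow_nonzero; lra].
      rewrite Rmult_0_r, <- H2, <- Series_scal_l. symmetry.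
      rewrite (Series_incr_n_aux (fun i => u i * x ^ i) n).
      - apply Series_ext. intros i. rewrite pow_add. ring.
      - intros k Hk. rewrite IH by auto. ring. }
    rewrite Series_incr_1 in Z by (apply (Hrel (fun i => u (n + i)%nat)); [lra|]; apply Habs; lra).
    rewrite Nat.add_0_r in Z. simpl pow in Z.
    assert (E : Series (fun k => u (n + S k)%nat * (x * x ^ k)) = x * Series (fun k => u (S n + k)%nat * x ^ k)).
    { rewrite <- Series_scal_l. apply Series_ext. intros k. replace (n + S k)%nat with (S n + k)%nat by lia. ring. }
    rewrite E in Z. replace (u n) with (- (x * Series (fun k => u (S n + k)%nat * x ^ k))) by lra.
    rewrite Rabs_Ropp, Rabs_mult, (Rabs_pos_eq x) by lra. apply Rmult_le_compat_l; [lra|].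
    pose proof (Habs x (S n) ltac:(lra)) as A. pose proof (Habs (/ 2) (S n) ltac:(lra)) as A2.
    assert (A3 : ex_series (fun k => Rabs (u (S n + k)%nat * x ^ k))).
    { eapply ex_series_ext_R; [|exact A]. intros i. cbv beta. rewrite Rabs_mult, (Rabs_pos_eq (x ^ i)); auto. apply pow_le; lra. }
    eapply Rle_trans; [apply Series_Rabs; auto|]. unfold M. apply Series_le; auto.
    intros k. split; [apply Rabs_pos|]. rewrite Rabs_mult. apply Rmult_le_compat_l; [apply Rabs_pos|].
    rewrite Rabs_pos_eq by (apply pow_le; lra). apply pow_incr; lra. }
  destruct (Req_dec (u n) 0) as [|Hn]; auto. exfalso.
  assert (Hp : 0 < Rabs (u n)) by (apply Rabs_pos_lt; auto).
  assert (HM : 0 <= M).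
  { apply Series_nonneg; [|apply (Habs (/ 2) (S n)); lra]. intros i. apply Rmult_le_pos; [apply Rabs_pos|apply pow_le; lra]. }
  set (x := Rmin (/ 2) (Rabs (u n) / (2 * (M + 1)))).
  assert (Hx : 0 < x) by (apply Rmin_pos; [lra|apply Rdiv_lt_0_compat; lra]).
  pose proof (Hu x (conj Hx (Rmin_l _ _))) as B.
  assert (x * M <= Rabs (u n) / 2).
  { apply Rle_trans with (Rabs (u n) / (2 * (M + 1)) * (M + 1)).
    - apply Rmult_le_compat; try lra. apply Rmin_r.
    - right. field. lra. }
  lra.
Qed.

Lemma qterm_real b x n : qterm b (RtoC x) n = RtoC (b n * exp (- x) ^ n).
Proof.
  unfold qterm. rewrite RtoC_mult. f_equal.
  replace (- (INR n * x))%C with (INR n * RtoC (- x))%C by (rewrite RtoC_opp; ring).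
  rewrite Cexp_INR, Cexp_RtoC. apply Cpow_RtoC.
Qed.

Lemma qterm_unique b d :
  (forall x, 0 < x -> summ (qterm b x) /\ summ (qterm d x) /\ CSer (qterm b x) = CSer (qterm d x)) ->
  forall n, b n = d n.
Proof.
  intros H n. assert (E : b n - d n = 0); [|lra].
  apply (series_zero_coef (fun n => b n - d n)). intros q Hq.
  assert (Hx : 0 < - ln q) by (pose proof (ln_increasing q 1); rewrite ln_1 in *; lra).
  destruct (H _ Hx) as [H1 [H2 H3]].
  assert (Eq : exp (- - ln q) = q) by (rewrite Ropp_involutive; apply exp_ln; lra).
  assert (S1 : summ (fun n => qterm b (- ln q)%R n - qterm d (- ln q)%R n)%C) by (apply summ_minus; auto).
  assert (Et : forall n, (qterm b (- ln q)%R n - qterm d (- ln q)%R n)%C = RtoC ((b n - d n) * q ^ n)).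
  { intros i. rewrite !qterm_real, Eq, <- RtoC_minus. f_equal. ring. }
  split.
  - unfold summ in S1. eapply ex_series_ext_R; [|exact S1]. intros i. cbv beta.
    rewrite Et, Cmod_R, Rabs_mult, (Rabs_pos_eq (q ^ i)); auto. apply pow_le; lra.
  - apply RtoC_inj. rewrite <- RtoC_series, <- (CSer_ext _ _ Et), CSer_minus, H3 by auto. ring.
Qed.

Lemma cder_qseries b z : coefs b -> 0 < Re z ->
  cder (fun w => CSer (qterm b w)) z (- CSer (qterm (fun n => INR n * b n)%R z))%C.
Proof.
  intros Hb Hz. set (r := Re z). assert (Hr : 0 < r) by exact Hz.
  assert (Hb1 : coefs (fun n => INR n * b n)) by (apply coefs_INR; auto).
  apply cder_eq with (CSer (fun n => - (1) * qterm (fun n => INR n * b n)%R z n)%C).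
  { rewrite CSer_scal by (apply qterm_summ; auto). ring. }
  apply (cder_series (fun n w => qterm b w n) (fun n w => - (1) * qterm (fun n => INR n * b n)%R w n)%C z
    (fun n => 3 * (Rabs (INR n * (INR n * b n)) * exp (- (INR n * (r / 2))))) (r / 2)).
  - lra.
  - intros h Hh. apply qterm_summ; auto. rewrite Re_Cplus. pose proof (re_le_Cmod h) as Hre.
    apply Rabs_le_between in Hre. fold r. lra.
  - apply summ_scal, qterm_summ; auto.
  - intros n h Hh. pose proof (pos_INR n) as Hn.
    replace (qterm b (z + h) n - qterm b z n - h * (- (1) * qterm (fun n => INR n * b n)%R z n))%C
      with (qterm b z n * (Cexp (- (INR n * h)) - 1 - - (INR n * h)))%C.
    2: { unfold qterm. replace (- (INR n * (z + h)))%C with (- (INR n * z) + - (INR n * h))%C by ring.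
         rewrite Cexp_plus, RtoC_mult. ring. }
    rewrite Cmod_mult, Cmod_qterm. fold r.
    pose proof (Cexp_quad (- (INR n * h))%C) as Q. rewrite Cmod_opp, Cmod_mult, Cmod_R, (Rabs_pos_eq (INR n)) in Q by lra.
    pose proof (Cmod_ge_0 h). pose proof (Rabs_pos (b n)).
    assert (He : exp (INR n * Cmod h) <= exp (INR n * (r / 2))) by (apply exp_le_mono, Rmult_le_compat_l; lra).
    rewrite !Rabs_mult, (Rabs_pos_eq (INR n)) by lra.
    apply Rle_trans with (Rabs (b n) * exp (- (INR n * r)) * (3 * (INR n * Cmod h) ^ 2 * exp (INR n * (r / 2)))).
    + apply Rmult_le_compat_l; [apply Rmult_le_pos; [lra|left; apply exp_pos]|].
      eapply Rle_trans; [apply Q|]. apply Rmult_le_compat_l; auto.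
      pose proof (pow2_ge_0 (INR n * Cmod h)). lra.
    + right. replace (exp (- (INR n * (r / 2)))) with (exp (- (INR n * r)) * exp (INR n * (r / 2))).
      * ring.
      * rewrite <- exp_plus. f_equal. field.
  - apply ex_series_Rmult_l. apply (coefs_INR _ Hb1). lra.
  - intros n. apply Rmult_le_pos; [lra|]. apply Rmult_le_pos; [apply Rabs_pos|left; apply exp_pos].
Qed.

(** Coefficients after the substitution of [q ^ c] for [q]. *)
Definition scale (c : nat) (b : nat -> R) (n : nat) : R :=
  if (n mod c =? 0)%nat then b (n / c)%nat else 0.

Lemma scale_csum (c : nat) b z N : (1 <= c)%nat ->
  csum (qterm (scale c b) z) (c * N) = csum (qterm b (INR c * z)%C) N.
Proof.
  intros Hc. induction N; [rewrite Nat.mul_0_r; auto|].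
  replace (c * S N)%nat with (c * N + c)%nat by lia. rewrite csum_add, IHN.
  simpl csum at 3. f_equal. destruct c as [|c]; [lia|].
  rewrite csum_S_l. rewrite (csum_ext _ (fun _ => 0 * 0)%C).
  - rewrite csum_scal, Cmult_0_l, Cplus_0_r. unfold qterm, scale.
    rewrite Nat.add_0_r, Nat.mul_comm, Nat.Div0.mod_mul, Nat.eqb_refl, Nat.div_mul by lia.
    rewrite mult_INR, RtoC_mult. do 2 f_equal. ring.
  - intros k Hk. unfold qterm, scale.
    replace ((S c * N + S k) mod S c =? 0)%nat with false; [ring|].
    symmetry. apply Nat.eqb_neq. rewrite (Nat.mul_comm (S c)), Nat.add_comm, Nat.Div0.mod_add, Nat.mod_small by lia. lia.
Qed.

Lemma scale_le c b n : (1 <= c)%nat -> (forall n, 0 <= b n <= b (S n)) -> 0 <= scale c b n <= b n.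
Proof.
  intros Hc Hb. unfold scale. destruct (n mod c =? 0)%nat; [|specialize (Hb n); lra].
  assert (Hm : forall i j, (i <= j)%nat -> b i <= b j).
  { intros i j Hij. induction Hij; [lra|]. pose proof (Hb m). lra. }
  split; [apply Hb|]. apply Hm. apply Nat.Div0.div_le_upper_bound; nia.
Qed.

Lemma scale_ser c b z : (1 <= c)%nat -> coefs b -> coefs (scale c b) -> 0 < Re z ->
  CSer (qterm (scale c b) z) = CSer (qterm b (INR c * z)%C).
Proof.
  intros Hc Hb Hs Hz.
  assert (Hcz : 0 < Re (INR c * z)%C).
  { rewrite Re_RtoC_mult. apply Rmult_lt_0_compat; auto. apply lt_0_INR; lia. }
  symmetry. apply CSer_unique; [apply qterm_summ; auto|].
  intros eps Heps. destruct (CSer_correct _ (qterm_summ (scale c b) z Hs Hz) eps Heps) as [N HN].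
  exists N. intros n Hn. rewrite <- (scale_csum c) by auto. apply HN. nia.
Qed.

Lemma coefs_le b d : (forall n, Rabs (b n) <= Rabs (d n)) -> coefs d -> coefs b.
Proof.
  intros H Hd r Hr. eapply ex_series_le_R; [|apply (Hd r Hr)]. intros n. split.
  - apply Rmult_le_pos; [apply Rabs_pos|left; apply exp_pos].
  - apply Rmult_le_compat_r; auto. left; apply exp_pos.
Qed.

(** A partial sum over a multiple of [c] terms is a partial sum of the original series at [c r], so
    the partial sums are bounded. *)
Lemma scale_coefs c b : (1 <= c)%nat -> coefs b -> coefs (scale c b).
Proof.
  intros Hc Hb r Hr.
  set (a := fun n => Rabs (scale c b n) * exp (- (INR n * r))).
  set (M := Series (fun n => Rabs (b n) * exp (- (INR n * (INR c * r))))).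
  assert (Hcr : 0 < INR c * r) by (apply Rmult_lt_0_compat; auto; apply lt_0_INR; lia).
  assert (Pa : forall n, 0 <= a n) by (intros; apply Rmult_le_pos; [apply Rabs_pos|left; apply exp_pos]).
  assert (E : forall N, sum_f_R0 a N <= M).
  { intros N.
    assert (HN : forall m, Re (csum (qterm (fun n => Rabs (scale c b n)) r) (S m)) = sum_f_R0 a m).
    { intros m. rewrite csum_Re. apply sum_eq. intros i _. unfold qterm, a. rewrite Re_RtoC_mult. f_equal.
      unfold Cexp. replace (- (INR i * r))%C with (RtoC (- (INR i * r))) by (rewrite RtoC_opp, RtoC_mult; auto).
      simpl. rewrite cos_0. ring. }
    assert (Hmono : forall m m', (m <= m')%nat -> sum_f_R0 a m <= sum_f_R0 a m').
    { intros m m' Hm. induction Hm; [lra|]. rewrite tech5. pose proof (Pa (S m0)). lra. }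
    apply Rle_trans with (sum_f_R0 a (c * S N - 1)); [apply Hmono; nia|].
    rewrite <- HN. replace (S (c * S N - 1)) with (c * S N)%nat by nia.
    rewrite (csum_ext _ (qterm (scale c (fun n => Rabs (b n))) r)).
    2: { intros k _. unfold qterm, scale. destruct (k mod c =? 0)%nat; auto. rewrite Rabs_R0. auto. }
    rewrite scale_csum by auto. rewrite csum_Re.
    rewrite (sum_eq _ (fun n => Rabs (b n) * exp (- (INR n * (INR c * r))))).
    - apply (sum_f_R0_le_Series (fun n => Rabs (b n) * exp (- (INR n * (INR c * r))))); [|apply Hb; auto].
      intros; apply Rmult_le_pos; [apply Rabs_pos|left; apply exp_pos].
    - intros i _. unfold qterm. rewrite Re_RtoC_mult. f_equal.
      unfold Cexp. replace (- (INR i * (INR c * r)))%C with (RtoC (- (INR i * (INR c * r)))) by (rewrite RtoC_opp, !RtoC_mult; auto).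
      simpl. rewrite cos_0. ring. }
  assert (Hgrow : ex_finite_lim_seq (sum_n a)).
  { apply ex_finite_lim_seq_incr with M.
    - intros n. rewrite !sum_n_Reals. simpl. pose proof (Pa (S n)). simpl in *. lra.
    - intros n. rewrite sum_n_Reals. apply E. }
  destruct Hgrow as [l Hl]. exists l. exact Hl.
Qed.

Lemma coefs_INR_id : coefs INR.
Proof.
  eapply coefs_le; [|apply (coefs_INR _ (coefs_const 1))]. intros n. cbv beta. rewrite Rmult_1_r. lra.
Qed.

(** Shifting the index gives [G = 1 + q G] for the geometric series and [I = q (I + G)] for the
    series of [n q ^ n]; both are solved algebraically. *)
Lemma cphi_qseries w : 0 < Re w -> CSer (qterm INR w) = cphi w.
Proof.
  intros Hw. assert (C1 : coefs (fun _ => 1)) by apply coefs_const.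
  pose proof coefs_INR_id as CI.
  set (q := Cexp (- w)). assert (Hq : (Cexp w = / q)%C) by (unfold q; rewrite Cexp_opp; field; apply Cexp_neq_0).
  assert (Hq0 : q <> 0) by apply Cexp_neq_0.
  assert (Hq1 : (1 - q)%C <> 0).
  { apply Cmod_gt_0. unfold q. pose proof (Cmod_triangle_inv 1 (- Cexp (- w))) as H.
    rewrite Cmod_opp, Cmod_1, Cmod_Cexp in H. change (Re (- w)%C) with (- Re w) in H.
    pose proof (exp_neg_lt1 _ Hw). unfold Cminus. lra. }
  assert (Sh : forall b n, qterm b w (S n) = (q * qterm (fun n => b (S n)) w n)%C).
  { intros b n. unfold qterm, q. rewrite RtoC_S.
    replace (- ((1 + INR n) * w))%C with (- w + - (INR n * w))%C by ring. rewrite Cexp_plus. ring. }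
  set (G := CSer (qterm (fun _ => 1) w)).
  assert (EG : G = (1 + q * G)%C).
  { unfold G at 1. rewrite (CSer_incr _ 1) by (apply qterm_summ; auto). simpl csum.
    rewrite (CSer_ext _ (fun n => q * qterm (fun _ => 1) w n)%C) by (intros; apply (Sh (fun _ => 1))).
    rewrite CSer_scal by (apply qterm_summ; auto). fold G. unfold qterm. simpl INR.
    replace (- (0 * w))%C with (RtoC 0) by ring. rewrite Cexp_0. ring. }
  assert (EI : CSer (qterm INR w) = (q * (CSer (qterm INR w) + G))%C).
  { rewrite (CSer_incr (qterm INR w) 1) at 1 by (apply qterm_summ; auto). simpl csum.
    rewrite (CSer_ext _ (fun n => q * (qterm INR w n + qterm (fun _ => 1) w n))%C).
    - rewrite CSer_scal, CSer_plus by (try apply summ_plus; apply qterm_summ; auto). fold G. unfold qterm. simpl INR. ring.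
    - intros n. simpl plus. rewrite Sh. f_equal. unfold qterm. rewrite RtoC_S. ring. }
  assert (EG' : G = (/ (1 - q))%C).
  { transitivity ((G - q * G) / (1 - q))%C; [field; auto|]. rewrite EG at 1. field. auto. }
  set (I := CSer (qterm INR w)) in *.
  transitivity ((I - q * I) / (1 - q))%C; [field; auto|].
  rewrite EI at 1. rewrite EG'. unfold cphi. rewrite Hq. field. auto.
Qed.

(** The divisor sum of [n]: the term of index [j] is [n / (j + 1)] if [j + 1] divides [n] and 0
    otherwise, so only finitely many terms are nonzero. *)
Definition sigma (n : nat) : R := Series (fun j => scale (S j) INR n).

Lemma scale_INR_bound j n : 0 <= scale (S j) INR n <= INR n /\ (scale (S j) INR n <> 0 -> (S j <= n)%nat).
Proof.
  split.
  - apply scale_le; [lia|]. intros k. pose proof (pos_INR k). rewrite S_INR. lra.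
  - unfold scale. destruct (n mod S j =? 0)%nat eqn:E; [|lra]. intros H.
    apply Nat.eqb_eq in E. destruct (Nat.le_gt_cases (S j) n); auto.
    exfalso. apply H. rewrite Nat.div_small by lia. reflexivity.
Qed.

Lemma cS_qseries : coefs sigma /\ forall z, 0 < Re z -> CSer (qterm sigma z) = cS z.
Proof.
  (* A nonzero term has [j + 1 <= n]. The decay [r] in [n] is split: [r / 2] absorbs the factor [n],
     [r / 4] is converted into decay in [j], and [r / 4] is kept. *)
  assert (Bd : forall r, 0 < r -> exists K, 0 <= K /\ forall j n,
    scale (S j) INR n * exp (- (INR n * r)) <= exp (- (INR (S j) * (r / 4))) * (K * exp (- (INR n * (r / 4))))).
  { intros r Hr. exists (2 / r). split; [left; apply Rdiv_lt_0_compat; lra|]. intros j n.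
    destruct (scale_INR_bound j n) as [[H1 H2] H3].
    pose proof (exp_pos (- (INR n * r))). pose proof (exp_pos (- (INR (S j) * (r / 4)))). pose proof (exp_pos (- (INR n * (r / 4)))).
    assert (0 < 2 / r) by (apply Rdiv_lt_0_compat; lra).
    destruct (Req_dec (scale (S j) INR n) 0) as [-> | Hn].
    - rewrite Rmult_0_l. repeat apply Rmult_le_pos; lra.
    - specialize (H3 Hn). apply le_INR in H3.
      apply Rle_trans with (INR n * exp (- (INR n * r))); [apply Rmult_le_compat_r; lra|].
      pose proof (pos_INR n) as Pn.
      replace (exp (- (INR n * r))) with (exp (- (INR n * (r / 2))) * (exp (- (INR n * (r / 4))) * exp (- (INR n * (r / 4)))))
        by (rewrite <- !exp_plus; f_equal; field).
      assert (Hk : INR n * exp (- (INR n * (r / 2))) <= 2 / r).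
      { eapply Rle_trans; [apply mul_exp_neg_le; lra|]. right. field. lra. }
      assert (Hj : exp (- (INR n * (r / 4))) <= exp (- (INR (S j) * (r / 4)))) by (apply exp_le_mono; nra).
      set (e1 := exp (- (INR n * (r / 2)))) in *. set (e2 := exp (- (INR n * (r / 4)))) in *.
      set (e3 := exp (- (INR (S j) * (r / 4)))) in *.
      replace (INR n * (e1 * (e2 * e2))) with (e2 * ((INR n * e1) * e2)) by ring.
      assert (0 < e1) by apply exp_pos.
      apply Rmult_le_compat; auto; try lra.
      + apply Rmult_le_pos; [apply Rmult_le_pos|]; lra.
      + apply Rmult_le_compat_r; lra. }
  assert (F : forall z, 0 < Re z ->
    (forall n, CSer (fun j => qterm (scale (S j) INR) z n) = qterm sigma z n) /\
    summ (fun n => CSer (fun j => qterm (scale (S j) INR) z n)) /\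
    CSer (fun n => CSer (fun j => qterm (scale (S j) INR) z n)) = cS z).
  { intros z Hz. destruct (Bd (Re z) Hz) as [K [HK HB]].
    destruct (series_fubini (fun j n => qterm (scale (S j) INR) z n)
      (fun j => exp (- (INR (S j) * (Re z / 4)))) (fun n => K * exp (- (INR n * (Re z / 4))))) as [F1 [F2 [_ [F4 F5]]]].
    - intros j n. rewrite Cmod_qterm, Rabs_pos_eq by apply scale_INR_bound. apply HB.
    - apply ex_series_exp. lra.
    - apply ex_series_Rmult_l. apply (ex_series_incr_1 (fun n => exp (- (INR n * (Re z / 4))))).
      apply ex_series_exp. lra.
    - intros; left; apply exp_pos.
    - intros; apply Rmult_le_pos; auto. left; apply exp_pos.
    - split; [|split]; auto.
      + intros n. unfold qterm, sigma. 
        transitivity (Cexp (- (INR n * z)) * CSer (fun j => RtoC (scale (S j) INR n)))%C.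
        * rewrite <- CSer_scal; [apply CSer_ext; intros; ring|].
          apply summ_le with (fun j => exp (INR n * Re z) * (exp (- (INR (S j) * (Re z / 4))) * (K * exp (- (INR n * (Re z / 4)))))).
          -- intros j. rewrite Cmod_R, Rabs_pos_eq by apply scale_INR_bound.
             specialize (HB j n). apply Rmult_le_compat_l with (r := exp (INR n * Re z)) in HB; [|left; apply exp_pos].
             eapply Rle_trans; [|apply HB]. rewrite exp_Ropp. right. field. apply Rgt_not_eq, exp_pos.
          -- apply ex_series_Rmult_l, ex_series_scal_r, ex_series_exp. lra.
        * rewrite RtoC_series. ring.
      + rewrite F5. unfold cS. apply CSer_ext. intros j.
        rewrite <- cphi_qseries by (apply Re_INR_pos; auto).
        apply scale_ser; auto; [lia|apply coefs_INR_id|]. apply scale_coefs; [lia|apply coefs_INR_id]. }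
  split.
  - intros r Hr. destruct (F (RtoC r) Hr) as [F1 [F2 _]]. unfold summ in F2.
    eapply ex_series_ext_R; [|exact F2]. intros n. cbv beta. rewrite F1, Cmod_qterm. reflexivity.
  - intros z Hz. destruct (F z Hz) as [F1 [_ F3]]. rewrite <- F3. apply CSer_ext. intros; symmetry; apply F1.
Qed.

(** * The generating function as an exponential *)

Lemma CV_radius_ge_1 (a : nat -> R) (M : R) : (forall n, Rabs (a n) <= M) -> Rbar_le 1 (CV_radius a).
Proof.
  intros H. apply CV_radius_bounded. exists M. intros n. rewrite pow1, Rmult_1_r. apply H.
Qed.

(** The power series and [- ln (1 - t)] both vanish at 0 and have the geometric series as
    derivative. *)
Lemma ln_series u : 0 < u < 1 -> is_series (fun j => u ^ S j / INR (S j)) (- ln (1 - u)).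
Proof.
  intros Hu. set (a := PS_Int (fun _ => 1)).
  assert (Ha : Rbar_le 1 (CV_radius a)).
  { apply (CV_radius_ge_1 a 1). intros n. unfold a, PS_Int. destruct n; [rewrite Rabs_R0; lra|].
    rewrite Rabs_pos_eq.
    - unfold Rdiv. rewrite Rmult_1_l, <- Rinv_1. apply Rinv_le_contravar; [lra|].
      rewrite S_INR. pose proof (pos_INR n). lra.
    - left. apply Rdiv_lt_0_compat; [lra|apply INR_S_pos]. }
  assert (Hr : forall t, 0 <= t <= u -> Rbar_lt (Rabs t) (CV_radius a)).
  { intros t Ht. eapply Rbar_lt_le_trans; [|exact Ha]. simpl. rewrite Rabs_pos_eq; lra. }
  assert (E : PSeries a 0 + ln (1 - 0) = PSeries a u + ln (1 - u)).
  { apply (is_derive_0_const (fun t => PSeries a t + ln (1 - t))). intros t Ht.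
    rewrite Rmin_left, Rmax_right in Ht by lra.
    replace 0 with (plus (PSeries (PS_derive a) t) (- / (1 - t))).
    - apply (is_derive_plus (V := R_NormedModule)); [apply is_derive_PSeries, Hr; auto|].
      auto_derive; [lra|]. field. lra.
    - change (PSeries (PS_derive a) t + - / (1 - t) = 0).
      rewrite (PSeries_ext _ (fun _ => 1)).
      + unfold PSeries. rewrite (Series_ext _ (fun k => t ^ k)) by (intros; ring).
        rewrite Series_geom by (rewrite Rabs_pos_eq; lra). ring.
      + intros n. unfold PS_derive, a, PS_Int. field. apply Rgt_not_eq, INR_S_pos. }
  rewrite PSeries_0, Rminus_0_r, ln_1 in E. unfold a at 1 in E. simpl in E.
  assert (S1 : ex_series (fun n => a n * u ^ n)).
  { apply ex_series_Rabs, CV_disk_inside, Hr. lra. }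
  replace (- ln (1 - u)) with (PSeries a u) by lra.
  unfold PSeries. rewrite Series_incr_1 by auto. unfold a at 1. unfold PS_Int at 1. rewrite Rmult_0_l, Rplus_0_l.
  eapply is_series_ext; [|apply Series_correct; apply ex_series_incr_1 in S1; exact S1].
  intros n. unfold a, PS_Int. change (1 / INR (S n) * u ^ S n = u ^ S n / INR (S n)). unfold Rdiv. ring.
Qed.

(** Both sides sum the double series of [exp (- i j x) / j], in the two possible orders. The product
    majorant comes from [i + j <= 2 i j]. *)
Lemma LamR_lim (x : R) : 0 < x ->
  is_lim_seq (fun N => sum_f_R0 (fun i => - ln (1 - exp (- (INR (S i) * x)))) N) (LamR x).
Proof.
  intros Hx.
  set (t := fun j i => / INR (S j) * exp (- (INR (S i) * x)) ^ S j).
  assert (Pt : forall j i, 0 <= t j i).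
  { intros. apply Rmult_le_pos; [left; apply Rinv_0_lt_compat, INR_S_pos|]. apply pow_le. left; apply exp_pos. }
  assert (Hd : forall j i, t j i <= exp (- (INR (S j) * (x / 2))) * exp (- (INR (S i) * (x / 2)))).
  { intros j i. unfold t. rewrite exp_pow, <- exp_plus.
    assert (H1 : 1 <= INR (S j)) by apply INR_S_ge1.
    assert (H2 : 1 <= INR (S i)) by apply INR_S_ge1.
    assert (/ INR (S j) <= 1) by (rewrite <- Rinv_1; apply Rinv_le_contravar; lra).
    assert (exp (INR (S j) * - (INR (S i) * x)) <= exp (- (INR (S j) * (x / 2)) + - (INR (S i) * (x / 2)))).
    { apply exp_le_mono. set (J := INR (S j)) in *. set (I := INR (S i)) in *.
      assert (J + I <= 2 * (J * I)) by nra. nra. }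
    pose proof (exp_pos (INR (S j) * - (INR (S i) * x))). 
    assert (0 < / INR (S j)) by (apply Rinv_0_lt_compat; lra). nra. }
  destruct (series_fubini (fun j i => RtoC (t j i))
    (fun j => exp (- (INR (S j) * (x / 2)))) (fun i => exp (- (INR (S i) * (x / 2))))) as [F1 [F2 [F3 _]]].
  - intros j i. rewrite Cmod_R, Rabs_pos_eq; auto.
  - apply ex_series_exp; lra.
  - apply ex_series_exp; lra.
  - intros; left; apply exp_pos.
  - intros; left; apply exp_pos.
  - assert (Ei : forall i, CSer (fun j => RtoC (t j i)) = RtoC (- ln (1 - exp (- (INR (S i) * x))))).
    { intros i. rewrite RtoC_series. f_equal. apply is_series_unique.
      eapply is_series_ext; [|apply ln_series, exp_neg_lt1].
      - intros j. unfold t. apply Rmult_comm.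
      - apply Rmult_lt_0_compat; auto. apply INR_S_pos. }
    assert (Ej : forall j, CSer (fun i => RtoC (t j i)) = RtoC (/ INR (S j) * / (exp (INR (S j) * x) - 1))).
    { intros j. rewrite RtoC_series. f_equal. unfold t. rewrite Series_scal_l. f_equal.
      rewrite (Series_ext _ (fun i => exp (- (INR (S i) * (INR (S j) * x))))).
      - assert (Hj : 0 < INR (S j) * x) by (apply Rmult_lt_0_compat; auto; apply INR_S_pos).
        rewrite (proj2 (ex_series_exp _ Hj)), exp_Ropp.
        pose proof (exp_ineq1 (INR (S j) * x) ltac:(lra)). field. lra.
      - intros i. rewrite exp_pow. f_equal. ring. }
    rewrite (CSer_ext _ _ Ej), RtoC_series in F3. fold (LamR x) in F3.
    apply clim_Re in F3. rewrite Re_RtoC in F3.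
    apply is_lim_seq_incr_1 in F3. eapply is_lim_seq_ext; [|exact F3].
    intros n. cbv beta. rewrite csum_Re. apply sum_eq. intros i _. rewrite Ei. reflexivity.
Qed.

Lemma exp_neg_pow x c i : exp (- x) ^ (c * S i) = exp (- (INR (S i) * (INR c * x))).
Proof.
  rewrite exp_pow, mult_INR. f_equal. ring.
Qed.

Lemma product_eq_exp (k : nat) (x : R) N : 0 < x ->
  let L c := sum_f_R0 (fun i => - ln (1 - exp (- (INR (S i) * (INR c * x))))) N in
  prod_f_R0 (fun i => diamond_factor k (exp (- x)) (S i)) N =
  exp (3 * L 1%nat + L (4 * k + 2)%nat - L 2%nat - L (2 * k + 1)%nat).
Proof.
  intros Hx.
  assert (F : forall i, let l c := - ln (1 - exp (- (INR (S i) * (INR c * x)))) in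
    diamond_factor k (exp (- x)) (S i) = exp (3 * l 1%nat + l (4 * k + 2)%nat - l 2%nat - l (2 * k + 1)%nat)).
  { intros i l. unfold diamond_factor.
    replace (exp (- x) ^ S i) with (exp (- x) ^ (1 * S i)) by (f_equal; lia).
    rewrite !exp_neg_pow.
    assert (P : forall c, (1 <= c)%nat -> exp (l c) = / (1 - exp (- (INR (S i) * (INR c * x)))) /\
      0 < 1 - exp (- (INR (S i) * (INR c * x)))).
    { intros c Hc. assert (0 < INR (S i) * (INR c * x)).
      { apply Rmult_lt_0_compat; [apply INR_S_pos|]. apply Rmult_lt_0_compat; auto. apply lt_0_INR; lia. }
      pose proof (exp_neg_lt1 _ H). split; [|lra]. unfold l. rewrite exp_Ropp, exp_ln by lra. auto. }
    replace (3 * l 1%nat + l (4 * k + 2)%nat - l 2%nat - l (2 * k + 1)%nat) with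
      (l 1%nat + l 1%nat + l 1%nat + l (4 * k + 2)%nat + - l 2%nat + - l (2 * k + 1)%nat) by ring.
    rewrite !exp_plus, (exp_Ropp (l 2%nat)), (exp_Ropp (l (2 * k + 1)%nat)).
    destruct (P 1%nat ltac:(lia)) as [-> P1]. destruct (P 2%nat ltac:(lia)) as [-> P2].
    destruct (P (4 * k + 2)%nat ltac:(lia)) as [-> P3]. destruct (P (2 * k + 1)%nat ltac:(lia)) as [-> P4].
    field. lra. }
  induction N as [|N IH]; intros L.
  - simpl prod_f_R0. rewrite F. reflexivity.
  - change (prod_f_R0 (fun i => diamond_factor k (exp (- x)) (S i)) (S N)) with
      (prod_f_R0 (fun i => diamond_factor k (exp (- x)) (S i)) N * diamond_factor k (exp (- x)) (S (S N))).
    rewrite IH, F, <- exp_plus. f_equal. unfold L. rewrite !tech5. ring.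
Qed.

Lemma exp_continuity_seq u l : is_lim_seq u (Finite l) -> is_lim_seq (fun n => exp (u n)) (exp l).
Proof.
  intros H. apply (is_lim_seq_continuous exp); auto. apply derivable_continuous_pt, derivable_pt_exp.
Qed.

(** Plain convergence at the larger point [exp (- r / 2)] bounds the terms there; a geometric factor
    then gives absolute convergence at [exp (- r)]. *)
Lemma coefs_of_is_broken_diamond k Delta : is_broken_diamond k Delta -> coefs Delta.
Proof.
  intros H r Hr. set (q := exp (- (r / 2))). pose proof (exp_neg_lt1 (r / 2) ltac:(lra)) as Hq. fold q in Hq.
  destruct (H q) as [l [_ Hl]]; [rewrite Rabs_pos_eq; lra|].
  assert (H0 : is_lim_seq (fun n => Delta n * q ^ n) 0) by (apply ex_series_lim_0; exists l; auto).
  assert (Hb : exists M, 0 <= M /\ forall n, Rabs (Delta n * q ^ n) <= M).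
  { destruct (filterlim_bounded (fun n => Delta n * q ^ n)) as [M HM].
    - exists 0. exact H0.
    - exists M. split; [|exact HM]. eapply Rle_trans; [apply Rabs_pos|apply (HM 0%nat)]. }
  destruct Hb as [M [HM Hb]].
  apply ex_series_le_R with (fun n => M * exp (- (INR n * (r / 2)))).
  - intros n. split; [apply Rmult_le_pos; [apply Rabs_pos|left; apply exp_pos]|].
    assert (E : q ^ n = exp (- (INR n * (r / 2)))).
    { unfold q. rewrite exp_pow. f_equal. ring. }
    specialize (Hb n). rewrite E, Rabs_mult, (Rabs_pos_eq (exp _)) in Hb by (left; apply exp_pos).
    replace (exp (- (INR n * r))) with (exp (- (INR n * (r / 2))) * exp (- (INR n * (r / 2)))) by (rewrite <- exp_plus; f_equal; field).
    rewrite <- Rmult_assoc. apply Rmult_le_compat_r; auto. left; apply exp_pos.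
  - apply ex_series_Rmult_l. apply (ex_series_incr_1 (fun n => exp (- (INR n * (r / 2))))).
    apply ex_series_exp. lra.
Qed.

Lemma LamF_RtoC s x : 0 < s -> 0 < x ->
  LamF s x = RtoC (3 * LamR x + LamR (2 * s * x) - LamR (2 * x) - LamR (s * x)).
Proof.
  intros Hs Hx. unfold LamF. rewrite <- !RtoC_mult, !Lam_RtoC by (repeat apply Rmult_lt_0_compat; lra).
  rewrite !RtoC_minus, RtoC_plus, RtoC_mult. auto.
Qed.

Lemma broken_diamond_real k Delta x : is_broken_diamond k Delta -> 0 < x ->
  CSer (qterm Delta x) = Cexp (LamF (INR (2 * k + 1)) x).
Proof.
  intros H Hx. pose proof (exp_neg_lt1 x Hx) as Hq.
  destruct (H (exp (- x))) as [l [Hl1 Hl2]]; [rewrite Rabs_pos_eq; lra|].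
  assert (Hs : 0 < INR (2 * k + 1)) by (apply lt_0_INR; lia).
  rewrite LamF_RtoC, Cexp_RtoC by auto.
  rewrite (CSer_ext _ (fun n => RtoC (Delta n * exp (- x) ^ n))) by (intros; apply qterm_real).
  rewrite RtoC_series, (is_series_unique _ _ Hl2). f_equal.
  assert (G : is_lim_seq (fun N => prod_f_R0 (fun i => diamond_factor k (exp (- x)) (S i)) N)
    (exp (3 * LamR x + LamR (2 * INR (2 * k + 1) * x) - LamR (2 * x) - LamR (INR (2 * k + 1) * x)))).
  { eapply is_lim_seq_ext; [intros n; symmetry; apply product_eq_exp; auto|].
    apply exp_continuity_seq.
    assert (LL : forall c, (1 <= c)%nat ->
      is_lim_seq (fun N => sum_f_R0 (fun i => - ln (1 - exp (- (INR (S i) * (INR c * x))))) N) (LamR (INR c * x))).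
    { intros c Hc. apply LamR_lim. apply Rmult_lt_0_compat; auto. apply lt_0_INR; lia. }
    apply is_lim_seq_minus'; [apply is_lim_seq_minus'; [apply is_lim_seq_plus'|]|].
    - apply (is_lim_seq_scal_l _ 3 (LamR x)).
      replace (LamR x) with (LamR (INR 1 * x)) by (f_equal; simpl; ring). apply LL. lia.
    - replace (2 * INR (2 * k + 1)) with (INR (4 * k + 2)); [apply LL; lia|].
      replace (4 * k + 2)%nat with (2 * (2 * k + 1))%nat by lia. rewrite mult_INR. reflexivity.
    - apply (LL 2%nat). lia.
    - apply LL. lia. }
  apply is_lim_seq_unique in Hl1. apply is_lim_seq_unique in G. rewrite Hl1 in G. injection G; auto.
Qed.

Lemma CSer_qterm_plus b d z : coefs b -> coefs d -> 0 < Re z ->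
  CSer (qterm (fun n => b n + d n) z) = (CSer (qterm b z) + CSer (qterm d z))%C.
Proof.
  intros Hb Hd Hz. rewrite <- CSer_plus by (apply qterm_summ; auto). apply CSer_ext. intros n.
  unfold qterm. rewrite RtoC_plus. ring.
Qed.

Lemma CSer_qterm_scal c b z : coefs b -> 0 < Re z ->
  CSer (qterm (fun n => c * b n) z) = (c * CSer (qterm b z))%C.
Proof.
  intros Hb Hz. rewrite <- CSer_scal by (apply qterm_summ; auto). apply CSer_ext. intros n.
  unfold qterm. rewrite RtoC_mult. ring.
Qed.

(** A complex derivative at a real point is determined by the restriction to the real axis, so
    functions known to agree only there have equal derivatives there. *)
Lemma cder_real_unique (f g : C -> C) (x : R) a b : 0 < x ->
  (forall y : R, 0 < y -> f y = g y) -> cder f x a -> cder g x b -> a = b.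
Proof.
  intros Hx E Hf Hg.
  assert (Ex : (0 + x * 1)%C = x) by ring.
  rewrite <- Ex in Hf, Hg. apply cder_line in Hf, Hg. destruct Hf as [F1 F2]. destruct Hg as [G1 G2].
  assert (Loc : locally x (fun t : R => f (0 + t * 1)%C = g (0 + t * 1)%C)).
  { exists (mkposreal x Hx). intros t Ht. replace (0 + t * 1)%C with (RtoC t) by ring. apply E.
    change (Rabs (t - x) < x) in Ht. apply Rabs_lt_between in Ht. lra. }
  rewrite Cmult_1_l in *. apply C_eq.
  - apply (is_derive_ext_loc _ (fun t : R => Re (g (0 + t * 1)%C))) in F1.
    + apply is_derive_unique in F1. apply is_derive_unique in G1. congruence.
    + apply (filter_imp (fun t : R => f (0 + t * 1)%C = g (0 + t * 1)%C)); auto. intros t ->; auto.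
  - apply (is_derive_ext_loc _ (fun t : R => Im (g (0 + t * 1)%C))) in F2.
    + apply is_derive_unique in F2. apply is_derive_unique in G2. congruence.
    + apply (filter_imp (fun t : R => f (0 + t * 1)%C = g (0 + t * 1)%C)); auto. intros t ->; auto.
Qed.

Lemma cder_LamF s z : 0 < s -> 0 < Re z ->
  cder (LamF s) z (- (3 * cS z + (2 * s)%R * cS ((2 * s)%R * z) - 2 * cS (2 * z) - s * cS (s * z)))%C.
Proof.
  intros Hs Hz.
  assert (D : forall c : R, 0 < c -> cder (fun w => Lam (c * w)%C) z (c * - cS (c * z))%C).
  { intros c Hc. eapply cder_eq; [|apply (cder_comp Lam (fun w => c * w)%C); [apply cder_Lam|apply cder_scal, cder_id]].
    - ring.
    - rewrite Re_RtoC_mult. nra. }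
  unfold LamF. eapply cder_eq; [|apply cder_minus; [apply cder_minus; [apply cder_plus|]|]].
  2: apply cder_scal, cder_Lam; auto.
  2: apply (D (2 * s)); lra.
  2: apply (D 2); lra.
  2: apply (D s); lra.
  ring.
Qed.

(* Both sides solve the same first order equation: the coefficient recursion read off on the
   positive axis is what carries it to the half-plane. *)
Lemma broken_diamond_Cexp k Delta z : is_broken_diamond k Delta -> 0 < Re z ->
  CSer (qterm Delta z) = Cexp (LamF (INR (2 * k + 1)) z).
Proof.
  intros H Hz. set (c := (2 * k + 1)%nat). set (s := INR c).
  assert (Hc : (1 <= c)%nat) by (unfold c; lia).
  assert (Hs : 0 < s) by (apply lt_0_INR; lia).
  pose proof (coefs_of_is_broken_diamond k Delta H) as HD.
  destruct cS_qseries as [Csig Esig].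
  (* Coefficients of minus the logarithmic derivative of the product in [z]: each factor contributes
     divisor sums rescaled by its exponent. *)
  set (b := fun n => ((3 * sigma n + 2 * s * scale (2 * c) sigma n) + (-2) * scale 2 sigma n) + (- s) * scale c sigma n).
  assert (C1 : forall m, (1 <= m)%nat -> coefs (scale m sigma)) by (intros; apply scale_coefs; auto).
  assert (K1 : coefs (fun n => 3 * sigma n)) by (apply coefs_scal; auto).
  assert (K2 : coefs (fun n => 2 * s * scale (2 * c) sigma n)) by (apply coefs_scal, C1; lia).
  assert (K3 : coefs (fun n => (-2) * scale 2 sigma n)) by (apply coefs_scal, C1; lia).
  assert (K4 : coefs (fun n => (- s) * scale c sigma n)) by (apply coefs_scal, C1; lia).
  assert (Hb : coefs b) by (unfold b; repeat apply coefs_plus; auto).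
  assert (Eb : forall z, 0 < Re z -> CSer (qterm b z) =
    (3 * cS z + (2 * s)%R * cS ((2 * s)%R * z) - 2 * cS (2 * z) - s * cS (s * z))%C).
  { intros w Hw. unfold b.
    rewrite CSer_qterm_plus by (repeat apply coefs_plus; auto).
    rewrite CSer_qterm_plus by (repeat apply coefs_plus; auto).
    rewrite CSer_qterm_plus by auto.
    rewrite !CSer_qterm_scal by (try apply C1; auto; lia).
    rewrite !scale_ser by (try apply C1; auto; lia).
    rewrite !Esig by (auto; rewrite Re_RtoC_mult; apply Rmult_lt_0_compat; auto; apply lt_0_INR; lia).
    fold s. replace (INR (2 * c)) with (2 * s) by (unfold s; rewrite mult_INR; reflexivity).
    replace (INR 2) with 2 by reflexivity. rewrite !RtoC_opp. 
    replace (RtoC (-2)) with (- RtoC 2)%C by (rewrite <- RtoC_opp; auto). ring. }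
  set (Hf := fun w => CSer (qterm Delta w)). set (Ef := fun w => Cexp (LamF s w)).
  assert (R0 : forall y : R, 0 < y -> Hf y = Ef y) by (intros; apply broken_diamond_real; auto).
  assert (Rec : forall n, INR n * Delta n = conv b Delta n).
  { apply qterm_unique. intros x Hx. destruct (conv_summ b Delta x Hb HD Hx) as [V1 V2].
    split; [|split]; auto.
    - apply qterm_summ; auto. apply coefs_INR; auto.
    - rewrite V2.
      pose proof (cder_qseries Delta x HD Hx) as D1.
      pose proof (cder_Cexp_comp _ _ _ (cder_LamF s x Hs Hx)) as D2.
      pose proof (cder_real_unique Hf Ef x _ _ Hx R0 D1 D2) as U.
      rewrite <- (Eb x Hx) in U. fold (Ef x) in U. rewrite <- (R0 x Hx) in U. unfold Hf in U.
      match goal with |- ?a = _ => transitivity (- - a)%C; [ring|] end. rewrite U. ring. }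
  assert (Const : (Hf z * Cexp (- LamF s z) = Hf (RtoC 1) * Cexp (- LamF s (RtoC 1)))%C).
  { apply (cder_0_const (fun w => Hf w * Cexp (- LamF s w))%C); auto; [simpl; lra|].
    intros w Hw.
    assert (Dm : cder (fun w => - LamF s w)%C w (- (1) * - CSer (qterm b w))%C).
    { apply (cder_ext (fun w => - (1) * LamF s w)%C _ _ _ 1); [lra|intros; ring|].
      apply cder_scal. rewrite Eb by auto. apply cder_LamF; auto. }
    eapply cder_eq; [|apply cder_mult; [apply (cder_qseries Delta w HD Hw)|apply cder_Cexp_comp, Dm]].
    cbv beta.
    replace (CSer (qterm (fun n => INR n * Delta n)%R w)) with (CSer (qterm b w) * Hf w)%C; [ring|].
    unfold Hf. rewrite <- (proj2 (conv_summ b Delta w Hb HD Hw)). apply CSer_ext. intros n. unfold qterm. rewrite <- Rec. auto. }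
  rewrite (R0 1 Rlt_0_1) in Const. unfold Ef in Const. rewrite <- Cexp_plus in Const.
  replace (LamF s (RtoC 1) + - LamF s (RtoC 1))%C with (RtoC 0) in Const by ring. rewrite Cexp_0 in Const.
  rewrite Cexp_opp in Const. pose proof (Cexp_neq_0 (LamF s z)).
  change (Hf z = Cexp (LamF s z)). transitivity (Hf z * / Cexp (LamF s z) * Cexp (LamF s z))%C; [field; auto|].
  rewrite Const. ring.
Qed.

(** * Gamma at integers and the modified Bessel function of order two *)

(** The primitive of [t ^ n * exp (- t)] that vanishes at infinity, obtained by repeated integration
    by parts. *)
Fixpoint gamma_prim (n : nat) (t : R) : R :=
  match n with
  | O => - exp (- t)
  | S p => - (exp (- t) * t ^ S p) + INR (S p) * gamma_prim p t
  end.

Lemma is_derive_gamma_prim n t : is_derive (gamma_prim n) t (t ^ n * exp (- t)).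
Proof.
  induction n.
  - simpl. auto_derive; auto. ring.
  - replace (t ^ S n * exp (- t)) with
      (plus (exp (- t) * t ^ S n - exp (- t) * (INR (S n) * t ^ n)) (INR (S n) * (t ^ n * exp (- t)))).
    2: { change (exp (- t) * t ^ S n - exp (- t) * (INR (S n) * t ^ n) + INR (S n) * (t ^ n * exp (- t)) = t ^ S n * exp (- t)). ring. }
    apply (is_derive_plus (V := R_NormedModule) (fun t => - (exp (- t) * t ^ S n)) (fun t => INR (S n) * gamma_prim n t)).
    + auto_derive; auto. destruct n; simpl; ring.
    + apply (is_derive_scal (gamma_prim n) t (INR (S n))); auto.
Qed.

Lemma gamma_prim_0 n : gamma_prim n 0 = - INR (fact n).
Proof.
  induction n; [simpl; rewrite Ropp_0, exp_0; ring|].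
  change (gamma_prim (S n) 0) with (- (exp (- 0) * 0 ^ S n) + INR (S n) * gamma_prim n 0).
  rewrite IHn, pow_i by lia. change (fact (S n)) with (S n * fact n)%nat. rewrite mult_INR. ring.
Qed.

Lemma pow_exp_lim n : is_lim (fun t => exp (- t) * t ^ n) p_infty 0.
Proof.
  (* From [t / (n + 1) <= exp (t / (n + 1))] raised to the power [n + 1]. *)
  set (K := INR (S n) ^ S n).
  apply is_lim_le_le_loc with (fun _ => 0) (fun t => K * / t).
  - exists 1. intros t Ht. pose proof (exp_pos (- t)). split.
    + apply Rmult_le_pos; [lra|apply pow_le; lra].
    + pose proof (INR_S_pos n) as Hn.
      assert (E : (t / INR (S n)) ^ S n <= exp t).
      { replace (exp t) with (exp (t / INR (S n)) ^ S n).
        - apply pow_incr. split; [left; apply Rdiv_lt_0_compat; lra|].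
          pose proof (exp_ineq1_le (t / INR (S n))). lra.
        - rewrite exp_pow. f_equal. field. lra. }
      rewrite exp_Ropp. apply Rmult_le_reg_r with (exp t * t); [apply Rmult_lt_0_compat; [apply exp_pos|lra]|].
      replace (/ exp t * t ^ n * (exp t * t)) with (t ^ S n) by (simpl; field; apply Rgt_not_eq, exp_pos).
      replace (K * / t * (exp t * t)) with (K * exp t) by (field; lra).
      unfold Rdiv in E. rewrite Rpow_mult_distr, pow_inv in E. fold K in E.
      assert (HK : 0 < K) by (apply pow_lt; auto).
      apply Rmult_le_compat_l with (r := K) in E; [|lra].
      replace (K * (t ^ S n * / K)) with (t ^ S n) in E by (field; lra). exact E.
  - apply is_lim_const.
  - replace (Finite 0) with (Rbar_mult K (Rbar_inv p_infty)) by (simpl; f_equal; ring).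
    apply is_lim_scal_l, is_lim_inv; [apply is_lim_id|discriminate].
Qed.

Lemma gamma_prim_lim n : is_lim (gamma_prim n) p_infty 0.
Proof.
  induction n.
  - pose proof (pow_exp_lim 0) as H. apply is_lim_opp in H. simpl Rbar_opp in H. rewrite Ropp_0 in H.
    eapply is_lim_ext; [|exact H]. intros t. simpl. ring.
  - replace (Finite 0) with (Rbar_plus (Rbar_opp 0) (Rbar_mult (INR (S n)) 0)) by (simpl; f_equal; ring).
    apply (is_lim_plus (fun t => - (exp (- t) * t ^ S n)) (fun t => INR (S n) * gamma_prim n t) p_infty (Rbar_opp 0) (Rbar_mult (INR (S n)) 0)).
    + apply (is_lim_opp (fun t => exp (- t) * t ^ S n)), pow_exp_lim.
    + apply is_lim_scal_l; auto.
    + apply Rbar_plus_correct. simpl. auto.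
Qed.

Lemma Gamma_INR n : Gamma (INR n + 1) = INR (fact n).
Proof.
  unfold Gamma. apply is_RInt_gen_unique.
  replace (INR (fact n)) with (0 - gamma_prim n 0) by (rewrite gamma_prim_0; ring).
  apply is_RInt_gen_ext with (Derive (gamma_prim n)).
  (* The bounds are taken positive because [Rpower t] is identified with the power only for positive
     [t]. *)
  - apply (Filter_prod _ _ _ (fun a => 0 < a) (fun b => 0 < b)).
    + exists (mkposreal 1 Rlt_0_1). intros y _ Hy. exact Hy.
    + exists 0. auto.
    + intros a b Ha Hb t [Ht _]. simpl in Ht.
      assert (0 < t) by (eapply Rlt_trans; [|exact Ht]; apply Rmin_pos; auto).
      rewrite (is_derive_unique _ _ _ (is_derive_gamma_prim n t)).
      replace (INR n + 1 - 1) with (INR n) by ring. rewrite Rpower_pow by auto. auto.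
  - apply is_RInt_gen_Derive.
    + apply (Filter_prod _ _ _ (fun _ => True) (fun _ => True)); try apply filter_true.
      intros a b _ _ t _. eexists. apply is_derive_gamma_prim.
    + apply (Filter_prod _ _ _ (fun _ => True) (fun _ => True)); try apply filter_true.
      intros a b _ _ t _.
      apply (continuous_ext (fun t => t ^ n * exp (- t))).
      { intros u. symmetry. apply is_derive_unique, is_derive_gamma_prim. }
      apply (ex_derive_continuous (V := R_NormedModule)). auto_derive. auto.
    + assert (Hc : continuous (gamma_prim n) 0).
      { apply (ex_derive_continuous (V := R_NormedModule)). eexists. apply is_derive_gamma_prim. }
      eapply filterlim_filter_le_1; [|exact Hc]. apply filter_le_within.
    + apply (gamma_prim_lim n).
Qed.

Lemma besselI2_eq y : besselI 2 y = Series (fun r => (y / 2) ^ (2 * r + 2) / (INR (fact r) * INR (fact (r + 2)))).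
Proof.
  unfold besselI. apply Series_ext. intros r.
  replace (INR r + INR 2 + 1) with (INR (r + 2) + 1) by (rewrite plus_INR; ring).
  rewrite Gamma_INR. field. split; apply INR_fact_neq_0.
Qed.

(** * Integral representation of the Bessel function *)

Lemma is_RInt_sum_n (u : nat -> R -> R) (v : nat -> R) a b N :
  (forall l, is_RInt (u l) a b (v l)) -> is_RInt (fun t => sum_n (fun l => u l t) N) a b (sum_n v N).
Proof.
  intros H. induction N.
  - rewrite sum_O. eapply is_RInt_ext; [|apply (H 0%nat)]. intros; rewrite sum_O; auto.
  - rewrite sum_Sn. eapply is_RInt_ext; [|apply (is_RInt_plus _ _ _ _ _ _ IHN (H (S N)))].
    intros; rewrite sum_Sn; auto.
Qed.

Lemma is_RInt_series (u : nat -> R -> R) (v B : nat -> R) a b : a <= b ->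
  (forall l, is_RInt (u l) a b (v l)) -> (forall l t, a <= t <= b -> Rabs (u l t) <= B l) -> ex_series B ->
  ex_series v /\ is_RInt (fun t => Series (fun l => u l t)) a b (Series v).
Proof.
  intros Hab Hu HB HS.
  (* The functions are cut off outside the interval, since [filterlim_RInt] asks for uniform
     convergence on the whole line. *)
  set (ind := fun t => if Rle_dec a t then if Rle_dec t b then true else false else false).
  assert (Hin : forall t, a < t < b -> ind t = true).
  { intros t Ht. unfold ind. destruct Rle_dec; [|lra]. destruct Rle_dec; auto; lra. }
  assert (Hin2 : forall t, ind t = true -> a <= t <= b).
  { intros t. unfold ind. destruct Rle_dec; [|discriminate]. destruct Rle_dec; [lra|discriminate]. }
  destruct (filterlim_RInt (V := R_CompleteNormedModule)
    (fun N t => if ind t then sum_n (fun l => u l t) N else 0) a b eventually _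
    (fun t => if ind t then Series (fun l => u l t) else 0) (sum_n v)) as [I [I1 I2]].
  - intros N. eapply is_RInt_ext; [|apply is_RInt_sum_n, Hu].
    intros t Ht. rewrite Rmin_left, Rmax_right in Ht by auto. cbv beta. rewrite Hin by auto. auto.
  - apply filterlim_locally. intros eps.
    destruct (series_tail_0 B HS eps (cond_pos eps)) as [N HN]. exists N. intros n Hn t.
    change (Rabs ((if ind t then sum_n (fun l => u l t) n else 0) - (if ind t then Series (fun l => u l t) else 0)) < eps).
    destruct (ind t) eqn:E; [|rewrite Rminus_diag, Rabs_R0; apply cond_pos].
    apply Hin2 in E. specialize (HN (S n) ltac:(lia)).
    assert (X : ex_series (fun l => u l t)).
    { apply ex_series_Rabs. apply ex_series_le_R with B; auto. intros l; split; [apply Rabs_pos|auto]. }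
    rewrite (Series_incr_n (fun l => u l t) (S n)) by (auto with arith). simpl pred.
    rewrite sum_n_Reals. match goal with |- Rabs (?p - (?p + ?q)) < _ => replace (p - (p + q)) with (- q) by ring end.
    rewrite Rabs_Ropp. eapply Rle_lt_trans; [|eapply Rle_lt_trans; [apply Rle_abs|exact HN]].
    assert (HBt : ex_series (fun k => B (S n + k)%nat)) by (apply (ex_series_incr_n B), HS).
    eapply Rle_trans; [apply Series_Rabs|].
    + apply ex_series_le_R with (fun k => B (S n + k)%nat); auto. intros l; split; [apply Rabs_pos|auto].
    + apply Series_le; auto. intros l; split; [apply Rabs_pos|auto].
  - split; [exists I; exact I1|].
    assert (E : Series v = I) by (apply is_series_unique; exact I1).
    rewrite E. eapply is_RInt_ext; [|exact I2].
    intros t Ht. rewrite Rmin_left, Rmax_right in Ht by auto. cbv beta. rewrite Hin by auto. auto.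
Qed.

Lemma continuous_of_derivable (f : R -> R) : (forall x, ex_derive f x) -> forall x, continuous f x.
Proof. intros H x. apply (ex_derive_continuous (V := R_NormedModule)), H. Qed.

Lemma ex_RInt_of_derivable (f : R -> R) a b : (forall x, ex_derive f x) -> ex_RInt f a b.
Proof. intros H. apply (ex_RInt_continuous (V := R_CompleteNormedModule)). intros; apply continuous_of_derivable, H. Qed.

Definition wallis (k : nat) : R := RInt (fun t => cos t ^ k) 0 PI.

Lemma is_RInt_wallis k : is_RInt (fun t => cos t ^ k) 0 PI (wallis k).
Proof. apply (RInt_correct (V := R_CompleteNormedModule)). apply ex_RInt_of_derivable. intros x. auto_derive. auto. Qed.

(** The difference of the integrands is the derivative of [cos t ^ (k + 1) * sin t], which vanishes
    at both ends. *)
Lemma wallis_rec k : INR (k + 2) * wallis (k + 2) = INR (k + 1) * wallis k.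
Proof.
  assert (H : is_RInt (fun t => INR (k + 2) * cos t ^ (k + 2) - INR (k + 1) * cos t ^ k) 0 PI
    (INR (k + 2) * wallis (k + 2) - INR (k + 1) * wallis k)).
  { apply (is_RInt_minus (V := R_NormedModule)); apply (is_RInt_scal (V := R_NormedModule)); apply is_RInt_wallis. }
  assert (H2 : is_RInt (fun t => INR (k + 2) * cos t ^ (k + 2) - INR (k + 1) * cos t ^ k) 0 PI
    (minus (cos PI ^ (k + 1) * sin PI) (cos 0 ^ (k + 1) * sin 0))).
  { apply (is_RInt_derive (V := R_CompleteNormedModule) (fun t => cos t ^ (k + 1) * sin t)).
    - intros t _. auto_derive; auto.
      replace (k + 1)%nat with (S k) by lia. replace (k + 2)%nat with (S (S k)) by lia.
      simpl pred. pose proof (sin2_cos2 t) as P. unfold Rsqr in P.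
      rewrite !S_INR. simpl pow.
      replace (sin t * sin t) with (1 - cos t * cos t) by lra.
      transitivity (cos t * (cos t * cos t ^ k) - (INR k + 1) * cos t ^ k * (sin t * sin t)); [ring|].
      replace (sin t * sin t) with (1 - cos t * cos t) by lra. ring.
    - intros t _. apply continuous_of_derivable. intros u. auto_derive. auto. }
  pose proof (is_RInt_unique _ _ _ _ H) as E1. pose proof (is_RInt_unique _ _ _ _ H2) as E2.
  rewrite E1 in E2. rewrite sin_PI, sin_0 in E2. change (minus ?a ?b) with (a - b) in E2.
  rewrite !Rmult_0_r in E2. unfold minus, plus, opp in E2. simpl in E2. lra.
Qed.

Lemma wallis_0 : wallis 0 = PI.
Proof.
  unfold wallis. rewrite (RInt_ext _ (fun _ => 1)) by (intros; simpl; auto).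
  rewrite RInt_const. unfold scal. simpl. unfold mult. simpl. ring.
Qed.

Lemma wallis_1 : wallis 1 = 0.
Proof.
  unfold wallis. apply is_RInt_unique.
  replace 0 with (minus (sin PI) (sin 0)) at 2.
  - apply (is_RInt_derive (V := R_CompleteNormedModule) sin).
    + intros t _. auto_derive; auto. ring.
    + intros t _. apply continuous_of_derivable. intros u. auto_derive. auto.
  - rewrite sin_PI, sin_0. unfold minus, plus, opp. simpl. ring.
Qed.

Lemma wallis_odd p : wallis (2 * p + 1) = 0.
Proof.
  induction p; [apply wallis_1|].
  pose proof (wallis_rec (2 * p + 1)) as H. rewrite IHp, Rmult_0_r in H.
  replace (2 * S p + 1)%nat with (2 * p + 1 + 2)%nat by lia.
  apply Rmult_integral in H. destruct H as [H|H]; auto.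
  exfalso. revert H. apply not_0_INR. lia.
Qed.

Lemma wallis_even p : wallis (2 * p) = PI * INR (fact (2 * p)) / (4 ^ p * INR (fact p) ^ 2).
Proof.
  induction p; [simpl; rewrite wallis_0; field|].
  pose proof (wallis_rec (2 * p)) as H. rewrite IHp in H.
  replace (2 * S p)%nat with (2 * p + 2)%nat by lia.
  assert (Hn : 0 < INR (2 * p + 2)) by (apply lt_0_INR; lia).
  apply Rmult_eq_reg_l with (INR (2 * p + 2)); [|lra]. rewrite H.
  replace (2 * p + 2)%nat with (S (S (2 * p))) by lia.
  change (fact (S (S (2 * p)))) with (S (S (2 * p)) * (S (2 * p) * fact (2 * p)))%nat.
  change (fact (S p)) with (S p * fact p)%nat. rewrite !mult_INR.
  replace (2 * p + 1)%nat with (S (2 * p)) by lia.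
  rewrite !S_INR, mult_INR. simpl (INR 2). pose proof (pos_INR p). pose proof (INR_fact_neq_0 p).
  simpl pow. assert (4 ^ p <> 0) by (apply pow_nonzero; lra). field. repeat split; auto; lra.
Qed.

(** With [cos (2 t) = 2 cos t ^ 2 - 1] the recursion gives the factor
    [2 (k + 1) / (k + 2) - 1 = k / (k + 2)]. *)
Lemma is_RInt_cos2_pow k :
  is_RInt (fun t => cos (2 * t) * cos t ^ k) 0 PI (INR k / INR (k + 2) * wallis k).
Proof.
  assert (Hn : 0 < INR (k + 2)) by (apply lt_0_INR; lia).
  replace (INR k / INR (k + 2) * wallis k) with (minus (scal 2 (wallis (k + 2))) (wallis k)).
  - eapply is_RInt_ext.
    2: { apply (is_RInt_minus (V := R_NormedModule)); [|apply (is_RInt_wallis k)].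
         apply (is_RInt_scal (V := R_NormedModule)), (is_RInt_wallis (k + 2)). }
    intros t _. unfold minus, plus, opp, scal. simpl. unfold mult. simpl.
    rewrite cos_2a_cos, pow_add. simpl. ring.
  - unfold minus, plus, opp, scal. simpl. unfold mult. simpl.
    pose proof (wallis_rec k) as H.
    replace (wallis (k + 2)) with (INR (k + 1) * wallis k / INR (k + 2)) by (rewrite <- H; field; lra).
    rewrite !plus_INR in *. simpl (INR 2) in *. simpl (INR 1). field. lra.
Qed.

Lemma exp_is_series x : is_series (fun k => x ^ k / INR (fact k)) (exp x).
Proof.
  eapply is_series_ext; [|apply is_exp_Reals]. intros n.
  unfold scal. simpl. unfold mult. simpl. rewrite pow_n_pow. reflexivity.
Qed.

(** In the expansion of the exponential the odd powers integrate to 0 and the power [2 r + 2] yields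
    the term of index [r] of the Bessel series. *)
Lemma besselI2_integral y :
  is_RInt (fun t => cos (2 * t) * exp (y * cos t)) 0 PI (PI * besselI 2 y).
Proof.
  pose proof PI_bounds as HP.
  set (u := fun k t => y ^ k / INR (fact k) * (cos (2 * t) * cos t ^ k)).
  set (v := fun k => y ^ k / INR (fact k) * (INR k / INR (k + 2) * wallis k)).
  assert (HB : ex_series (fun k => Rabs y ^ k / INR (fact k))) by (eexists; apply exp_is_series).
  assert (Hb : forall k t, Rabs (u k t) <= Rabs y ^ k / INR (fact k)).
  { intros k t. unfold u. assert (0 < INR (fact k)) by apply INR_fact_lt_0.
    unfold Rdiv. rewrite !Rabs_mult, Rabs_inv, (Rabs_pos_eq (INR (fact k))), <- !RPow_abs by lra.
    rewrite <- (Rmult_1_r (Rabs y ^ k * / INR (fact k))) at 2.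
    apply Rmult_le_compat_l.
    - apply Rmult_le_pos; [apply pow_le, Rabs_pos|left; apply Rinv_0_lt_compat; auto].
    - rewrite <- (Rmult_1_l 1). apply Rmult_le_compat; try apply Rabs_pos.
      + apply pow_le, Rabs_pos.
      + apply Rabs_le, COS_bound.
      + rewrite <- (pow1 k). apply pow_incr. split; [apply Rabs_pos|apply Rabs_le, COS_bound]. }
  assert (I : ex_series v /\ is_RInt (fun t => Series (fun k => u k t)) 0 PI (Series v)).
  { apply is_RInt_series with (fun k => Rabs y ^ k / INR (fact k)); auto; [lra|].
    intros k. apply (is_RInt_scal (V := R_NormedModule)), is_RInt_cos2_pow. }
  destruct I as [Hv I].
  assert (Ev : Series v = PI * besselI 2 y).
  { pose proof (is_series_pairs v Hv) as Hp. apply is_series_unique in Hp.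
    rewrite <- Hp, besselI2_eq, <- Series_scal_l.
    (* The power 0 drops out because of the factor [k / (k + 2)], so the index moves by one. *)
    rewrite Series_incr_1_aux.
    2: { unfold v. simpl. rewrite wallis_1. unfold Rdiv. ring. }
    apply Series_ext. intros r. unfold v.
    rewrite wallis_odd, !Rmult_0_r, Rplus_0_r.
    rewrite wallis_even. unfold Rdiv at 5. rewrite Rpow_mult_distr.
    replace (2 * r + 2)%nat with (2 * S r)%nat by lia.
    replace ((/ 2) ^ (2 * S r)) with (/ 4 ^ S r).
    2: { rewrite (pow_mult (/ 2)). replace ((/ 2) ^ 2) with (/ 4) by field. rewrite pow_inv. auto. }
    replace (r + 2)%nat with (S (S r)) by lia.
    replace (INR (2 * S r + 2)) with (2 * (INR r + 2)) by (rewrite plus_INR, mult_INR, (S_INR r); change (INR 2) with 2; ring).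
    replace (INR (2 * S r)) with (2 * (INR r + 1)) by (rewrite mult_INR, (S_INR r); change (INR 2) with 2; ring).
    change (fact (S (S r))) with (S (S r) * (S r * fact r))%nat. change (fact (S r)) with (S r * fact r)%nat.
    rewrite !mult_INR, !S_INR. pose proof (pos_INR r).
    pose proof (INR_fact_neq_0 (2 * S r)). pose proof (INR_fact_neq_0 r).
    assert (4 ^ S r <> 0) by (apply pow_nonzero; lra). field. repeat split; auto; lra. }
  rewrite <- Ev. eapply is_RInt_ext; [|exact I].
  intros t _. unfold u. cbv beta.
  transitivity (cos (2 * t) * Series (fun k => (y * cos t) ^ k / INR (fact k))).
  - rewrite <- Series_scal_l. apply Series_ext. intros k. rewrite Rpow_mult_distr. unfold Rdiv. ring.
  - f_equal. apply is_series_unique, exp_is_series.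
Qed.

(** Termwise comparison with the series of [(sinh y - y) / (2 y)]. A factor of order [sqrt y] is
    lost against the true size of the Bessel function, which is harmless next to an exponentially
    smaller error. *)
Lemma besselI2_lower y : 0 < y -> ((exp y - exp (- y)) / 2 - y) / (2 * y) <= besselI 2 y.
Proof.
  intros Hy. rewrite besselI2_eq.
  (* The induction compares quotients: [4 (r + 1) (r + 3) <= (2 r + 5) (2 r + 4)]. *)
  assert (F : forall r, 4 ^ S r * (INR (fact r) * INR (fact (r + 2))) <= 2 * INR (fact (2 * r + 3))).
  { induction r; [simpl; lra|].
    replace (2 * S r + 3)%nat with (S (S (2 * r + 3))) by lia. replace (S r + 2)%nat with (S (r + 2)) by lia.
    change (fact (S (S (2 * r + 3)))) with (S (S (2 * r + 3)) * (S (2 * r + 3) * fact (2 * r + 3)))%nat.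
    change (fact (S (r + 2))) with (S (r + 2) * fact (r + 2))%nat. change (fact (S r)) with (S r * fact r)%nat.
    rewrite !mult_INR, !S_INR, !plus_INR, mult_INR. simpl (INR 2). simpl (INR 3).
    set (X := 4 ^ S r) in *. change (4 ^ S (S r)) with (4 * X).
    set (a := INR (fact r)) in *. set (b := INR (fact (r + 2))) in *. set (d := INR (fact (2 * r + 3))) in *.
    pose proof (pos_INR r) as Hr. set (x := INR r) in *.
    assert (0 < d) by apply INR_fact_lt_0. 
    assert (0 < X * (a * b)).
    { apply Rmult_lt_0_compat; [apply pow_lt; lra|]. apply Rmult_lt_0_compat; apply INR_fact_lt_0. }
    apply Rle_trans with (4 * (x + 1) * (x + 2 + 1) * (X * (a * b))); [right; simpl; ring|].
    apply Rle_trans with (4 * (x + 1) * (x + 2 + 1) * (2 * d)); [apply Rmult_le_compat_l; nra|].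
    assert (4 * (x + 1) * (x + 2 + 1) <= ((2 * x + 5) * (2 * x + 4))) by nra.
    apply Rle_trans with (((2 * x + 5) * (2 * x + 4)) * (2 * d)); [apply Rmult_le_compat_r; lra|].
    right. simpl. ring. }
  assert (S0 : is_series (fun k => y ^ k / INR (fact k) - (- y) ^ k / INR (fact k)) (exp y - exp (- y))).
  { apply (is_series_minus (V := R_NormedModule)); apply exp_is_series. }
  pose proof (is_series_pairs _ (ex_intro _ _ S0 : ex_series _)) as Sp. rewrite (is_series_unique _ _ S0) in Sp.
  set (w := fun r => 2 * y * (y ^ (2 * r + 2) / INR (fact (2 * r + 3)))).
  assert (Sw : is_series w (exp y - exp (- y) - 2 * y)).
  { assert (Sp' : is_series (fun r => 2 * y * (y ^ (2 * r) / INR (fact (2 * r + 1)))) (exp y - exp (- y))).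
    { eapply is_series_ext; [|exact Sp]. intros i. cbv beta.
      replace ((- y) ^ (2 * i)) with (y ^ (2 * i)) by (rewrite !pow_mult; f_equal; ring).
      replace ((- y) ^ (2 * i + 1)) with (- (y * y ^ (2 * i))).
      - rewrite (pow_add y (2 * i) 1). change (y ^ (2 * i) / INR (fact (2 * i)) - y ^ (2 * i) / INR (fact (2 * i)) +
          (y ^ (2 * i) * y ^ 1 / INR (fact (2 * i + 1)) - - (y * y ^ (2 * i)) / INR (fact (2 * i + 1))) = 2 * y * (y ^ (2 * i) / INR (fact (2 * i + 1)))).
        field. split; apply INR_fact_neq_0.
      - rewrite pow_add, !pow_mult. replace ((- y) ^ 2) with (y ^ 2) by ring. ring. }
    apply (is_series_ext (fun r => 2 * y * (y ^ (2 * S r) / INR (fact (2 * S r + 1))))).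
    { intros r. unfold w. replace (2 * S r)%nat with (2 * r + 2)%nat by lia.
      replace (2 * r + 2 + 1)%nat with (2 * r + 3)%nat by lia. auto. }
    apply (is_series_incr_1 (fun r => 2 * y * (y ^ (2 * r) / INR (fact (2 * r + 1))))).
    replace (plus _ _) with (exp y - exp (- y)); [exact Sp'|].
    unfold plus. simpl. field. }
  assert (Hb : ex_series (fun r => (y / 2) ^ (2 * r + 2) / (INR (fact r) * INR (fact (r + 2))))).
  { apply ex_series_le_R with (fun r => ((y / 2) ^ 2) * ((y / 2) ^ 2) ^ r / INR (fact r)).
    - intros r. rewrite pow_add, pow_mult. 
      assert (0 < INR (fact r)) by apply INR_fact_lt_0.
      assert (1 <= INR (fact (r + 2))) by (change 1 with (INR 1); apply le_INR, lt_O_fact).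
      assert (0 < (y / 2) ^ 2) by (apply pow_lt; lra).
      assert (0 < ((y / 2) ^ 2) ^ r) by (apply pow_lt; auto).
      assert (0 < ((y / 2) ^ 2) ^ r * (y / 2) ^ 2) by nra.
      split; [left; apply Rdiv_lt_0_compat; auto; nra|].
      rewrite (Rmult_comm ((y / 2) ^ 2)). apply Rmult_le_compat_l; [lra|].
      apply Rinv_le_contravar; auto. nra.
    - apply ex_series_ext with (fun r => (y / 2) ^ 2 * (((y / 2) ^ 2) ^ r / INR (fact r))).
      + intros r. unfold Rdiv. symmetry. apply Rmult_assoc.
      + apply ex_series_Rmult_l. eexists. apply exp_is_series. }
  apply Rle_trans with (Series (fun r => / (4 * y) * w r)).
  - rewrite Series_scal_l, (is_series_unique _ _ Sw). right. field. lra.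
  - apply Series_le; auto. intros r. unfold w. specialize (F r).
    assert (0 < INR (fact (2 * r + 3))) by apply INR_fact_lt_0.
    assert (0 < INR (fact r) * INR (fact (r + 2))) by (apply Rmult_lt_0_compat; apply INR_fact_lt_0).
    assert (0 < y ^ (2 * r + 2)) by (apply pow_lt; auto).
    replace (/ (4 * y) * (2 * y * (y ^ (2 * r + 2) / INR (fact (2 * r + 3))))) with (y ^ (2 * r + 2) * / (2 * INR (fact (2 * r + 3)))) by (field; lra).
    split; [apply Rmult_le_pos; [lra|left; apply Rinv_0_lt_compat; lra]|].
    replace ((y / 2) ^ (2 * r + 2) / (INR (fact r) * INR (fact (r + 2)))) with (y ^ (2 * r + 2) * / (4 ^ S r * (INR (fact r) * INR (fact (r + 2))))).
    + apply Rmult_le_compat_l; [lra|]. apply Rinv_le_contravar; auto.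
      apply Rmult_lt_0_compat; auto. apply pow_lt; lra.
    + unfold Rdiv. rewrite Rpow_mult_distr, Rinv_mult.
      replace ((/ 2) ^ (2 * r + 2)) with (/ 4 ^ S r); [ring|].
      replace (2 * r + 2)%nat with (2 * S r)%nat by lia. rewrite pow_mult.
      replace ((/ 2) ^ 2) with (/ 4) by field. rewrite pow_inv. auto.
Qed.

(** * The coefficient as a contour integral *)

(* Half of the contour; the other half is its complex conjugate. It runs along the circle of
   radius [R] from [R] to [R * exp (PI * i / 4) = r + i * r] and then up the vertical line
   through that point to [r + i * PI]. *)
Definition arc (R t : R) : C := (R * cos t, R * sin t).
Definition vline (r th : R) : C := (r, th).

(** The imaginary part of [exp (kap z) / kap] at [z = c + d i], a primitive of the real part of
    [exp (kap z) dz / i]; at [kap = 0] it is replaced by its limit. *)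
Definition path_prim (kap c d : R) : R :=
  if Req_dec_T kap 0 then d else exp (kap * c) * sin (kap * d) / kap.

Lemma is_derive_path_prim (kap : R) (c d c' d' : R -> R) t :
  is_derive c t (c' t) -> is_derive d t (d' t) ->
  is_derive (fun t => path_prim kap (c t) (d t)) t
    (exp (kap * c t) * (d' t * cos (kap * d t) + c' t * sin (kap * d t))).
Proof.
  intros Hc Hd. unfold path_prim. destruct (Req_dec_T kap 0) as [->|Hk].
  - rewrite !Rmult_0_l, exp_0, cos_0, sin_0.
    replace (1 * (d' t * 1 + c' t * 0)) with (d' t) by ring. exact Hd.
  - assert (E1 : ex_derive c t) by (eexists; eauto). assert (E2 : ex_derive d t) by (eexists; eauto).
    auto_derive; auto.
    change (Derive (fun x : R => c x) t) with (Derive c t). change (Derive (fun x : R => d x) t) with (Derive d t).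
    rewrite (is_derive_unique _ _ _ Hc), (is_derive_unique _ _ _ Hd). field. auto.
Qed.

Lemma is_RInt_path (kap : R) (c d c' d' : R -> R) a b :
  (forall t, is_derive c t (c' t)) -> (forall t, is_derive d t (d' t)) ->
  (forall t, ex_derive c' t) -> (forall t, ex_derive d' t) ->
  is_RInt (fun t => exp (kap * c t) * (d' t * cos (kap * d t) + c' t * sin (kap * d t))) a b
    (path_prim kap (c b) (d b) - path_prim kap (c a) (d a)).
Proof.
  intros Hc Hd Hc' Hd'.
  apply (is_RInt_derive (V := R_CompleteNormedModule) (fun t => path_prim kap (c t) (d t))).
  - intros t _. apply is_derive_path_prim; auto.
  - intros t _. apply continuous_of_derivable. intros u.
    assert (ex_derive c u) by (eexists; apply Hc). assert (ex_derive d u) by (eexists; apply Hd).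
    auto_derive. repeat split; auto.
Qed.

Lemma sin_INR_PI m : sin (INR m * PI) = 0.
Proof.
  induction m; [simpl; rewrite Rmult_0_l; apply sin_0|].
  rewrite S_INR. replace ((INR m + 1) * PI) with (INR m * PI + PI) by ring.
  rewrite neg_sin, IHm. ring.
Qed.

Lemma sin_diff_INR_PI n l : sin ((INR n - INR l) * PI) = 0.
Proof.
  rewrite Rmult_minus_distr_r, sin_minus, !sin_INR_PI. ring.
Qed.

Lemma is_series_single (n : nat) (c : R) : is_series (fun l => if (l =? n)%nat then c else 0) c.
Proof.
  apply is_series_sum_f_R0.
  apply is_lim_seq_ext_loc with (fun _ => c); [|apply is_lim_seq_const].
  exists n. intros m Hm. symmetry. induction Hm as [|m Hm IH].
  - assert (Z : forall j, (j < n)%nat -> sum_f_R0 (fun l => if (l =? n)%nat then c else 0) j = 0).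
    { induction j; intros Hj.
      - destruct n; [lia|]. auto.
      - rewrite tech5, IHj by lia. replace (S j =? n)%nat with false; [ring|]. symmetry. apply Nat.eqb_neq. lia. }
    destruct n as [|p]; [reflexivity|]. rewrite tech5, Z by lia. rewrite Nat.eqb_refl. ring.
  - rewrite tech5, IH. replace (S m =? n)%nat with false; [ring|]. symmetry. apply Nat.eqb_neq. lia.
Qed.

Lemma Re_Cexp_mult (k : R) z : Re (Cexp (k * z)) = exp (k * Re z) * cos (k * Im z).
Proof. unfold Cexp. rewrite Re_RtoC_mult, Im_RtoC_mult. reflexivity. Qed.

Lemma Im_Cexp_mult (k : R) z : Im (Cexp (k * z)) = exp (k * Re z) * sin (k * Im z).
Proof. unfold Cexp. rewrite Re_RtoC_mult, Im_RtoC_mult. reflexivity. Qed.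

Lemma qseries_shift b z n : coefs b -> 0 < Re z ->
  summ (fun l => b l * Cexp ((INR n - INR l)%R * z))%C /\
  (CSer (qterm b z) * Cexp (INR n * z))%C = CSer (fun l => b l * Cexp ((INR n - INR l)%R * z))%C.
Proof.
  intros Hb Hz.
  assert (E : forall l, (Cexp (INR n * z) * qterm b z l)%C = (b l * Cexp ((INR n - INR l)%R * z))%C).
  { intros l. unfold qterm. replace ((INR n - INR l)%R * z)%C with (INR n * z + - (INR l * z))%C.
    - rewrite Cexp_plus. ring.
    - rewrite RtoC_minus. ring. }
  split.
  - eapply summ_ext; [exact E|]. apply summ_scal, qterm_summ; auto.
  - rewrite <- (CSer_ext _ _ E), CSer_scal by (apply qterm_summ; auto). ring.
Qed.

Lemma contour_formula (b : nat -> R) (n : nat) (rho r : R) : coefs b -> 0 < r -> r = rho * cos (PI / 4) -> r <= PI ->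
  exists I1 I2 : R,
    is_RInt (fun t => Re (arc rho t * (CSer (qterm b (arc rho t)) * Cexp (INR n * arc rho t)))%C) 0 (PI / 4) I1 /\
    is_RInt (fun th => Re (CSer (qterm b (vline r th)) * Cexp (INR n * vline r th))%C) r PI I2 /\
    PI * b n = I1 + I2.
Proof.
  intros Hb Hr HrR HrP. pose proof PI_bounds as HP.
  assert (Hc4 : 0 < cos (PI / 4)) by (apply cos_gt_0; lra).
  assert (HR : 0 < rho).
  { destruct (Rle_dec rho 0); [|lra]. exfalso. assert (rho * cos (PI / 4) <= 0) by nra. lra. }
  assert (Hsr : rho * sin (PI / 4) = r) by (rewrite sin_cos_PI4; lra).
  set (kap := fun l => INR n - INR l).
  set (u1 := fun l t => b l * (exp (kap l * (rho * cos t)) * ((rho * cos t) * cos (kap l * (rho * sin t)) + (- (rho * sin t)) * sin (kap l * (rho * sin t))))).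
  set (u2 := fun l th => b l * (exp (kap l * r) * (1 * cos (kap l * th) + 0 * sin (kap l * th)))).
  set (v1 := fun l => b l * (path_prim (kap l) r r - path_prim (kap l) rho 0)).
  set (v2 := fun l => b l * (path_prim (kap l) r PI - path_prim (kap l) r r)).
  assert (Hcos : forall t, 0 <= t <= PI / 4 -> r <= rho * cos t <= rho).
  { intros t Ht. rewrite HrR. pose proof (COS_bound t). split; [|nra].
    apply Rmult_le_compat_l; [lra|]. apply cos_decr_1; lra. }
  assert (X1 : ex_series v1 /\ is_RInt (fun t => Series (fun l => u1 l t)) 0 (PI / 4) (Series v1)).
  { apply is_RInt_series with (fun l => (rho * 2 * exp (INR n * rho)) * (Rabs (b l) * exp (- (INR l * r)))); [lra| | |].
    - intros l. unfold u1, v1. apply (is_RInt_scal (V := R_NormedModule)).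
      replace (path_prim (kap l) r r) with (path_prim (kap l) (rho * cos (PI / 4)) (rho * sin (PI / 4))) by (rewrite Hsr, <- HrR; auto).
      replace (path_prim (kap l) rho 0) with (path_prim (kap l) (rho * cos 0) (rho * sin 0)) by (rewrite cos_0, sin_0, Rmult_1_r, Rmult_0_r; auto).
      apply (is_RInt_path (kap l) (fun t => rho * cos t) (fun t => rho * sin t) (fun t => - (rho * sin t)) (fun t => rho * cos t)); intros t; auto_derive; auto; ring.
    - intros l t Ht. specialize (Hcos t Ht). unfold u1. rewrite !Rabs_mult.
      rewrite (Rabs_pos_eq (exp _)) by (left; apply exp_pos).
      assert (B1 : exp (kap l * (rho * cos t)) <= exp (INR n * rho) * exp (- (INR l * r))).
      { rewrite <- exp_plus. apply exp_le_mono. unfold kap. pose proof (pos_INR n). pose proof (pos_INR l). nra. }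
      assert (B2 : Rabs (rho * cos t * cos (kap l * (rho * sin t)) + - (rho * sin t) * sin (kap l * (rho * sin t))) <= rho * 2).
      { eapply Rle_trans; [apply Rabs_triang|]. rewrite !Rabs_mult, Rabs_Ropp, !Rabs_mult, (Rabs_pos_eq rho) by lra.
        assert (forall x, Rabs (cos x) <= 1) by (intros; apply Rabs_le, COS_bound).
        assert (forall x, Rabs (sin x) <= 1) by (intros; apply Rabs_le, SIN_bound).
        assert (rho * Rabs (cos t) * Rabs (cos (kap l * (rho * sin t))) <= rho * 1 * 1).
        { apply Rmult_le_compat; auto; try apply Rabs_pos; [apply Rmult_le_pos; [lra|apply Rabs_pos]|].
          apply Rmult_le_compat_l; auto; lra. }
        assert (rho * Rabs (sin t) * Rabs (sin (kap l * (rho * sin t))) <= rho * 1 * 1).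
        { apply Rmult_le_compat; auto; try apply Rabs_pos; [apply Rmult_le_pos; [lra|apply Rabs_pos]|].
          apply Rmult_le_compat_l; auto; lra. }
        lra. }
      replace (rho * 2 * exp (INR n * rho) * (Rabs (b l) * exp (- (INR l * r)))) with
        (Rabs (b l) * ((exp (INR n * rho) * exp (- (INR l * r))) * (rho * 2))) by ring.
      apply Rmult_le_compat_l; [apply Rabs_pos|]. apply Rmult_le_compat; auto; [left; apply exp_pos|apply Rabs_pos].
    - apply ex_series_Rmult_l, Hb. auto. }
  assert (X2 : ex_series v2 /\ is_RInt (fun t => Series (fun l => u2 l t)) r PI (Series v2)).
  { apply is_RInt_series with (fun l => exp (INR n * r) * (Rabs (b l) * exp (- (INR l * r)))); [lra| | |].
    - intros l. unfold u2, v2. apply (is_RInt_scal (V := R_NormedModule)).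
      apply (is_RInt_path (kap l) (fun _ => r) (fun t => t) (fun _ => 0) (fun _ => 1)); intros t; auto_derive; auto; ring.
    - intros l t Ht. unfold u2. rewrite !Rabs_mult. rewrite (Rabs_pos_eq (exp _)) by (left; apply exp_pos).
      replace (1 * cos (kap l * t) + 0 * sin (kap l * t)) with (cos (kap l * t)) by ring.
      assert (Rabs (cos (kap l * t)) <= 1) by (apply Rabs_le, COS_bound).
      replace (exp (INR n * r) * (Rabs (b l) * exp (- (INR l * r)))) with (Rabs (b l) * (exp (kap l * r) * 1)).
      + apply Rmult_le_compat_l; [apply Rabs_pos|]. apply Rmult_le_compat_l; auto. left; apply exp_pos.
      + unfold kap. replace ((INR n - INR l) * r) with (INR n * r + - (INR l * r)) by ring. rewrite exp_plus. ring.
    - apply ex_series_Rmult_l, Hb. auto. }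
  destruct X1 as [V1 X1]. destruct X2 as [V2 X2].
  exists (Series v1), (Series v2). split; [|split].
  - eapply is_RInt_ext; [|exact X1]. intros t Ht. rewrite Rmin_left, Rmax_right in Ht by lra. cbv beta.
    specialize (Hcos t ltac:(lra)).
    assert (Hz : 0 < Re (arc rho t)) by (simpl; lra).
    destruct (qseries_shift b (arc rho t) n Hb Hz) as [Q1 ->].
    rewrite <- CSer_scal by auto. rewrite Re_CSer. apply Series_ext. intros l. fold (kap l).
    rewrite Re_Cmult, Re_RtoC_mult, Im_RtoC_mult, Re_Cexp_mult, Im_Cexp_mult. unfold u1, arc. simpl Re. simpl Im. ring.
  - eapply is_RInt_ext; [|exact X2]. intros t Ht. cbv beta.
    assert (Hz : 0 < Re (vline r t)) by (simpl; lra).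
    destruct (qseries_shift b (vline r t) n Hb Hz) as [Q1 ->].
    rewrite Re_CSer. apply Series_ext. intros l. fold (kap l).
    rewrite Re_RtoC_mult, Re_Cexp_mult. unfold u2, vline. simpl Re. simpl Im. ring.
  - rewrite <- Series_plus by auto. symmetry. apply is_series_unique.
    eapply is_series_ext; [|apply (is_series_single n (PI * b n))].
    intros l. cbv beta. unfold v1, v2, path_prim, kap.
    destruct (Nat.eqb_spec l n) as [->|Hl].
    + destruct (Req_dec_T (INR n - INR n) 0) as [_|E]; [|exfalso; apply E; ring].
      change (PI * b n = b n * (r - 0) + b n * (PI - r)). ring.
    + destruct (Req_dec_T (INR n - INR l) 0) as [E|E].
      { exfalso. apply Hl. apply INR_eq. lra. }
      rewrite sin_diff_INR_PI, Rmult_0_r, sin_0.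
      match goal with |- 0 = ?a * (?p - ?q) + ?a * (?s - ?p) => change (0 = a * (p - q) + a * (s - p)) end.
      field. auto.
Qed.

(** * Bounds for the generating function *)

Lemma Re_inv_formula (z : C) : Re (/ z)%C = Re z / Cmod z ^ 2.
Proof. rewrite Cmod2_alt. reflexivity. Qed.

Lemma Re_dual_mult (c : R) (z : C) : c <> 0 -> z <> 0 -> Re (dual (c * z)) = 4 * PI ^ 2 / c * Re (/ z)%C.
Proof.
  intros Hc Hz. unfold dual. rewrite <- Re_RtoC_mult. f_equal. rewrite RtoC_div by auto. field.
  split; auto. apply RtoC_neq0; auto.
Qed.

Lemma exp_1_gt : 2.718 < exp 1.
Proof.
  pose proof (exp_is_series 1) as H.
  rewrite <- (is_series_unique _ _ H).
  eapply Rlt_le_trans; [|apply (sum_f_R0_le_Series _ 7)].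
  - simpl. lra.
  - intros k. rewrite pow1. apply Rlt_le, Rdiv_lt_0_compat; [lra|apply INR_fact_lt_0].
  - eexists; exact H.
Qed.

Lemma exp_m1_lt : exp (- (1)) < 0.37.
Proof.
  rewrite exp_Ropp. pose proof exp_1_gt.
  apply Rmult_lt_reg_r with (exp 1); [lra|]. rewrite Rinv_l by lra. lra.
Qed.

(** The exponent is the smallest of the four dual real parts, attained at scale [2 s]; the others
    are its multiples by [2 s], [s] and 2. Each [Lam] costs a factor [1 / (1 - 0.37) ^ 2 < 2.6], and
    the multiplicities [3 + 1 + 1 + 1] give [15.6 <= 16]. *)
Lemma Cmod_LamD_le (s : R) (z : C) : 1 <= s -> 0 < Re z -> 1 <= 4 * PI ^ 2 / (2 * s) * Re (/ z)%C ->
  Cmod (LamD s z) <= 16 * exp (- (4 * PI ^ 2 / (2 * s) * Re (/ z)%C)).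
Proof.
  intros Hs Hz Hb. set (be := 4 * PI ^ 2 / (2 * s) * Re (/ z)%C) in *.
  assert (Hz0 : z <> 0) by (apply Re_pos_neq0; auto).
  pose proof exp_m1_lt as H37. pose proof (exp_pos (- (1))). pose proof (exp_pos (- be)).
  assert (L : forall w, be <= Re w -> Cmod (Lam w) <= 2.6 * exp (- be)).
  { intros w Hw. eapply Rle_trans; [apply (Cmod_Lam_le w 1); lra|].
    assert (exp (- Re w) <= exp (- be)) by (apply exp_le_mono; lra).
    assert (0.3969 <= (1 - exp (- (1))) ^ 2) by nra.
    apply Rmult_le_reg_r with ((1 - exp (- (1))) ^ 2); [lra|].
    unfold Rdiv. rewrite Rmult_assoc, Rinv_l by lra. nra. }
  assert (Ebe : forall c, c <> 0 -> Re (dual (c * z)) = 2 * s / c * be).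
  { intros c Hc. rewrite Re_dual_mult by auto. unfold be. field. lra. }
  pose proof (L (dual z)) as L1. pose proof (L (dual ((2 * s)%R * z))) as L2.
  pose proof (L (dual (2 * z))) as L3. pose proof (L (dual (s * z))) as L4.
  rewrite Ebe in L2, L3, L4 by lra.
  replace (dual z) with (dual (1 * z)) in L1 by (f_equal; ring). rewrite Ebe in L1 by lra.
  replace (1 * z)%C with z in L1 by ring.
  specialize (L1 ltac:(replace (2 * s / 1) with (2 * s) by field; nra)).
  specialize (L2 ltac:(replace (2 * s / (2 * s)) with 1 by (field; lra); lra)).
  specialize (L3 ltac:(replace (2 * s / 2) with s by field; nra)).
  specialize (L4 ltac:(replace (2 * s / s) with 2 by (field; lra); lra)).
  unfold LamD. eapply Rle_trans; [apply Cmod_triangle_minus|].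
  eapply Rle_trans; [apply Rplus_le_compat_r, Cmod_triangle_minus|].
  eapply Rle_trans; [apply Rplus_le_compat_r, Rplus_le_compat_r, Cmod_triangle|].
  rewrite Cmod_mult, Cmod_R, (Rabs_pos_eq 3) by lra. lra.
Qed.

(** The constant 6 is [16 * exp (- 1)] rounded up. *)
Lemma Cexp_LamD_bounds (s : R) (z : C) : 1 <= s -> 0 < Re z -> 1 <= 4 * PI ^ 2 / (2 * s) * Re (/ z)%C ->
  Cmod (Cexp (LamD s z)) <= exp 6 /\
  Cmod (Cexp (LamD s z) - 1)%C <= 16 * exp 6 * exp (- (4 * PI ^ 2 / (2 * s) * Re (/ z)%C)).
Proof.
  intros Hs Hz Hb. pose proof (Cmod_LamD_le s z Hs Hz Hb) as L.
  set (be := 4 * PI ^ 2 / (2 * s) * Re (/ z)%C) in *.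
  pose proof exp_m1_lt. pose proof (exp_pos (- be)).
  assert (exp (- be) <= exp (- (1))) by (apply exp_le_mono; lra).
  assert (L6 : Cmod (LamD s z) <= 6) by lra.
  split.
  - rewrite Cmod_Cexp. apply exp_le_mono. eapply Rle_trans; [apply Rle_abs|].
    eapply Rle_trans; [apply re_le_Cmod|]. auto.
  - eapply Rle_trans; [apply Cexp_sub1_le|].
    replace (16 * exp 6 * exp (- be)) with ((16 * exp (- be)) * exp 6) by ring.
    apply Rmult_le_compat; auto; [apply Cmod_ge_0|left; apply exp_pos|apply exp_le_mono; auto].
Qed.

(** * The generating function away from the real axis *)

Definition cer (x : R) : R := / (exp x - 1).

Lemma ce_RtoC x : 0 < x -> ce x = cer x.
Proof.
  intros H. unfold ce, cer. rewrite Cexp_RtoC, <- RtoC_minus, <- RtoC_inv; auto.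
  pose proof (exp_ineq1 x). lra.
Qed.

Lemma Cmod_ce_cer w : 0 < Re w -> Cmod (ce w) <= cer (Re w).
Proof.
  intros H. unfold ce, cer. pose proof (exp_ineq1 (Re w) ltac:(lra)).
  assert (B : exp (Re w) - 1 <= Cmod (Cexp w - 1)%C).
  { replace (Cexp w - 1)%C with (Cexp w + - (1))%C by ring.
    eapply Rle_trans; [|apply Cmod_triangle_inv]. rewrite Cmod_Cexp, Cmod_m1. lra. }
  rewrite Cmod_inv by (apply Cmod_gt_0; lra). apply Rinv_le_contravar; lra.
Qed.

(** For odd [s] inclusion-exclusion shows this to be the sum of [exp (- n w)] over the odd [n] not
    divisible by [s]. *)
Definition gpart (s : R) (w : C) : C := (ce w + ce ((2 * s)%R * w) - ce (2 * w) - ce (s * w))%C.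

Lemma ce_pow (c : nat) (w : C) : 0 < Re w -> (1 <= c)%nat ->
  ce (INR c * w) = (Cexp (- w) ^ c / (1 - Cexp (- w) ^ c))%C /\ (1 - Cexp (- w) ^ c)%C <> 0.
Proof.
  intros Hw Hc. set (q := Cexp (- w)).
  assert (Hq0 : (q ^ c)%C <> 0).
  { unfold q. rewrite <- Cexp_INR. apply Cexp_neq_0. }
  assert (Hq1 : (1 - q ^ c)%C <> 0).
  { apply Cmod_gt_0. pose proof (Cmod_triangle_inv 1 (- q ^ c)) as H.
    unfold q in *. rewrite Cmod_opp, Cmod_1, Cmod_pow, Cmod_Cexp in H.
    change (Re (- w)%C) with (- Re w) in H. pose proof (exp_neg_lt1 (Re w) Hw) as He.
    assert (exp (- Re w) ^ c < 1).
    { destruct c; [lia|]. simpl. assert (0 < exp (- Re w) ^ c <= 1); [|nra].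
      split; [apply pow_lt; lra|]. rewrite <- (pow1 c). apply pow_incr; lra. }
    unfold Cminus. lra. }
  split; auto. unfold ce.
  replace (Cexp (INR c * w)) with (/ (q ^ c))%C.
  - field. split; auto.
  - unfold q. rewrite <- Cexp_INR, <- Cexp_opp. f_equal. ring.
Qed.

Lemma gpart_3 w : 0 < Re w ->
  gpart 3 w = ((Cexp (- w) + Cexp (- w) ^ 5) / (1 - Cexp (- w) ^ 6))%C /\ (1 - Cexp (- w) ^ 6)%C <> 0.
Proof.
  intros Hw. destruct (ce_pow 1 w Hw ltac:(lia)) as [E1 N1]. destruct (ce_pow 2 w Hw ltac:(lia)) as [E2 N2].
  destruct (ce_pow 3 w Hw ltac:(lia)) as [E3 N3]. destruct (ce_pow 6 w Hw ltac:(lia)) as [E6 N6].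
  split; auto. unfold gpart.
  replace (RtoC (2 * 3)) with (RtoC (INR 6)) by (f_equal; simpl; ring).
  replace (RtoC 2) with (RtoC (INR 2)) by (f_equal; simpl; ring).
  replace (RtoC 3) with (RtoC (INR 3)) by (f_equal; simpl; ring).
  replace (ce w) with (ce (INR 1 * w)) by (f_equal; simpl; ring).
  rewrite E1, E2, E3, E6. set (q := Cexp (- w)) in *. simpl Cpow in *. rewrite ?Cmult_1_r in *.
  field. repeat split; auto.
Qed.

Lemma gpart_5 w : 0 < Re w ->
  gpart 5 w = ((Cexp (- w) + Cexp (- w) ^ 3 + Cexp (- w) ^ 7 + Cexp (- w) ^ 9) / (1 - Cexp (- w) ^ 10))%C /\
  (1 - Cexp (- w) ^ 10)%C <> 0.
Proof.
  intros Hw. destruct (ce_pow 1 w Hw ltac:(lia)) as [E1 N1]. destruct (ce_pow 2 w Hw ltac:(lia)) as [E2 N2].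
  destruct (ce_pow 5 w Hw ltac:(lia)) as [E3 N3]. destruct (ce_pow 10 w Hw ltac:(lia)) as [E6 N6].
  split; auto. unfold gpart.
  replace (RtoC (2 * 5)) with (RtoC (INR 10)) by (f_equal; simpl; ring).
  replace (RtoC 2) with (RtoC (INR 2)) by (f_equal; simpl; ring).
  replace (RtoC 5) with (RtoC (INR 5)) by (f_equal; simpl; ring).
  replace (ce w) with (ce (INR 1 * w)) by (f_equal; simpl; ring).
  rewrite E1, E2, E3, E6. set (q := Cexp (- w)) in *. simpl Cpow in *. rewrite ?Cmult_1_r in *.
  field. repeat split; auto.
Qed.

(* The expansion of [gpart] in powers of [exp (- w)] has nonnegative coefficients. *)
Lemma Cmod_gpart_le s w : s = 3 \/ s = 5 -> 0 < Re w -> exists g : R,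
  gpart s (RtoC (Re w)) = RtoC g /\ Cmod (gpart s w) <= g.
Proof.
  intros Hs Hw. set (x := Re w). set (p := exp (- x)). pose proof (exp_neg_lt1 x Hw) as Hp. fold p in Hp.
  assert (Er : Cexp (- RtoC x) = RtoC p) by (rewrite <- RtoC_opp, Cexp_RtoC; auto).
  assert (Em : Cmod (Cexp (- w)) = p) by (rewrite Cmod_Cexp; reflexivity).
  assert (Pl : forall c, (1 <= c)%nat -> p ^ c < 1).
  { intros c Hc. destruct c; [lia|]. simpl. assert (0 < p ^ c <= 1); [|nra].
    split; [apply pow_lt; lra|]. rewrite <- (pow1 c). apply pow_incr; lra. }
  assert (Den : forall c, (1 <= c)%nat -> 1 - p ^ c <= Cmod (1 - Cexp (- w) ^ c)%C).
  { intros c Hc. pose proof (Cmod_triangle_inv 1 (- Cexp (- w) ^ c)) as H.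
    rewrite Cmod_opp, Cmod_1, Cmod_pow, Em in H. exact H. }
  destruct Hs as [-> | ->].
  - exists ((p + p ^ 5) / (1 - p ^ 6)). pose proof (Pl 6%nat ltac:(lia)).
    destruct (gpart_3 (RtoC x) Hw) as [-> _]. destruct (gpart_3 w Hw) as [-> N]. split.
    + rewrite Er, !Cpow_RtoC, <- RtoC_plus, <- RtoC_minus, <- RtoC_div; auto. lra.
    + rewrite Cmod_div by auto. pose proof (Den 6%nat ltac:(lia)).
      pose proof (pow_lt p 5 ltac:(lra)).
      apply Rmult_le_compat; [apply Cmod_ge_0|left; apply Rinv_0_lt_compat; lra| |apply Rinv_le_contravar; lra].
      eapply Rle_trans; [apply Cmod_triangle|]. rewrite Cmod_pow, Em. lra.
  - exists ((p + p ^ 3 + p ^ 7 + p ^ 9) / (1 - p ^ 10)). pose proof (Pl 10%nat ltac:(lia)).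
    destruct (gpart_5 (RtoC x) Hw) as [-> _]. destruct (gpart_5 w Hw) as [-> N]. split.
    + rewrite Er, !Cpow_RtoC, <- !RtoC_plus, <- RtoC_minus, <- RtoC_div; auto. lra.
    + rewrite Cmod_div by auto. pose proof (Den 10%nat ltac:(lia)).
      apply Rmult_le_compat; [apply Cmod_ge_0|left; apply Rinv_0_lt_compat; lra| |apply Rinv_le_contravar; lra].
      eapply Rle_trans; [apply Cmod_triangle|]. apply Rplus_le_compat; [|rewrite Cmod_pow, Em; lra].
      eapply Rle_trans; [apply Cmod_triangle|]. apply Rplus_le_compat; [|rewrite Cmod_pow, Em; lra].
      eapply Rle_trans; [apply Cmod_triangle|]. rewrite Cmod_pow, Em. lra.
Qed.

(** Only one of the three copies of [ce] is needed to compensate the negative terms in [gpart]. The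
    other two stay apart, and their cancellation off the real axis is what gets exploited. *)
Lemma LamF_as_series s z : 0 < s -> 0 < Re z ->
  summ (fun j => (/ INR (S j))%R * (2 * ce (INR (S j) * z) + gpart s (INR (S j) * z)))%C /\
  LamF s z = CSer (fun j => (/ INR (S j))%R * (2 * ce (INR (S j) * z) + gpart s (INR (S j) * z)))%C.
Proof.
  intros Hs Hz.
  assert (P : forall c : R, 0 < c -> 0 < Re (c * z)%C) by (intros c Hc; rewrite Re_RtoC_mult; nra).
  pose proof (Lam_summ z Hz) as S1. pose proof (Lam_summ _ (P (2 * s) ltac:(lra))) as S2.
  pose proof (Lam_summ _ (P 2 ltac:(lra))) as S3. pose proof (Lam_summ _ (P s Hs)) as S4.
  assert (E : forall j,
    (3 * ((/ INR (S j))%R * ce (INR (S j) * z)) + (/ INR (S j))%R * ce (INR (S j) * ((2 * s)%R * z))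
      - (/ INR (S j))%R * ce (INR (S j) * (2 * z)) - (/ INR (S j))%R * ce (INR (S j) * (s * z)) =
    (/ INR (S j))%R * (2 * ce (INR (S j) * z) + gpart s (INR (S j) * z)))%C).
  { intros j. unfold gpart.
    replace (INR (S j) * ((2 * s)%R * z))%C with ((2 * s)%R * (INR (S j) * z))%C by ring.
    replace (INR (S j) * (2 * z))%C with (2 * (INR (S j) * z))%C by ring.
    replace (INR (S j) * (s * z))%C with (s * (INR (S j) * z))%C by ring. ring. }
  split.
  - eapply summ_ext; [exact E|]. auto using summ_minus, summ_plus, summ_scal.
  - rewrite <- (CSer_ext _ _ E).
    rewrite !CSer_minus, CSer_plus, CSer_scal by (auto using summ_minus, summ_plus, summ_scal). reflexivity.
Qed.

Lemma LamF_minor s z : s = 3 \/ s = 5 -> 0 < Re z ->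
  Re (LamF s z) <= Re (LamF s (RtoC (Re z))) - 2 * cer (Re z) + 2 * Cmod (ce z).
Proof.
  intros Hs Hz. assert (Hs0 : 0 < s) by (destruct Hs; lra). set (x := Re z).
  destruct (LamF_as_series s z Hs0 Hz) as [_ ->].
  destruct (LamF_as_series s (RtoC x) Hs0 Hz) as [Sx ->].
  set (T := fun j => / INR (S j) * (2 * cer (INR (S j) * x) + Re (gpart s (INR (S j) * x)%R))).
  assert (Hg : forall j, Cmod (gpart s (INR (S j) * z)%C) <= Re (gpart s (INR (S j) * x)%R)).
  { intros j. pose proof (Re_INR_pos j z Hz) as Hj.
    destruct (Cmod_gpart_le s (INR (S j) * z)%C Hs Hj) as [g [G1 G2]].
    rewrite Re_RtoC_mult in G1. fold x in G1. rewrite G1, Re_RtoC. exact G2. }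
  assert (HT : forall j, Re ((/ INR (S j))%R * (2 * ce (INR (S j) * RtoC x) + gpart s (INR (S j) * RtoC x)))%C = T j).
  { intros j. unfold T. rewrite Re_RtoC_mult, Re_Cplus, Re_RtoC_mult, <- RtoC_mult.
    rewrite ce_RtoC by (apply Rmult_lt_0_compat; [apply INR_S_pos|auto]). reflexivity. }
  assert (ET : ex_series T) by (eapply ex_series_ext_R; [exact HT|]; apply summ_Re; auto).
  match goal with |- _ <= Re ?Q - _ + _ => replace (Re Q) with (Series T) by (symmetry; apply (Series_ext _ _ HT)) end.
  (* Index [O] is the term [j = 1], the only one in which [ce] is not replaced by its value on the
     real axis. *)
  set (Bd := fun j => match j with O => 2 * Cmod (ce z) + Re (gpart s x) | S _ => T j end).
  assert (EB : ex_series Bd).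
  { apply (ex_series_incr_1 Bd). apply (ex_series_incr_1 T). auto. }
  eapply Rle_trans; [apply Rle_abs|]. eapply Rle_trans; [apply re_le_Cmod|].
  eapply Rle_trans; [apply (CSer_Cmod_le_b _ Bd); auto|].
  - intros j. rewrite Cmod_mult, Cmod_R, Rabs_pos_eq by (left; apply Rinv_0_lt_compat, INR_S_pos).
    destruct j as [|j].
    + unfold Bd. replace (INR 1) with 1 by reflexivity. rewrite Rinv_1, Rmult_1_l, Cmult_1_l.
      specialize (Hg 0%nat). replace (INR 1) with 1 in Hg by reflexivity. rewrite Rmult_1_l, Cmult_1_l in Hg.
      eapply Rle_trans; [apply Cmod_triangle|]. rewrite Cmod_mult, Cmod_R, Rabs_pos_eq by lra. lra.
    + unfold Bd, T. apply Rmult_le_compat_l; [left; apply Rinv_0_lt_compat, INR_S_pos|].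
      eapply Rle_trans; [apply Cmod_triangle|]. rewrite Cmod_mult, Cmod_R, Rabs_pos_eq by lra.
      apply Rplus_le_compat; [|apply Hg]. apply Rmult_le_compat_l; [lra|].
      pose proof (Cmod_ce_cer _ (Re_INR_pos (S j) z Hz)) as H. rewrite Re_RtoC_mult in H. exact H.
  - rewrite (Series_incr_1 Bd), (Series_incr_1 T) by auto.
    assert (E0 : T 0%nat = 2 * cer x + Re (gpart s x)).
    { unfold T. replace (INR 1) with 1 by reflexivity. rewrite Rinv_1, !Rmult_1_l. auto. }
    rewrite E0. unfold Bd at 1. right.
    change (Series (fun k => Bd (S k))) with (Series (fun k => T (S k))). ring.
Qed.

Lemma sin_cubic u : 0 <= u -> u - u ^ 3 / 6 <= sin u.
Proof.
  intros Hu. destruct (MVT_gen (fun u => sin u - u + u ^ 3 / 6) 0 u (fun u => cos u - 1 + u ^ 2 / 2)) as [c [_ Hc]].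
  - intros t _. auto_derive; auto. field.
  - intros t _. apply continuity_pt_filterlim. apply (continuous_of_derivable (fun u => sin u - u + u ^ 3 / 6)). intros v. auto_derive. auto.
  - rewrite sin_0 in Hc. pose proof (one_minus_cos_le c).
    assert (0 <= (cos c - 1 + c ^ 2 / 2) * (u - 0)) by (apply Rmult_le_pos; lra). lra.
Qed.

(** The modulus of [exp z - 1] is [2 exp (r / 2) |sinh (z / 2)|], hence at least [2 sin (th / 2)].
    The constant [0.5885] is [1 - u ^ 2 / 6] at [u = PI / 2] rounded down, and [1.7] its inverse
    rounded up. *)
Lemma Cmod_ce_vline r th : 0 < r -> 0 < th <= PI -> Cmod (ce (vline r th)) <= 1.7 / th.
Proof.
  intros Hr Hth. pose proof PI_bounds. set (z := vline r th).
  assert (Hs : 0.5885 * (th / 2) <= sin (th / 2)).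
  { eapply Rle_trans; [|apply sin_cubic; lra]. set (u := th / 2).
    assert (0 < u <= 1.5708) by (unfold u; lra). nra. }
  assert (B : 0.5885 * th <= Cmod (Cexp z - 1)%C).
  { rewrite Cexp_sub1_csh, !Cmod_mult, Cmod_R, Cmod_Cexp, (Rabs_pos_eq 2) by lra.
    assert (E : Re (z / 2)%C = r / 2).
    { replace (z / 2)%C with ((/ 2)%R * z)%C by (rewrite RtoC_inv by lra; field).
      rewrite Re_RtoC_mult. simpl. field. }
    assert (E' : Im (z / 2)%C = th / 2) by (rewrite Im_div_R by lra; reflexivity).
    rewrite E. pose proof (Cmod2_csh (z / 2)%C) as C2. rewrite E' in C2.
    assert (sin (th / 2) <= Cmod (csh (z / 2))).
    { apply Rsqr_incr_0_var; [|apply Cmod_ge_0]. rewrite !Rsqr_pow2, C2.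
      pose proof (pow2_ge_0 ((exp (Re (z / 2)%C) - exp (- Re (z / 2)%C)) / 2)). lra. }
    pose proof (exp_ineq1_le (r / 2)). pose proof (Cmod_ge_0 (csh (z / 2))). nra. }
  unfold ce. rewrite Cmod_inv by (apply Cmod_gt_0; lra).
  apply Rle_trans with (/ (0.5885 * th)); [apply Rinv_le_contravar; lra|].
  apply Rmult_le_reg_r with (0.5885 * th); [lra|]. rewrite Rinv_l by lra.
  replace (1.7 / th * (0.5885 * th)) with (1.7 * 0.5885) by (field; lra). lra.
Qed.

Lemma cer_lower r : 0 < r < 1 -> / r - 1 <= cer r.
Proof.
  intros Hr. unfold cer. pose proof (exp_ineq1 r ltac:(lra)) as H1.
  assert (H2 : exp r <= / (1 - r)).
  { pose proof (exp_ineq1_le (- r)) as H. rewrite exp_Ropp in H.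
    rewrite <- (Rinv_inv (exp r)). apply Rinv_le_contravar; lra. }
  replace (/ r - 1) with (/ (/ (1 - r) - 1)) by (field; lra).
  apply Rinv_le_contravar; lra.
Qed.

Lemma abs_is_RInt_le (f : R -> R) (a b I M : R) : a <= b -> is_RInt f a b I ->
  (forall t, a <= t <= b -> Rabs (f t) <= M) -> Rabs I <= (b - a) * M.
Proof.
  intros Hab HI HM. rewrite <- (is_RInt_unique _ _ _ _ HI).
  apply abs_RInt_le_const; auto. eexists; exact HI.
Qed.

(** * Estimates on the pieces of the contour *)

Section Estimate.

Variables (n : nat) (b : nat -> R) (s A Y rho r N : R).
Hypothesis Hs : s = 3 \/ s = 5.
Hypothesis HA : A = PI ^ 2 / 6 * (5 / 2 - / (2 * s)).
Hypothesis HY : 116 <= Y.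
Hypothesis HR : rho = A / Y.
Hypothesis Hr : r = rho * cos (PI / 4).
Hypothesis HN : N = INR n - (1 + s) / 24.
Hypothesis HYN : Y ^ 2 = A * N.
Hypothesis Hb : coefs b.
Hypothesis Hgen : forall z, 0 < Re z -> CSer (qterm b z) = Cexp (LamF s z).

Let c := cos (PI / 4).

(** The two values are [7 PI ^ 2 / 18] for [s = 3] and [2 PI ^ 2 / 5] for [s = 5]. *)
Lemma est_A : 3.83 <= A <= 3.948.
Proof. pose proof PI_bounds. rewrite HA. destruct Hs as [-> | ->]; nra. Qed.

Lemma est_c : c * c = 1 / 2 /\ 0.707 < c < 0.70711.
Proof.
  pose proof PI_bounds. assert (Hc : 0 < c) by (apply cos_gt_0; lra).
  pose proof (sin2_cos2 (PI / 4)) as H1. rewrite sin_cos_PI4 in H1. unfold Rsqr in H1. fold c in H1.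
  assert (c * c = 1 / 2) by lra. split; auto. split; nra.
Qed.

(** At the saddle point the two parts of the exponent are equal; [0.0341] is [3.948 / 116] rounded
    up. *)
Lemma est_R : 0 < rho /\ rho <= 0.0341 /\ A / rho = Y /\ N * rho = Y.
Proof.
  pose proof est_A as EA. assert (HR0 : 0 < rho) by (rewrite HR; apply Rdiv_lt_0_compat; lra).
  assert (E : rho * Y = A) by (rewrite HR; field; lra).
  split; auto. split; [nra|]. split.
  - rewrite HR. field. lra.
  - rewrite HR. replace (N * (A / Y)) with ((A * N) / Y) by (field; lra). rewrite <- HYN. field. lra.
Qed.

Lemma est_r : 0 < r /\ r <= 0.02412 /\ A / r = 2 * c * Y /\ N * r = c * Y.
Proof.
  destruct est_R as [R1 [R2 [R3 R4]]]. destruct est_c as [C1 C2]. pose proof est_A as EA. fold c in Hr.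
  assert (0 < r) by (rewrite Hr; nra). split; auto. split; [rewrite Hr; nra|]. split.
  - rewrite <- R3, Hr. replace (A / (rho * c)) with (A / rho * (/ c)) by (field; lra).
    replace (/ c) with (2 * c); [ring|]. apply Rmult_eq_reg_l with c; [|lra]. rewrite Rinv_r by lra. lra.
  - rewrite <- R4, Hr. ring.
Qed.

(** For positive [s] this amounts to [5 s - 1 <= 24], with equality at [s = 5]; here [k <= 2] is
    decisive. The decay of the dual product thus compensates the whole growth of [exp (A / z)]. *)
Lemma est_dual : A <= 4 * PI ^ 2 / (2 * s).
Proof. pose proof PI_bounds. rewrite HA. destruct Hs as [-> | ->]; nra. Qed.

Lemma est_s : 0 < s /\ 1 <= s.
Proof. destruct Hs as [-> | ->]; lra. Qed.

Lemma est_transform z : 0 < Re z ->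
  (CSer (qterm b z) * Cexp (INR n * z) = z / (2 * PI)%R * Cexp (A / z + N * z) * Cexp (LamD s z))%C.
Proof.
  intros Hz. destruct est_s as [S1 S2]. rewrite Hgen, LamF_transform by auto. rewrite <- HA.
  assert (Hz0 : z <> 0) by (apply Re_pos_neq0; auto).
  replace (A / z + N * z)%C with ((A / z - ((1 + s) / 24)%R * z) + INR n * z)%C.
  - rewrite Cexp_plus. ring.
  - rewrite HN, RtoC_minus. ring.
Qed.

Lemma est_arc_exponent t : 0 < Re (arc rho t) -> (A / arc rho t + N * arc rho t)%C = RtoC (2 * Y * cos t).
Proof.
  intros Hz. assert (Hz0 : arc rho t <> 0) by (apply Re_pos_neq0; auto).
  destruct est_R as [R1 [R2 [R3 R4]]].
  assert (E1 : N * rho * rho = A) by (rewrite R4, HR; field; lra).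
  assert (E2 : Y * rho = A) by (rewrite HR; field; lra).
  assert (E : (A + N * (arc rho t * arc rho t) = (2 * Y * cos t)%R * arc rho t)%C).
  { apply C_eq.
    - rewrite Re_Cplus, !Re_RtoC_mult, Re_Cmult. unfold arc. simpl.
      pose proof (sin2_cos2 t) as H. unfold Rsqr in H.
      replace (N * (rho * cos t * (rho * cos t) - rho * sin t * (rho * sin t))) with (N * rho * rho * (cos t * cos t - sin t * sin t)) by ring.
      replace (2 * Y * cos t * (rho * cos t)) with (2 * (Y * rho) * (cos t * cos t)) by ring.
      rewrite E1, E2. replace (sin t * sin t) with (1 - cos t * cos t) by lra. ring.
    - rewrite Im_Cplus, !Im_RtoC_mult, Im_Cmult. unfold arc. simpl.
      replace (N * (rho * cos t * (rho * sin t) + rho * sin t * (rho * cos t))) with (N * rho * rho * (2 * cos t * sin t)) by ring.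
      replace (2 * Y * cos t * (rho * sin t)) with (Y * rho * (2 * cos t * sin t)) by ring.
      rewrite E1, E2. ring. }
  transitivity ((A + N * (arc rho t * arc rho t)) / arc rho t)%C; [field; auto|]. rewrite E. field. auto.
Qed.

(** One factor [z] comes from the parametrization and one from the weight; the real part of [z ^ 2]
    supplies the [cos (2 t)] that selects the Bessel order 2. The dual product differs from 1 by at
    most a multiple of [exp (- Y cos t)], so the error is of size [exp (Y cos t) <= exp Y]. *)
Lemma est_arc t : 0 <= t <= PI / 4 ->
  Rabs (Re (arc rho t * (CSer (qterm b (arc rho t)) * Cexp (INR n * arc rho t)))%C
        - rho ^ 2 / (2 * PI) * (cos (2 * t) * exp (2 * Y * cos t))) <= rho ^ 2 / (2 * PI) * (16 * exp 6 * exp Y).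
Proof.
  intros Ht. pose proof PI_bounds as HP. destruct est_R as [R1 [R2 [R3 R4]]]. destruct est_c as [C1 C2].
  destruct est_s as [S1 S2]. pose proof est_A as EA. pose proof est_dual as ED.
  assert (Hct : c <= cos t <= 1).
  { split; [|apply COS_bound]. apply cos_decr_1; lra. }
  assert (Hz : 0 < Re (arc rho t)) by (simpl; nra).
  rewrite est_transform, est_arc_exponent, Cexp_RtoC by auto.
  set (D := Cexp (LamD s (arc rho t))).
  assert (Ezz : (arc rho t * arc rho t)%C = (rho ^ 2 * cos (2 * t), rho ^ 2 * sin (2 * t))).
  { rewrite cos_2a, sin_2a. apply C_eq; [rewrite Re_Cmult|rewrite Im_Cmult]; simpl; ring. }
  assert (Em : Cmod (arc rho t) ^ 2 = rho ^ 2).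
  { rewrite Cmod2_alt. simpl. pose proof (sin2_cos2 t) as H. unfold Rsqr in H.
    transitivity (rho * rho * (sin t * sin t + cos t * cos t)); [ring|]. rewrite H. ring. }
  assert (HP2 : RtoC (2 * PI) <> 0) by (apply RtoC_neq0; lra).
  set (E := exp (2 * Y * cos t)).
  replace (arc rho t * (arc rho t / (2 * PI)%R * E * D))%C with
    ((E / (2 * PI))%R * (arc rho t * arc rho t) + (E / (2 * PI))%R * (arc rho t * arc rho t) * (D - 1))%C
    by (rewrite RtoC_div by lra; field; auto).
  rewrite Re_Cplus, Re_RtoC_mult. rewrite Ezz at 1. simpl (Re (_, _)).
  replace (E / (2 * PI) * (rho * (rho * 1) * cos (2 * t))) with (rho ^ 2 / (2 * PI) * (cos (2 * t) * E)) by (simpl; field; lra).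
  match goal with |- Rabs (?p + ?q - ?p) <= _ => replace (p + q - p) with q by ring end.
  eapply Rle_trans; [apply re_le_Cmod|]. rewrite !Cmod_mult, Cmod_R.
  assert (HE : 0 < E) by apply exp_pos.
  rewrite Rabs_pos_eq by (left; apply Rdiv_lt_0_compat; lra).
  replace (Cmod (arc rho t) * Cmod (arc rho t)) with (rho ^ 2) by (rewrite <- Em; ring).
  assert (Einv : Re (/ arc rho t)%C = cos t / rho).
  { rewrite Re_inv_formula, Em. simpl. field. lra. }
  assert (Hbe : Y * cos t <= 4 * PI ^ 2 / (2 * s) * Re (/ arc rho t)%C).
  { rewrite Einv. apply Rle_trans with (A * (cos t / rho)).
    - right. rewrite <- R3. field. lra.
    - apply Rmult_le_compat_r; auto. left; apply Rdiv_lt_0_compat; lra. }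
  assert (HYc : 1 <= Y * cos t) by nra.
  destruct (Cexp_LamD_bounds s (arc rho t) S2 Hz ltac:(lra)) as [_ B]. fold D in B.
  assert (B2 : E * Cmod (D - 1)%C <= 16 * exp 6 * exp Y).
  { set (be := 4 * PI ^ 2 / (2 * s) * Re (/ arc rho t)%C) in *.
    apply Rle_trans with (E * (16 * exp 6 * exp (- be))); [apply Rmult_le_compat_l; lra|].
    replace (E * (16 * exp 6 * exp (- be))) with (16 * exp 6 * (E * exp (- be))) by ring.
    pose proof (exp_pos 6). apply Rmult_le_compat_l; [lra|]. unfold E. rewrite <- exp_plus. apply exp_le_mono. nra. }
  replace (E / (2 * PI) * rho ^ 2 * Cmod (D - 1)%C) with (rho ^ 2 / (2 * PI) * (E * Cmod (D - 1)%C)) by (field; lra).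
  apply Rmult_le_compat_l; auto. left. apply Rdiv_lt_0_compat; nra.
Qed.

(** For [th >= r] one has [Re (1 / z) <= 1 / (2 r)], so the exponent is at most
    [A / (2 r) + N r = 2 c Y], and [2 c = sqrt 2] lies below [1.527]. *)
Lemma est_near th : r <= th <= 10 * r ->
  Rabs (Re (CSer (qterm b (vline r th)) * Cexp (INR n * vline r th))%C) <= 11 * r / (2 * PI) * (exp 6 * exp (2 * c * Y)).
Proof.
  intros Hth. pose proof PI_bounds as HP. destruct est_r as [r1 [r2 [r3 r4]]]. destruct est_c as [C1 C2].
  destruct est_s as [S1 S2]. pose proof est_A as EA. pose proof est_dual as ED.
  assert (Hz : 0 < Re (vline r th)) by (simpl; lra).
  rewrite est_transform by auto. set (z := vline r th).
  eapply Rle_trans; [apply re_le_Cmod|]. assert (HP2 : RtoC (2 * PI) <> 0) by (apply RtoC_neq0; lra).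
  rewrite !Cmod_mult, Cmod_div, Cmod_R, (Rabs_pos_eq (2 * PI)), Cmod_Cexp by (auto; lra).
  assert (Em : Cmod z ^ 2 = r ^ 2 + th ^ 2) by (rewrite Cmod2_alt; reflexivity).
  assert (Hq : 0 < r ^ 2 + th ^ 2) by nra.
  assert (Einv : Re (/ z)%C = r / (r ^ 2 + th ^ 2)) by (rewrite Re_inv_formula, Em; reflexivity).
  assert (Hm : Cmod z <= 11 * r).
  { apply Rsqr_incr_0_var; [|lra]. rewrite !Rsqr_pow2, Em. nra. }
  assert (Hi1 : Re (/ z)%C <= / (2 * r)).
  { rewrite Einv. apply Rmult_le_reg_r with ((r ^ 2 + th ^ 2) * (2 * r)); [nra|].
    replace (r / (r ^ 2 + th ^ 2) * ((r ^ 2 + th ^ 2) * (2 * r))) with (2 * r ^ 2) by (field; lra).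
    replace (/ (2 * r) * ((r ^ 2 + th ^ 2) * (2 * r))) with (r ^ 2 + th ^ 2) by (field; lra). nra. }
  assert (Ci_sqr : / (101 * r) <= Re (/ z)%C).
  { rewrite Einv. apply Rmult_le_reg_r with ((r ^ 2 + th ^ 2) * (101 * r)); [nra|].
    replace (r / (r ^ 2 + th ^ 2) * ((r ^ 2 + th ^ 2) * (101 * r))) with (101 * r ^ 2) by (field; lra).
    replace (/ (101 * r) * ((r ^ 2 + th ^ 2) * (101 * r))) with (r ^ 2 + th ^ 2) by (field; lra). nra. }
  (* [101 = 1 + 10 ^ 2] comes from [th <= 10 r]. As [A / r = 2 c Y], it suffices that
     [2 c Y >= 101], which follows from [Y >= 116]. *)
  assert (Hbe : 1 <= 4 * PI ^ 2 / (2 * s) * Re (/ z)%C).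
  { assert (0 < / (101 * r)) by (apply Rinv_0_lt_compat; lra).
    apply Rle_trans with (A * / (101 * r)); [|apply Rmult_le_compat; lra].
    replace (A * / (101 * r)) with (A / r / 101) by (field; lra). rewrite r3. nra. }
  destruct (Cexp_LamD_bounds s z S2 Hz Hbe) as [B _].
  assert (Hre : Re (A / z + N * z)%C <= 2 * c * Y).
  { rewrite Re_Cplus. unfold Cdiv. rewrite !Re_RtoC_mult.
    assert (A * Re (/ z)%C <= c * Y).
    { apply Rle_trans with (A * / (2 * r)); [apply Rmult_le_compat_l; lra|].
      replace (A * / (2 * r)) with (A / r / 2) by (field; lra). rewrite r3. lra. }
    assert (N * Re z = c * Y) by (simpl; exact r4). lra. }
  apply exp_le_mono in Hre. rewrite Rmult_assoc. apply Rmult_le_compat.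
  - apply Rmult_le_pos; [apply Cmod_ge_0|left; apply Rinv_0_lt_compat; lra].
  - apply Rmult_le_pos; [left; apply exp_pos|apply Cmod_ge_0].
  - apply Rmult_le_compat_r; auto. left; apply Rinv_0_lt_compat; lra.
  - rewrite Rmult_comm. apply Rmult_le_compat; auto; [apply Cmod_ge_0|left; apply exp_pos].
Qed.

(* The exponent is at most [c * (3 - 3.32 / A) * Y + 8], and [c * (3 - 3.32 / A) < 1.527]. *)
Lemma est_far th : 10 * r <= th <= PI ->
  Rabs (Re (CSer (qterm b (vline r th)) * Cexp (INR n * vline r th))%C) <= r / (2 * PI) * (exp 8 * exp (1.527 * Y)).
Proof.
  intros Hth. pose proof PI_bounds as HP. destruct est_r as [r1 [r2 [r3 r4]]]. destruct est_c as [C1 C2].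
  destruct est_s as [S1 S2]. pose proof est_A as EA. pose proof est_dual as ED.
  assert (Hz : 0 < Re (vline r th)) by (simpl; lra).
  rewrite Hgen by auto. set (z := vline r th).
  eapply Rle_trans; [apply re_le_Cmod|]. rewrite Cmod_mult, !Cmod_Cexp, Re_RtoC_mult.
  assert (Erz : Re z = r) by reflexivity. rewrite Erz.
  pose proof (LamF_minor s z Hs Hz) as M. rewrite Erz in M.
  pose proof (Cmod_ce_vline r th r1 ltac:(lra)) as Q1. fold z in Q1.
  pose proof (cer_lower r ltac:(lra)) as Q2.
  assert (Q3 : 1.7 / th <= 0.17 * / r).
  { replace (0.17 * / r) with (1.7 * / (10 * r)) by (rewrite Rinv_mult; lra).
    apply Rmult_le_compat_l; [lra|]. apply Rinv_le_contravar; lra. }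
  assert (Tr : exp (Re (LamF s (RtoC r))) <= r / (2 * PI) * (exp (A / r - (1 + s) / 24 * r) * exp 6)).
  { rewrite <- Cmod_Cexp, LamF_transform by (auto; simpl; lra). rewrite <- HA.
    rewrite !Cmod_mult, Cmod_Cexp.
    replace (A / r - ((1 + s) / 24)%R * r)%C with (RtoC (A / r - (1 + s) / 24 * r)).
    2: { rewrite RtoC_minus, RtoC_div, RtoC_mult by lra. reflexivity. }
    rewrite Re_RtoC, <- RtoC_div, Cmod_R, Rabs_pos_eq by (try lra; left; apply Rdiv_lt_0_compat; lra).
    rewrite Rmult_assoc. apply Rmult_le_compat_l; [left; apply Rdiv_lt_0_compat; lra|].
    apply Rmult_le_compat_l; [left; apply exp_pos|]. apply Cexp_LamD_bounds; auto.
    rewrite <- RtoC_inv, Re_RtoC by lra.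
    apply Rle_trans with (A * / r).
    - change (A * / r) with (A / r). rewrite r3. nra.
    - apply Rmult_le_compat_r; auto. left; apply Rinv_0_lt_compat; lra. }
  assert (Hir : 0 < / r) by (apply Rinv_0_lt_compat; lra).
  (* [1.66 = 2 (1 - 0.17)] is the gain from the term [j = 1] when [th >= 10 r]; the summand 2 is
     twice the loss in [cer_lower]. *)
  apply Rle_trans with (exp (Re (LamF s (RtoC r))) * exp (2 - 1.66 * / r + INR n * r)).
  - rewrite <- !exp_plus. apply exp_le_mono. lra.
  - apply Rle_trans with (r / (2 * PI) * (exp (A / r - (1 + s) / 24 * r) * exp 6) * exp (2 - 1.66 * / r + INR n * r)).
    { apply Rmult_le_compat_r; auto. left; apply exp_pos. }
    rewrite Rmult_assoc. apply Rmult_le_compat_l; [left; apply Rdiv_lt_0_compat; lra|].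
    rewrite <- !exp_plus. apply exp_le_mono.
    assert (EN : INR n * r = c * Y + (1 + s) / 24 * r) by (rewrite <- r4, HN; ring).
    assert (Ei : / r = 2 * c * Y / A) by (rewrite <- r3; field; lra).
    assert (Hin : 0.8409 * c * Y <= 1.66 * / r).
    { rewrite Ei. replace (1.66 * (2 * c * Y / A)) with (3.32 / A * (c * Y)) by (unfold Rdiv; lra).
      rewrite Rmult_assoc. apply Rmult_le_compat_r; [nra|].
      apply Rmult_le_reg_r with A; [lra|]. replace (3.32 / A * A) with 3.32 by (field; lra). lra. }
    rewrite EN, r3. nra.
Qed.

(** The arc supplies the Bessel integrand only on [[0, PI / 4]]. Completing it to [[0, PI]] costs a
    multiple of [exp (2 c Y)], because [cos t <= c] on the rest. *)
Lemma main_estimate :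
  Rabs (b n - rho ^ 2 / (2 * PI) * besselI 2 (2 * Y)) <= 30 * exp (1.527 * Y).
Proof.
  pose proof PI_bounds as HP. destruct est_r as [r1 [r2 [r3 r4]]]. destruct est_c as [C1 C2].
  destruct est_R as [R1 [R2 [R3 R4]]].
  destruct (contour_formula b n rho r Hb r1 Hr ltac:(lra)) as [I1 [I2 [H1 [H2 H3]]]].
  set (G := fun t => rho ^ 2 / (2 * PI) * (cos (2 * t) * exp (2 * Y * cos t))).
  assert (HG : is_RInt G 0 PI (rho ^ 2 / (2 * PI) * (PI * besselI 2 (2 * Y)))).
  { apply (is_RInt_scal (V := R_NormedModule)), besselI2_integral. }
  assert (XG : forall u v, ex_RInt G u v).
  { intros u v. apply ex_RInt_of_derivable. intros t. unfold G. auto_derive. auto. }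
  set (g1 := RInt G 0 (PI / 4) : R). set (g2 := RInt G (PI / 4) PI : R).
  assert (HG1 : is_RInt G 0 (PI / 4) g1) by (apply (RInt_correct (V := R_CompleteNormedModule)); auto).
  assert (HG2 : is_RInt G (PI / 4) PI g2) by (apply (RInt_correct (V := R_CompleteNormedModule)); auto).
  assert (EG : rho ^ 2 / (2 * PI) * (PI * besselI 2 (2 * Y)) = g1 + g2).
  { pose proof (is_RInt_Chasles _ _ _ _ _ _ HG1 HG2) as Hc.
    apply (is_RInt_unique (V := R_CompleteNormedModule)) in Hc. apply (is_RInt_unique (V := R_CompleteNormedModule)) in HG. rewrite HG in Hc. exact Hc. }
  assert (B1 : Rabs (I1 - g1) <= (PI / 4 - 0) * (rho ^ 2 / (2 * PI) * (16 * exp 6 * exp Y))).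
  { eapply abs_is_RInt_le; [lra|apply (is_RInt_minus (V := R_NormedModule) _ _ _ _ _ _ H1 HG1)|].
    intros t Ht. apply (est_arc t Ht). }
  assert (B2 : Rabs g2 <= (PI - PI / 4) * (rho ^ 2 / (2 * PI) * exp (2 * c * Y))).
  { eapply abs_is_RInt_le; [lra|exact HG2|]. intros t Ht. unfold G.
    assert (0 < rho ^ 2 / (2 * PI)) by (apply Rdiv_lt_0_compat; nra).
    rewrite Rabs_mult, (Rabs_pos_eq (rho ^ 2 / (2 * PI))) by lra. apply Rmult_le_compat_l; [lra|].
    rewrite Rabs_mult, (Rabs_pos_eq (exp _)) by (left; apply exp_pos).
    rewrite <- (Rmult_1_l (exp (2 * c * Y))). apply Rmult_le_compat; [apply Rabs_pos|left; apply exp_pos| |].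
    - apply Rabs_le, COS_bound.
    - apply exp_le_mono. assert (cos t <= c) by (apply cos_decr_1; lra). nra. }
  assert (X2 : ex_RInt (fun th => Re (CSer (qterm b (vline r th)) * Cexp (INR n * vline r th))%C) r PI) by (eexists; exact H2).
  set (F2 := fun th => Re (CSer (qterm b (vline r th)) * Cexp (INR n * vline r th))%C) in *.
  assert (X21 : ex_RInt F2 r (10 * r)) by (apply (ex_RInt_Chasles_1 (V := R_CompleteNormedModule)) with PI; auto; lra).
  assert (X22 : ex_RInt F2 (10 * r) PI) by (apply (ex_RInt_Chasles_2 (V := R_CompleteNormedModule)) with r; auto; lra).
  destruct X21 as [J1 HJ1]. destruct X22 as [J2 HJ2].
  assert (EJ : I2 = J1 + J2).
  { pose proof (is_RInt_Chasles _ _ _ _ _ _ HJ1 HJ2) as Hc.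
    apply (is_RInt_unique (V := R_CompleteNormedModule)) in Hc. apply (is_RInt_unique (V := R_CompleteNormedModule)) in H2. rewrite H2 in Hc. exact Hc. }
  assert (B3 : Rabs J1 <= (10 * r - r) * (11 * r / (2 * PI) * (exp 6 * exp (2 * c * Y)))).
  { eapply abs_is_RInt_le; [lra|exact HJ1|]. intros th Hth. apply est_near; auto. }
  assert (B4 : Rabs J2 <= (PI - 10 * r) * (r / (2 * PI) * (exp 8 * exp (1.527 * Y)))).
  { eapply abs_is_RInt_le; [lra|exact HJ2|]. intros th Hth. apply est_far; auto. }
  set (E := exp (1.527 * Y)) in *. assert (HE : 0 < E) by apply exp_pos.
  assert (He6 : 0 < exp 6 <= 729).
  { split; [apply exp_pos|]. replace 6 with (INR 6 * 1) by (simpl; ring). rewrite <- exp_pow.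
    replace 729 with (3 ^ 6) by ring. pose proof exp_le_3. pose proof (exp_pos 1). apply pow_incr. lra. }
  assert (He8 : 0 < exp 8 <= 6561).
  { split; [apply exp_pos|]. replace 8 with (INR 8 * 1) by (simpl; ring). rewrite <- exp_pow.
    replace 6561 with (3 ^ 8) by ring. pose proof exp_le_3. pose proof (exp_pos 1). apply pow_incr. lra. }
  assert (D1 : 0 < exp Y <= E) by (split; [apply exp_pos|apply exp_le_mono; lra]).
  assert (D2 : 0 < exp (2 * c * Y) <= E) by (split; [apply exp_pos|apply exp_le_mono; nra]).
  assert (T1 : (PI / 4 - 0) * (rho ^ 2 / (2 * PI) * (16 * exp 6 * exp Y)) <= 2 * E).
  { replace ((PI / 4 - 0) * (rho ^ 2 / (2 * PI) * (16 * exp 6 * exp Y))) with (2 * rho ^ 2 * exp 6 * exp Y) by (field; lra).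
    assert (rho ^ 2 <= 0.0012) by nra. assert (0 < rho ^ 2) by nra.
    assert (2 * rho ^ 2 * exp 6 <= 2) by nra. assert (0 < 2 * rho ^ 2 * exp 6) by nra. apply Rmult_le_compat; lra. }
  assert (T2 : (PI - PI / 4) * (rho ^ 2 / (2 * PI) * exp (2 * c * Y)) <= E).
  { replace ((PI - PI / 4) * (rho ^ 2 / (2 * PI) * exp (2 * c * Y))) with (3 / 8 * rho ^ 2 * exp (2 * c * Y)) by (field; lra).
    assert (rho ^ 2 <= 0.0012) by nra. assert (0 < rho ^ 2) by nra. nra. }
  assert (T3 : (10 * r - r) * (11 * r / (2 * PI) * (exp 6 * exp (2 * c * Y))) <= 8 * E).
  { replace ((10 * r - r) * (11 * r / (2 * PI) * (exp 6 * exp (2 * c * Y)))) with (99 / (2 * PI) * r ^ 2 * exp 6 * exp (2 * c * Y)) by (field; lra).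
    assert (99 / (2 * PI) <= 15.8).
    { apply Rmult_le_reg_r with (2 * PI); [lra|]. replace (99 / (2 * PI) * (2 * PI)) with 99 by (field; lra). lra. }
    assert (0 < 99 / (2 * PI)) by (apply Rdiv_lt_0_compat; lra).
    assert (r ^ 2 <= 0.000582) by nra. assert (0 < r ^ 2) by nra.
    assert (99 / (2 * PI) * r ^ 2 <= 15.8 * 0.000582) by (apply Rmult_le_compat; lra).
    assert (0 < 99 / (2 * PI) * r ^ 2) by (apply Rmult_lt_0_compat; lra).
    assert (99 / (2 * PI) * r ^ 2 * exp 6 <= 15.8 * 0.000582 * 729) by (apply Rmult_le_compat; lra).
    assert (0 < 99 / (2 * PI) * r ^ 2 * exp 6) by (apply Rmult_lt_0_compat; lra).
    apply Rmult_le_compat; lra. }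
  assert (T4 : (PI - 10 * r) * (r / (2 * PI) * (exp 8 * E)) <= 80 * E).
  { apply Rle_trans with (PI * (r / (2 * PI) * (exp 8 * E))).
    - apply Rmult_le_compat_r; [|lra]. apply Rmult_le_pos; [left; apply Rdiv_lt_0_compat; lra|]. apply Rmult_le_pos; lra.
    - replace (PI * (r / (2 * PI) * (exp 8 * E))) with (r / 2 * exp 8 * E) by (field; lra).
      apply Rmult_le_compat_r; [lra|]. nra. }
  apply Rmult_le_reg_l with PI; [lra|].
  rewrite <- (Rabs_pos_eq PI) at 1 by lra. rewrite <- Rabs_mult.
  replace (PI * (b n - rho ^ 2 / (2 * PI) * besselI 2 (2 * Y))) with ((I1 - g1) + - g2 + J1 + J2).
  2: { rewrite Rmult_minus_distr_l, H3, EJ.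
       replace (PI * (rho ^ 2 / (2 * PI) * besselI 2 (2 * Y))) with (rho ^ 2 / (2 * PI) * (PI * besselI 2 (2 * Y))) by ring.
       rewrite EG. ring. }
  eapply Rle_trans; [apply Rabs_triang|]. eapply Rle_trans; [apply Rplus_le_compat_r, Rabs_triang|].
  eapply Rle_trans; [apply Rplus_le_compat_r, Rplus_le_compat_r, Rabs_triang|]. rewrite Rabs_Ropp.
  (* The four errors add up to [2 + 1 + 8 + 80 = 91], and [30 PI > 91]. *)
  assert (91 * E <= PI * (30 * E)) by nra. lra.
Qed.

End Estimate.

(** * The error against the main term *)

Lemma exp_beats_pow9 Y : 116 <= Y -> 1100 * Y ^ 9 <= exp (0.473 * Y).
Proof.
  (* With [Y = 116 (1 + tau)] the claim reduces to [Y = 116]: since [0.473 * 116 > 54], the exponent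
     is at least [54 + 9 tau], and [exp (9 tau)] covers [(1 + tau) ^ 9]. *)
  intros HY. set (tau := Y / 116 - 1). assert (Ht : 0 <= tau) by (unfold tau; lra).
  assert (EY : Y = 116 * (1 + tau)) by (unfold tau; field).
  assert (P1 : (1 + tau) ^ 9 <= exp (9 * tau)).
  { replace (9 * tau) with (INR 9 * tau) by (simpl; ring). rewrite <- exp_pow. apply pow_incr.
    pose proof (exp_ineq1_le tau). lra. }
  (* [387 < 2.7 ^ 6], and [387 ^ 9] exceeds [1100 * 116 ^ 9]. *)
  assert (P2 : 387 ^ 9 <= exp 54).
  { replace 54 with (INR 9 * 6) by (simpl; ring). rewrite <- exp_pow. apply pow_incr. split; [lra|].
    replace 6 with (INR 6 * 1) by (simpl; ring). rewrite <- exp_pow.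
    pose proof exp_1_gt. apply Rle_trans with (2.7 ^ 6); [lra|]. apply pow_incr; lra. }
  rewrite EY, Rpow_mult_distr.
  apply Rle_trans with (exp 54 * exp (9 * tau)).
  - rewrite <- Rmult_assoc. apply Rmult_le_compat; auto; [|apply pow_le; lra|].
    + apply Rmult_le_pos; [lra|apply pow_le; lra].
    + eapply Rle_trans; [|exact P2]. lra.
  - rewrite <- exp_plus. apply exp_le_mono. lra.
Qed.

(** Here [14.66 <= 3.83 ^ 2], [6.2832] bounds [2 PI], and [5.04] is [(12 / 7) ^ 3] rounded up, with
    [12 / 7 = 4 / (7 / 3)]. Collecting constants, [30 * 5.04 * 6.2832 * 16 / 14.66 < 1100], which is
    the constant in [exp_beats_pow9]. *)
Lemma main_term_lower (A Y x : R) : 3.83 <= A -> 116 <= Y -> 0 < x -> 7 / 3 * x ^ 2 <= 4 * Y ^ 2 ->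
  30 * exp (1.527 * Y) <= (A / Y) ^ 2 / (2 * PI) * besselI 2 (2 * Y) * (1 / x ^ 6).
Proof.
  intros HA HY Hx Hxy. pose proof PI_bounds as HP.
  set (E := exp (2 * Y)).
  assert (HE1 : 8 * Y + 2 <= E).
  { unfold E. replace (2 * Y) with (Y + Y) by ring. rewrite exp_plus.
    pose proof (exp_ineq1_le Y). nra. }
  assert (Hm : exp (- (2 * Y)) <= 1) by (rewrite <- exp_0; apply exp_le_mono; lra).
  assert (HI : E / (16 * Y) <= besselI 2 (2 * Y)).
  { eapply Rle_trans; [|apply besselI2_lower; lra]. fold E.
    replace (E / (16 * Y)) with (E / 4 / (2 * (2 * Y))) by (field; lra).
    apply Rmult_le_compat_r; [left; apply Rinv_0_lt_compat; lra|]. lra. }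
  assert (HE : 0 < E) by apply exp_pos.
  assert (HK : 14.66 / (6.2832 * Y ^ 2) <= (A / Y) ^ 2 / (2 * PI)).
  { replace ((A / Y) ^ 2 / (2 * PI)) with (A ^ 2 / (2 * PI * Y ^ 2)) by (field; lra).
    assert (0 < Y ^ 2) by nra.
    apply Rmult_le_compat; [lra| |nra|].
    - left; apply Rinv_0_lt_compat; nra.
    - apply Rinv_le_contravar; nra. }
  assert (Hx6 : 0 < x ^ 6 <= 5.04 * Y ^ 6).
  { split; [apply pow_lt; auto|].
    assert (H2 : x ^ 2 <= 12 / 7 * Y ^ 2) by lra.
    replace (x ^ 6) with ((x ^ 2) ^ 3) by ring.
    apply Rle_trans with ((12 / 7 * Y ^ 2) ^ 3); [apply pow_incr; split; [nra|auto]|].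
    rewrite Rpow_mult_distr. replace ((Y ^ 2) ^ 3) with (Y ^ 6) by ring.
    apply Rmult_le_compat_r; [apply pow_le; lra|]. lra. }
  assert (HY2 : 0 < Y ^ 2) by nra.
  assert (HM : 14.66 / (6.2832 * Y ^ 2) * (E / (16 * Y)) <= (A / Y) ^ 2 / (2 * PI) * besselI 2 (2 * Y)).
  { apply Rmult_le_compat; auto; left; apply Rdiv_lt_0_compat; lra. }
  apply Rle_trans with (14.66 / (6.2832 * Y ^ 2) * (E / (16 * Y)) * (1 / x ^ 6)).
  2: { apply Rmult_le_compat_r; auto. left; apply Rdiv_lt_0_compat; lra. }
  apply Rmult_le_reg_r with (x ^ 6); [lra|].
  replace (14.66 / (6.2832 * Y ^ 2) * (E / (16 * Y)) * (1 / x ^ 6) * x ^ 6)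
    with (14.66 / 6.2832 / 16 * (E / Y ^ 3)) by (field; repeat split; lra).
  pose proof (exp_beats_pow9 Y HY) as H9.
  assert (EE : E = exp (1.527 * Y) * exp (0.473 * Y)) by (unfold E; rewrite <- exp_plus; f_equal; lra).
  set (F := exp (1.527 * Y)) in *. assert (HF : 0 < F) by apply exp_pos.
  assert (HY3 : 0 < Y ^ 3) by (apply pow_lt; lra). assert (HY6 : 0 < Y ^ 6) by (apply pow_lt; lra).
  apply Rle_trans with (30 * F * (5.04 * Y ^ 6)); [apply Rmult_le_compat_l; lra|].
  assert (G : 1100 * Y ^ 6 * F <= E / Y ^ 3).
  { apply Rmult_le_reg_r with (Y ^ 3); auto. replace (E / Y ^ 3 * Y ^ 3) with E by (field; lra).
    rewrite EE. replace (1100 * Y ^ 6 * F * Y ^ 3) with (F * (1100 * Y ^ 9)) by ring.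
    apply Rmult_le_compat_l; lra. }
  assert (G2 : 0 < Y ^ 6 * F) by (apply Rmult_lt_0_compat; auto). lra.
Qed.

Theorem theorem3p1 (k : nat) (hk : k = 1%nat \/ k = 2%nat)
  (Delta : nat -> R) (hDelta : is_broken_diamond k Delta)
  (n : nat) (hn : (1 <= n)%nat) (hx : 152 <= xk k n) :
  Mk k n * (1 - 1 / xk k n ^ 6) <= Delta n /\
  Delta n <= Mk k n * (1 + 1 / xk k n ^ 6).
Proof.
  pose proof PI_bounds as HP.
  set (x := xk k n) in *. set (al := alpha1 k). set (s := INR (2 * k + 1)).
  assert (Hs : s = 3 \/ s = 5) by (unfold s; destruct hk as [-> | ->]; simpl; lra).
  assert (Hsk : s = 2 * INR k + 1) by (unfold s; rewrite plus_INR, mult_INR; reflexivity).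
  assert (Hal : al = 5 / 2 - / (2 * s)).
  { unfold al, alpha1. rewrite Hsk. pose proof (pos_INR k). field. lra. }
  assert (Hal2 : 7 / 3 <= al) by (rewrite Hal; destruct Hs as [-> | ->]; lra).
  set (X := 24 * INR n - (2 * INR k + 2)).
  (* [sqrt] is 0 at nonpositive arguments, so [152 <= x] forces [X > 0]. *)
  assert (HX : 0 < X).
  { destruct (Rlt_dec 0 X) as [|Hn]; auto. exfalso.
    unfold x, xk in hx. fold X in hx. rewrite sqrt_neg_0 in hx by lra. lra. }
  assert (Hx2 : x ^ 2 = PI ^ 2 * X / 36).
  { unfold x, xk. fold X. replace ((PI * sqrt X / 6) ^ 2) with (PI ^ 2 * (sqrt X * sqrt X) / 36) by field.
    rewrite sqrt_sqrt by lra. reflexivity. }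
  set (N := INR n - (1 + s) / 24). assert (HN : X = 24 * N) by (unfold X, N; rewrite Hsk; field).
  set (A := PI ^ 2 / 6 * (5 / 2 - / (2 * s))). assert (HA : A = PI ^ 2 / 6 * al) by (unfold A; rewrite Hal; auto).
  set (Y := sqrt al * x / 2).
  assert (HY2 : Y ^ 2 = al * x ^ 2 / 4).
  { unfold Y. replace ((sqrt al * x / 2) ^ 2) with (sqrt al * sqrt al * x ^ 2 / 4) by field.
    rewrite sqrt_sqrt by lra. reflexivity. }
  assert (HY0 : 0 < Y) by (unfold Y; pose proof (sqrt_lt_R0 al ltac:(lra)); nra).
  (* [7 / 12 * 152 ^ 2] is about 13477, just above [116 ^ 2 = 13456]. *)
  assert (HY : 116 <= Y) by (assert (152 ^ 2 <= x ^ 2) by (apply pow_incr; lra); nra).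
  assert (HYN : Y ^ 2 = A * N) by (rewrite HY2, Hx2, HN, HA; field).
  assert (HA1 : 3.83 <= A) by (rewrite HA; nra).
  pose proof (main_estimate n Delta s A Y (A / Y) (A / Y * cos (PI / 4)) N Hs eq_refl HY eq_refl eq_refl eq_refl HYN
    (coefs_of_is_broken_diamond k Delta hDelta) (fun z Hz => broken_diamond_Cexp k Delta z hDelta Hz)) as M.
  assert (EM : Mk k n = (A / Y) ^ 2 / (2 * PI) * besselI 2 (2 * Y)).
  { unfold Mk. fold x al. f_equal.
    - replace ((A / Y) ^ 2 / (2 * PI)) with (A ^ 2 / (2 * PI * Y ^ 2)) by (field; lra).
      rewrite HY2, HA. field. lra.
    - f_equal. unfold Y. field. }
  pose proof (main_term_lower A Y x HA1 HY ltac:(lra) ltac:(rewrite HY2; nra)) as L.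
  rewrite <- EM in M, L. apply Rabs_le_between in M.
  rewrite Rmult_minus_distr_l, Rmult_plus_distr_l, Rmult_1_r. lra.
Qed.
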